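(* Suppose $K_0\subset K\subset\mathbb{R}^n$ are such that $K_0$ is a linear subspace and $K$ is a closed convex cone. Then for $\mu\in K_0$ (i.e. when $Y=\mu+\xi$ with $\mu \in K_0$), $$d_{\mathrm{TV}}\left(\frac{T(Y)-m_0}{\sigma_0},\mathcal{N}(0,1)\right)\le\frac{8}{\sqrt{\delta_K-\delta_{K_0}}}.$$
   Context: Model: $Y=\mu+\xi$, $\xi$ standard Gaussian in $\mathbb{R}^n$; $\|\cdot\|$ is the Euclidean norm and $\Pi_C$ the metric projection onto a closed convex set $C$. The likelihood ratio statistic for $H_0:\mu\in K_0$ versus $H_1:\mu\in K$ is $$T(Y)=\|Y-\Pi_{K_0}(Y)\|^2-\|Y-\Pi_K(Y)\|^2.$$ $m_\mu=\mathbb{E}_\mu T(Y)$ and $\sigma_\mu^2=\mathrm{Var}_\mu(T(Y))$ under mean $\mu$; $m_0,\sigma_0$ are these quantities at $\mu=0$ (they are the same for all $\mu\in K_0$). The statistical dimension of a closed convex cone $C$ is $\delta_C=\mathbb{E}\|\Pi_C(\xi)\|^2$ (so $\delta_{K_0}=\dim K_0$). $d_{\mathrm{TV}}(X,Z)=\sup_{B\text{ Borel}}|\mathbb{P}(X\in B)-\mathbb{P}(Z\in B)|$. The bound is read as $+\infty$ if $\delta_K=\delta_{K_0}$. *)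

(* Defs.v *)
From HB Require Import structures.
From mathcomp Require Import all_boot all_order all_algebra.
From mathcomp Require Import all_classical all_reals all_analysis.

Set Implicit Arguments.
Unset Strict Implicit.
Unset Printing Implicit Defensive.

Import Order.TTheory GRing.Theory Num.Theory.
Import numFieldNormedType.Exports.

Local Open Scope classical_set_scope.
Local Open Scope ring_scope.

(* The norm `|x| that MathComp-Analysis puts on 'rV[R]_n is the sup norm, hence
   a separate Euclidean norm.  Both induce the product topology, so [closed]
   has its usual meaning in R^n. *)
Definition enorm (R : realType) (n : nat) (x : 'rV[R]_n) : R :=
  Num.sqrt (\sum_(i < n) x ord0 i ^+ 2).

(* Metric projection: the point of [C] nearest to [x], which exists and is
   unique when [C] is nonempty, closed and convex (0 is a default value when
   there is no nearest point). *)
Definition metric_proj (R : realType) (n : nat) (C : set 'rV[R]_n)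
    (x : 'rV[R]_n) : 'rV[R]_n :=
  xget 0 [set p | C p /\ forall c, C c -> enorm (x - p) <= enorm (x - c)].

Definition closed_convex_cone (R : realType) (n : nat) (K : set 'rV[R]_n) :
    Prop :=
  [/\ closed K, convex_set K &
      forall (t : R) (x : 'rV[R]_n), 0 <= t -> K x -> K (t *: x)].

(* [xi] is a standard Gaussian vector: its coordinates are random variables
   whose joint law is the n-fold product of N(0, 1), i.e. they are independent
   and each of law N(0, 1) (take the other B j to be setT).  In [normal_prob]
   the second parameter is the standard deviation. *)
Definition standard_gaussian (R : realType) (d : measure_display)
    (Omega : measurableType d) (P : probability Omega R) (n : nat)
    (xi : Omega -> 'rV[R]_n) : Prop :=
  (forall i, measurable_fun [set: Omega] (fun w => xi w ord0 i)) /\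
  (forall B : 'I_n -> set R, (forall i, measurable (B i)) ->
     P [set w | forall i, B i (xi w ord0 i)] =
     (\prod_(i < n) normal_prob 0 1 (B i))%E).

Definition lrt (R : realType) (n : nat) (K0 K : set 'rV[R]_n)
    (y : 'rV[R]_n) : R :=
  enorm (y - metric_proj K0 y) ^+ 2 - enorm (y - metric_proj K y) ^+ 2.

(* Below, [xi] is the noise vector on the probability space [P].  The
   expectations and variances are finite for the sets considered (projections
   are 1-Lipschitz), so [fine] only changes their type. *)
Definition lrt_mean (R : realType) (d : measure_display)
    (Omega : measurableType d) (P : probability Omega R) (n : nat)
    (xi : Omega -> 'rV[R]_n) (K0 K : set 'rV[R]_n) (mu : 'rV[R]_n) : R :=
  fine ('E_P[(fun w => lrt K0 K (mu + xi w))%R])%E.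

Definition lrt_sd (R : realType) (d : measure_display)
    (Omega : measurableType d) (P : probability Omega R) (n : nat)
    (xi : Omega -> 'rV[R]_n) (K0 K : set 'rV[R]_n) (mu : 'rV[R]_n) : R :=
  Num.sqrt (fine ('V_P[(fun w => lrt K0 K (mu + xi w))%R])%E).

Definition stat_dim (R : realType) (d : measure_display)
    (Omega : measurableType d) (P : probability Omega R) (n : nat)
    (xi : Omega -> 'rV[R]_n) (C : set 'rV[R]_n) : R :=
  fine ('E_P[(fun w => enorm (metric_proj C (xi w)) ^+ 2)%R])%E.

Definition dTV (R : realType) (d : measure_display) (T : measurableType d)
    (mu nu : set T -> \bar R) : \bar R :=
  ereal_sup [set (`|mu B - nu B|)%E | B in measurable].

(* Main.v *)
Require Import Defs.
From mathcomp Require Import all_boot all_order all_algebra.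
From mathcomp Require Import all_classical all_reals all_analysis.
From mathcomp Require Import measurable_realfun.
From mathcomp Require Import zify ring lra.
Import Order.TTheory GRing.Theory Num.Theory.
Import numFieldNormedType.Exports.
Set Implicit Arguments.
Unset Strict Implicit.
Unset Printing Implicit Defensive.
Local Open Scope classical_set_scope.
Local Open Scope ring_scope.


(** Let C be the part of the cone K orthogonal to K0, Pi the projection onto C
    and F x = |Pi x|^2. As K is the orthogonal sum of K0 and C, the statistic at
    mu + xi is F(xi), and delta = E F(xi) is the difference of the statistical
    dimensions. The gradient G = 2 Pi of F is 2-Lipschitz, and |G|^2 = 4 F.

    The proof is Stein's method with a Poincare inequality for the Stein kernel.
    Let y be an independent copy of x and u = cos theta x + sin theta y. Moving
    x to y along this circle, by small rotations that preserve the Gaussian law,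
    and integrating by parts at each step gives
      Cov(F, p) = int_0^(pi/2) sin theta E <G u, grad p(x)> dtheta,
    proved as a Riemann sum with an error of order 1 / N ([gaussian_ibp],
    [covariance_step], [covariance_formula]). It is used in three ways.
    - With p = F: <Pi u, Pi x> >= <u, Pi x>, whose mean is cos theta delta, so
      that sigma^2 = Var F >= 2 delta ([var_ge]).
    - For equal functions g: Var g <= E |grad g|^2, which smoothing by averages
      along the axes extends to Var g <= E L^2 when L bounds the local Lipschitz
      constant of g ([poincare_taylor], [poincare_loclip]).
    - With p = f(Z), where Z = (F - delta) / sigma and f solves Stein's equation
      f' - x f = h - E h(N) for a Lipschitz h with values in [0, 1]: then
      E h(Z) - E h(N) = sigma^-2 E f'(Z) (sigma^2 - tau), where tau is the
      average of <G u, G x> over theta and |f'| <= 2.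
    The mean of tau is sigma^2, and tau is locally Lipschitz on R^(2n) with
    constant an average of 2 (|G u| + |G x|), so the Poincare inequality gives
    Var tau <= 16 E |G|^2 = 64 delta ([var_stein_kernel]). Hence
      |E h(Z) - E h(N)| <= 2 sigma^-2 8 sqrt delta <= 8 / sqrt delta
    ([stein_bound]). Finally every Borel set is approximated by such functions
    h in L1 of the two laws ([borel_approximable]), so the same bound holds for
    the total variation distance.

    All functions in play are Lipschitz with polynomial weights ([tame]), with
    gradients in the sense of a quadratic remainder ([taylor]); this asks no
    differentiability of Pi, which in general is only Lipschitz. *)

(** * Euclidean norm and weighted Lipschitz functions *)

Section euclidean.
Context {R : realType}.

Definition dot n (u v : 'rV[R]_n) : R := \sum_(i < n) u ord0 i * v ord0 i.

Lemma dotC n (u v : 'rV[R]_n) : dot u v = dot v u.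
Proof. by apply: eq_bigr => i _; rewrite mulrC. Qed.

Lemma dotDl n (u v x : 'rV[R]_n) : dot (u + v) x = dot u x + dot v x.
Proof. by rewrite -big_split; apply: eq_bigr => i _; rewrite mxE mulrDl. Qed.

Lemma dotZl n a (u v : 'rV[R]_n) : dot (a *: u) v = a * dot u v.
Proof. by rewrite mulr_sumr; apply: eq_bigr => i _; rewrite mxE mulrA. Qed.

Lemma dotDr n (u v x : 'rV[R]_n) : dot x (u + v) = dot x u + dot x v.
Proof. by rewrite dotC dotDl !(dotC x). Qed.

Lemma dotZr n a (u v : 'rV[R]_n) : dot u (a *: v) = a * dot u v.
Proof. by rewrite dotC dotZl dotC. Qed.

Lemma dotNl n (u v : 'rV[R]_n) : dot (- u) v = - dot u v.
Proof. by rewrite -scaleN1r dotZl mulN1r. Qed.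

Lemma dotNr n (u v : 'rV[R]_n) : dot u (- v) = - dot u v.
Proof. by rewrite dotC dotNl dotC. Qed.

Definition dotE := (dotDl, dotDr, dotZl, dotZr, dotNl, dotNr).

Lemma dot0l n (u : 'rV[R]_n) : dot 0 u = 0.
Proof. by rewrite -(scale0r 0) dotZl mul0r. Qed.

Lemma dot_delta n (u : 'rV[R]_n) i : dot u (delta_mx ord0 i) = u ord0 i.
Proof.
rewrite /dot (bigD1 i)//= big1 ?addr0 ?mxE ?eqxx ?mulr1// => j ji.
by rewrite mxE (negbTE ji) andbF mulr0.
Qed.

Lemma dot_ge0 n (u : 'rV[R]_n) : 0 <= dot u u.
Proof. by apply: sumr_ge0 => i _; rewrite -expr2 sqr_ge0. Qed.

Lemma enorm_ge0 n (u : 'rV[R]_n) : 0 <= enorm u.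
Proof. exact: sqrtr_ge0. Qed.

Lemma enorm2 n (u : 'rV[R]_n) : enorm u ^+ 2 = dot u u.
Proof.
rewrite /enorm sqr_sqrtr; last by apply: sumr_ge0 => i _; rewrite sqr_ge0.
by apply: eq_bigr => i _; rewrite expr2.
Qed.

Lemma enormE n (u : 'rV[R]_n) : enorm u = Num.sqrt (dot u u).
Proof. by rewrite -enorm2 sqrtr_sqr ger0_norm ?enorm_ge0. Qed.

Lemma ler_enorm n m (u : 'rV[R]_n) (v : 'rV[R]_m) :
  (enorm u <= enorm v) = (dot u u <= dot v v).
Proof. by rewrite -!enorm2 ler_pXn2r// nnegrE enorm_ge0. Qed.

Lemma enorm0 n : enorm (0 : 'rV[R]_n) = 0.
Proof. by rewrite enormE dot0l sqrtr0. Qed.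

Lemma enorm0_eq0 n (u : 'rV[R]_n) : dot u u = 0 -> u = 0.
Proof.
move=> /eqP; rewrite psumr_eq0 => [/allP u0|i _]; last by rewrite -expr2 sqr_ge0.
apply/rowP => i; have := u0 i (mem_index_enum _).
by rewrite /= mulf_eq0 orbb mxE => /eqP.
Qed.

Lemma enormN n (u : 'rV[R]_n) : enorm (- u) = enorm u.
Proof. by rewrite !enormE dotNl dotNr opprK. Qed.

Lemma enormZ n a (u : 'rV[R]_n) : enorm (a *: u) = `|a| * enorm u.
Proof. by rewrite !enormE dotZl dotZr mulrA sqrtrM ?sqr_ge0// -expr2 ?sqr_ge0// sqrtr_sqr. Qed.

Lemma enormBC n (u v : 'rV[R]_n) : enorm (u - v) = enorm (v - u).
Proof. by rewrite -enormN opprB. Qed.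

Lemma cauchy_schwarz n (u v : 'rV[R]_n) : `|dot u v| <= enorm u * enorm v.
Proof.
have [->|v0] := eqVneq v 0; first by rewrite enorm0 dotC dot0l normr0 mulr0.
have vv : 0 < dot v v.
  rewrite lt0r dot_ge0 andbT; apply: contra_neq v0; exact: enorm0_eq0.
rewrite -(ler_pXn2r (n := 2))// ?nnegrE ?normr_ge0 ?mulr_ge0 ?enorm_ge0//.
rewrite exprMn !enorm2 -normrX ger0_norm ?sqr_ge0//.
have := dot_ge0 (dot v v *: u - dot u v *: v); rewrite !dotE (dotC v u) => h.
have : 0 <= dot v v * (dot u u * dot v v - dot u v ^+ 2) by lra.
by rewrite pmulr_rge0// subr_ge0.
Qed.

Lemma dot_le n (u v : 'rV[R]_n) : dot u v <= enorm u * enorm v.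
Proof. exact: le_trans (ler_norm _) (cauchy_schwarz u v). Qed.

Lemma ler_enormD n (u v : 'rV[R]_n) : enorm (u + v) <= enorm u + enorm v.
Proof.
rewrite -(ler_pXn2r (n := 2))// ?nnegrE ?addr_ge0 ?enorm_ge0//.
rewrite sqrrD !enorm2 !dotE (dotC v u); have := dot_le u v; lra.
Qed.

Lemma ler_enormB n (u v : 'rV[R]_n) : enorm (u - v) <= enorm u + enorm v.
Proof. by rewrite -(enormN v) ler_enormD. Qed.

Lemma enorm_triangle n (x u v : 'rV[R]_n) :
  enorm (u - v) <= enorm (u - x) + enorm (x - v).
Proof. by have := ler_enormD (u - x) (x - v); rewrite addrA subrK. Qed.

Lemma ler_coord_enorm n (u : 'rV[R]_n) i : `|u ord0 i| <= enorm u.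
Proof.
rewrite -dot_delta (le_trans (cauchy_schwarz _ _))// enormE [enorm (delta_mx _ _)]enormE dot_delta mxE !eqxx.
by rewrite sqrtr1 mulr1.
Qed.

Lemma enorm_delta n (i : 'I_n) : enorm (delta_mx ord0 i : 'rV[R]_n) = 1.
Proof. by rewrite enormE dot_delta mxE !eqxx sqrtr1. Qed.

Lemma ler_enorm_sum n (u : 'rV[R]_n) : enorm u <= \sum_(i < n) `|u ord0 i|.
Proof.
rewrite {1}(row_sum_delta u).
elim/big_ind2 : _ => [|x a y b xa yb|i _]; first by rewrite enorm0.
  by rewrite (le_trans (ler_enormD _ _))// lerD.
by rewrite enormZ enorm_delta mulr1.
Qed.

End euclidean.

Section tame.
Context {R : realType}.

(* locked, so that arithmetic tactics see an atom *)
Fact wt_key : unit. Proof. exact: tt. Qed.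
Definition wt n (x : 'rV[R]_n) : R := locked_with wt_key (1 + enorm x).

Lemma wtE n (x : 'rV[R]_n) : wt x = 1 + enorm x.
Proof. by rewrite /wt unlock. Qed.

Lemma wt_ge1 n (x : 'rV[R]_n) : 1 <= wt x.
Proof. by rewrite wtE lerDl enorm_ge0. Qed.

Lemma wt_ge0 n (x : 'rV[R]_n) : 0 <= wt x.
Proof. exact: le_trans (wt_ge1 x). Qed.

Lemma enorm_le_wt n (x : 'rV[R]_n) : enorm x <= wt x.
Proof. by rewrite wtE lerDr. Qed.

Lemma wt0 n : wt (0 : 'rV[R]_n) = 1.
Proof. by rewrite wtE enorm0 addr0. Qed.

Lemma wtX_ge1 n (x : 'rV[R]_n) k : 1 <= wt x ^+ k.
Proof. by rewrite exprn_ege1// wt_ge1. Qed.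

Lemma wtM_ge1 n (x y : 'rV[R]_n) : 1 <= wt x * wt y.
Proof. by rewrite -[1]mulr1 ler_pM// wt_ge1. Qed.

Lemma wtMX_ge0 n (x y : 'rV[R]_n) k : 0 <= (wt x * wt y) ^+ k.
Proof. by rewrite exprn_ge0// mulr_ge0// wt_ge0. Qed.

Lemma wtMX_homo n (x y : 'rV[R]_n) k l : (k <= l)%N ->
  (wt x * wt y) ^+ k <= (wt x * wt y) ^+ l.
Proof. by move=> kl; rewrite ler_weXn2l// wtM_ge1. Qed.

Lemma wtX_homo n (x : 'rV[R]_n) k l : (k <= l)%N -> wt x ^+ k <= wt x ^+ l.
Proof. by move=> kl; rewrite ler_weXn2l// wt_ge1. Qed.

Lemma wt_le_wtM n (x y : 'rV[R]_n) : wt x <= wt x * wt y.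
Proof. by rewrite ler_peMr ?wt_ge0 ?wt_ge1. Qed.

Definition polybd n (g : 'rV[R]_n -> R) :=
  exists2 C : R, 0 <= C & exists k, forall x, `|g x| <= C * wt x ^+ k.

(** Locally Lipschitz with polynomial weights. This class contains every
    function of the Gaussian vector that occurs below; it is stable under
    sums, products and composition, and gives continuity, measurability and
    all moments at once. *)
Definition tame n (g : 'rV[R]_n -> R) :=
  exists2 C : R, 0 <= C & exists k, forall x y,
    `|g x - g y| <= C * (wt x * wt y) ^+ k * enorm (x - y).

Definition tamev n m (f : 'rV[R]_n -> 'rV[R]_m) :=
  forall i, tame (fun x => f x ord0 i).

Lemma tame_polybd n (g : 'rV[R]_n -> R) : tame g -> polybd g.
Proof.
move=> [C C0 [k gC]]; exists (`|g 0| + C); first by rewrite addr_ge0.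
exists k.+1 => x; rewrite -(subrK (g 0) (g x)) (le_trans (ler_normD _ _))//.
rewrite addrC mulrDl lerD//; first by rewrite ler_peMr// wtX_ge1.
rewrite (le_trans (gC _ _))// wt0 mulr1 subr0 exprSr mulrA.
by rewrite ler_wpM2l ?enorm_le_wt// mulr_ge0// exprn_ge0// wt_ge0.
Qed.

Lemma tame_lip n (g : 'rV[R]_n -> R) (C : R) :
  (forall x y, `|g x - g y| <= C * enorm (x - y)) -> tame g.
Proof.
move=> gC; exists `|C| => //; exists 0 => x y; rewrite expr0 mulr1.
by rewrite (le_trans (gC _ _))// ler_wpM2r ?enorm_ge0// ler_norm.
Qed.

Lemma tame_cst n (c : R) : tame (fun _ : 'rV[R]_n => c).
Proof. by apply: (@tame_lip _ _ 0) => x y; rewrite subrr normr0 mul0r. Qed.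

Lemma tame_coord n (i : 'I_n) : tame (fun x : 'rV[R]_n => x ord0 i).
Proof.
apply: (@tame_lip _ _ 1) => x y; rewrite mul1r.
by have := ler_coord_enorm (x - y) i; rewrite !mxE.
Qed.

Lemma tame_enorm n : tame (fun x : 'rV[R]_n => enorm x).
Proof.
apply: (@tame_lip _ _ 1) => x y; rewrite mul1r ler_norml.
have := ler_enormD (x - y) y; have := ler_enormD (y - x) x.
by rewrite !subrK (enormBC y x); lra.
Qed.

Lemma tameD n (f g : 'rV[R]_n -> R) :
  tame f -> tame g -> tame (fun x => f x + g x).
Proof.
move=> [C C0 [k fC]] [D D0 [l gD]]; exists (C + D); first exact: addr_ge0.
exists (k + l)%N => x y; rewrite opprD addrACA (le_trans (ler_normD _ _))//.
rewrite !mulrDl lerD//.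
  rewrite (le_trans (fC _ _))// ler_wpM2r ?enorm_ge0// ler_wpM2l//.
  by rewrite wtMX_homo// leq_addr.
rewrite (le_trans (gD _ _))// ler_wpM2r ?enorm_ge0// ler_wpM2l//.
by rewrite wtMX_homo// leq_addl.
Qed.

Lemma tameM n (f g : 'rV[R]_n -> R) :
  tame f -> tame g -> tame (fun x => f x * g x).
Proof.
move=> tf tg; have [C' C0' [k' fC']] := tame_polybd tf.
have [D' D0' [l' gD']] := tame_polybd tg.
move: tf tg => [C C0 [k fC]] [D D0 [l gD]].
exists (C' * D + C * D'); first by rewrite addr_ge0// mulr_ge0.
exists (k + l + k' + l')%N => x y.
have -> : f x * g x - f y * g y = f x * (g x - g y) + (f x - f y) * g y by ring.
have n0 := enorm_ge0 (x - y).
have w1 := wtM_ge1 x y.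
rewrite (le_trans (ler_normD _ _))// !normrM !mulrDl lerD//.
  apply: (@le_trans _ _ ((C' * (wt x * wt y) ^+ k') *
     (D * (wt x * wt y) ^+ l * enorm (x - y)))).
    apply: ler_pM => //.
    rewrite (le_trans (fC' _))// ler_wpM2l// lerXn2r ?nnegrE ?wt_ge0 ?mulr_ge0 ?wt_ge0//.
    exact: wt_le_wtM.
  rewrite mulrACA -!mulrA ler_wpM2l// ler_wpM2l// !mulrA -exprD.
  by rewrite ler_wpM2r// wtMX_homo//; lia.
apply: (@le_trans _ _ ((C * (wt x * wt y) ^+ k * enorm (x - y)) *
   (D' * (wt x * wt y) ^+ l'))).
  apply: ler_pM => //.
  rewrite (le_trans (gD' _))// ler_wpM2l// lerXn2r ?nnegrE ?wt_ge0 ?mulr_ge0 ?wt_ge0//.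
  by rewrite mulrC wt_le_wtM.
rewrite mulrAC mulrACA -exprD -!mulrA ler_wpM2l// ler_wpM2l// ler_wpM2r//.
by rewrite wtMX_homo//; lia.
Qed.

Lemma tameZ n a (f : 'rV[R]_n -> R) : tame f -> tame (fun x => a * f x).
Proof. by move=> tf; apply: tameM => //; exact: tame_cst. Qed.

Lemma tameN n (f : 'rV[R]_n -> R) : tame f -> tame (fun x => - f x).
Proof.
move=> tf; rewrite (_ : (fun _ => _) = fun x => -1 * f x); first exact: tameZ.
by apply/funext => x; rewrite mulN1r.
Qed.

Lemma tameB n (f g : 'rV[R]_n -> R) :
  tame f -> tame g -> tame (fun x => f x - g x).
Proof. by move=> tf tg; apply: tameD => //; exact: tameN. Qed.

Lemma tameX n (f : 'rV[R]_n -> R) k : tame f -> tame (fun x => f x ^+ k).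
Proof.
move=> tf; elim: k => [|k ih]; first exact: tame_cst.
by under eq_fun do rewrite exprS; exact: tameM.
Qed.

Lemma tame_sum n (I : Type) (r : seq I) (f : I -> 'rV[R]_n -> R) :
  (forall i, tame (f i)) -> tame (fun x => \sum_(i <- r) f i x).
Proof.
move=> tf; elim: r => [|i r ih].
  by under eq_fun do rewrite big_nil; exact: tame_cst.
by under eq_fun do rewrite big_cons; exact: tameD.
Qed.

Lemma polybd_sum n (I : Type) (r : seq I) (f : I -> 'rV[R]_n -> R) :
  (forall i, polybd (f i)) ->
  exists2 C : R, 0 <= C & exists k, forall x, \sum_(i <- r) `|f i x| <= C * wt x ^+ k.
Proof.
move=> tf; elim: r => [|i r [C C0 [k ih]]].
  by exists 0 => //; exists 0 => x; rewrite big_nil mul0r.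
have [D D0 [l fD]] := tf i; exists (D + C); first exact: addr_ge0.
exists (l + k)%N => x; rewrite big_cons mulrDl lerD//.
  by rewrite (le_trans (fD _))// ler_wpM2l// wtX_homo// leq_addr.
by rewrite (le_trans (ih _))// ler_wpM2l// wtX_homo// leq_addl.
Qed.

Lemma tamev_wt n m (f : 'rV[R]_n -> 'rV[R]_m) : tamev f ->
  exists2 C : R, 0 <= C & exists k, forall x, wt (f x) <= C * wt x ^+ k.
Proof.
move=> tf; have [C C0 [k fC]] :=
  polybd_sum (index_enum 'I_m) (fun i => tame_polybd (tf i)).
exists (1 + C); first exact: addr_ge0.
exists k => x; rewrite wtE mulrDl lerD// ?mul1r ?wtX_ge1//.
exact: le_trans (ler_enorm_sum _) (fC x).
Qed.

Lemma tamev_dist n m (f : 'rV[R]_n -> 'rV[R]_m) : tamev f ->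
  exists2 C : R, 0 <= C & exists k, forall x y,
    enorm (f x - f y) <= C * (wt x * wt y) ^+ k * enorm (x - y).
Proof.
move=> tf; suff [C C0 [k fC]] : exists2 C : R, 0 <= C & exists k, forall x y,
  \sum_(i < m) `|f x ord0 i - f y ord0 i| <= C * (wt x * wt y) ^+ k * enorm (x - y).
  exists C => //; exists k => x y; rewrite (le_trans (ler_enorm_sum _))//.
  by under eq_bigr do rewrite !mxE.
elim: (index_enum _) => [|i r [C C0 [k ih]]].
  by exists 0 => //; exists 0 => x y; rewrite big_nil !mul0r.
have [D D0 [l fD]] := tf i; exists (D + C); first exact: addr_ge0.
exists (l + k)%N => x y; rewrite big_cons !mulrDl lerD//.
  rewrite (le_trans (fD _ _))// ler_wpM2r ?enorm_ge0// ler_wpM2l//.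
  by rewrite wtMX_homo// leq_addr.
rewrite (le_trans (ih _ _))// ler_wpM2r ?enorm_ge0// ler_wpM2l//.
by rewrite wtMX_homo// leq_addl.
Qed.

Lemma tame_comp n m (g : 'rV[R]_m -> R) (f : 'rV[R]_n -> 'rV[R]_m) :
  tame g -> tamev f -> tame (fun x => g (f x)).
Proof.
move=> [C C0 [k gC]] tf; have [D D0 [l fD]] := tamev_wt tf.
have [E E0 [p fE]] := tamev_dist tf.
exists (C * (D * D) ^+ k * E).
  by rewrite !mulr_ge0// exprn_ge0// mulr_ge0.
exists (l * k + p)%N => x y; rewrite (le_trans (gC _ _))//.
rewrite (_ : C * (D * D) ^+ k * E * _ * _ = C * ((D * D) ^+ k *
  (wt x * wt y) ^+ (l * k)) * (E * (wt x * wt y) ^+ p * enorm (x - y))); last first.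
  by rewrite exprD; ring.
apply: ler_pM => //; rewrite ?mulr_ge0 ?enorm_ge0 ?wtMX_ge0//.
rewrite ler_wpM2l// exprM -exprMn; apply: lerXn2r.
- by rewrite nnegrE mulr_ge0 ?wt_ge0.
- by rewrite nnegrE !mulr_ge0// wtMX_ge0.
- rewrite (le_trans (ler_pM _ _ (fD x) (fD y)))// ?wt_ge0// exprMn.
  by rewrite mulrACA.
Qed.

Lemma tamev_lip n m (f : 'rV[R]_n -> 'rV[R]_m) (C : R) :
  (forall x y, enorm (f x - f y) <= C * enorm (x - y)) -> tamev f.
Proof.
move=> fC i; apply: (@tame_lip _ _ C) => x y; rewrite (le_trans _ (fC x y))//.
by have := ler_coord_enorm (f x - f y) i; rewrite !mxE.
Qed.

Lemma tamev_id n : tamev (fun x : 'rV[R]_n => x).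
Proof. by move=> i; exact: tame_coord. Qed.

Lemma tamev_cst n m (c : 'rV[R]_m) : tamev (fun _ : 'rV[R]_n => c).
Proof. by move=> i; exact: tame_cst. Qed.

Lemma tamevD n m (f g : 'rV[R]_n -> 'rV[R]_m) :
  tamev f -> tamev g -> tamev (fun x => f x + g x).
Proof. by move=> tf tg i; under eq_fun do rewrite mxE; exact: tameD. Qed.

Lemma tamevZ n m (a : 'rV[R]_n -> R) (f : 'rV[R]_n -> 'rV[R]_m) :
  tame a -> tamev f -> tamev (fun x => a x *: f x).
Proof. by move=> ta tf i; under eq_fun do rewrite mxE; exact: tameM. Qed.

Lemma tamevZc n m (a : R) (f : 'rV[R]_n -> 'rV[R]_m) :
  tamev f -> tamev (fun x => a *: f x).
Proof. by apply: tamevZ; exact: tame_cst. Qed.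

Lemma tamevN n m (f : 'rV[R]_n -> 'rV[R]_m) :
  tamev f -> tamev (fun x => - f x).
Proof. by move=> tf i; under eq_fun do rewrite mxE; exact: tameN. Qed.

Lemma tamev_comp n m p (g : 'rV[R]_m -> 'rV[R]_p) (f : 'rV[R]_n -> 'rV[R]_m) :
  tamev g -> tamev f -> tamev (fun x => g (f x)).
Proof. by move=> tg tf i; exact: (tame_comp (tg i) tf). Qed.

Lemma tamev_lsubmx n m : tamev (fun z : 'rV[R]_(n + m) => lsubmx z).
Proof. by move=> i; under eq_fun do rewrite mxE; exact: tame_coord. Qed.

Lemma tamev_rsubmx n m : tamev (fun z : 'rV[R]_(n + m) => rsubmx z).
Proof. by move=> i; under eq_fun do rewrite mxE; exact: tame_coord. Qed.

Lemma tame_dot n m (f g : 'rV[R]_n -> 'rV[R]_m) :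
  tamev f -> tamev g -> tame (fun x => dot (f x) (g x)).
Proof. by move=> tf tg; apply: tame_sum => i; exact: tameM. Qed.

Lemma tame_enormv n m (f : 'rV[R]_n -> 'rV[R]_m) :
  tamev f -> tame (fun x => enorm (f x)).
Proof. exact: tame_comp (@tame_enorm m). Qed.

Lemma tame_wt n m (f : 'rV[R]_n -> 'rV[R]_m) :
  tamev f -> tame (fun x => wt (f x)).
Proof. by move=> tf; under eq_fun do rewrite wtE; apply: tameD; [exact: tame_cst|exact: tame_enormv]. Qed.

End tame.
#[export] Hint Resolve tame_cst tame_coord tame_enormv tameD tameM tameN tameB
  tameX tame_sum tame_dot tame_wt tamev_id tamev_cst tamevD tamevZ tamevZc
  tamevN tamev_lsubmx tamev_rsubmx : tame.


(** * Projection onto a closed convex cone *)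

Section topology.
Context {R : realType}.

Lemma enorm_continuous n : continuous (@enorm R n).
Proof.
move=> x; apply: continuous_comp; last exact: sqrt_continuous.
apply: (@continuous_big R 'I_n +%R 0 xpredT add_continuous) => i _ {}x.
apply: (@continuous_comp _ _ _ (fun y : 'rV[R]_n => y ord0 i) (fun t => t ^+ 2)).
  exact: coord_continuous.
exact: exprn_continuous.
Qed.

Lemma dist_continuous n (x : 'rV[R]_n) : continuous (fun y : 'rV[R]_n => enorm (x - y)).
Proof.
move=> y; apply: (@continuous_comp _ _ _ (fun z : 'rV[R]_n => x - z) (@enorm R n)); last exact: enorm_continuous.
by apply: continuousB; [exact: (@cst_continuous 'rV[R]_n)|exact: (@cvg_id 'rV[R]_n)].
Qed.

Lemma tame_continuous n (g : 'rV[R]_n -> R) : tame g -> continuous g.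
Proof.
move=> [C C0 [k gC]] x; apply/(@cvgrPdist_le _ _ _ (nbhs x)) => e e0.
have cN := @dist_continuous n x.
have cw : continuous (fun y : 'rV[R]_n => C * (wt x * (1 + enorm y)) ^+ k * enorm (x - y)).
  move=> y; apply: (@cvgM _ _ (nbhs _)); last exact: cN.
  apply: (@cvgM _ _ (nbhs _)); first exact: (@cst_continuous 'rV[R]_n).
  apply: (@continuous_comp _ _ _ (fun z : 'rV[R]_n => wt x * (1 + enorm z)) (fun t => t ^+ k)).
    apply: (@cvgM _ _ (nbhs _)); first exact: (@cst_continuous 'rV[R]_n).
    by apply: (@cvgD _ _ _ (nbhs _)); [exact: (@cst_continuous 'rV[R]_n)|exact: enorm_continuous].
  exact: exprn_continuous.
have := cw x; rewrite /continuous_at subrr enorm0 mulr0.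
move=> /(@cvgrPdist_le _ _ _ (nbhs x)) /(_ e e0); apply: filterS => y.
rewrite sub0r normrN -wtE; apply: le_trans.
exact: le_trans (gC x y) (ler_norm _).
Qed.

Lemma closed_preimage (T U : topologicalType) (f : T -> U) (D : set U) :
  continuous f -> closed D -> closed (f @^-1` D).
Proof. by move=> cf; apply: preimage_closed => x _; exact: cf. Qed.

Lemma ler_norm_enorm n (x : 'rV[R]_n) : `|x| <= enorm x.
Proof.
rewrite /Num.norm /= mx_normrE; apply/bigmax_leP; split; first exact: enorm_ge0.
by move=> [i j] _ /=; rewrite (ord1 i) ler_coord_enorm.
Qed.

End topology.

Section projection.
Context {R : realType} {n : nat}.
Implicit Types (K C : set 'rV[R]_n).

Lemma cone_add K (x y : 'rV[R]_n) : closed_convex_cone K -> K x -> K y -> K (x + y).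
Proof.
move=> [_ cK hK] Kx Ky.
have h0 : (0 : R) <= 2^-1 by lra.
have h1 : 2^-1 <= (1 : R) by lra.
have := cK x y (Itv01 h0 h1).
rewrite !inE => /(_ Kx Ky) Kxy.
have := hK 2 _ (ler0n _ 2) Kxy.
rewrite (_ : 2 *: _ = x + y)//; apply/rowP => i; rewrite /conv/= !mxE /unstable.onem; lra.
Qed.

(** A closed ball makes the minimization problem compact. *)
Lemma metric_proj_spec K : closed_convex_cone K -> K 0 -> forall x,
  K (metric_proj K x) /\
  forall c, K c -> enorm (x - metric_proj K x) <= enorm (x - c).
Proof.
move=> [clK _ _] K0 x.
suff [p [Kp pmin]] : exists p, K p /\ forall c, K c -> enorm (x - p) <= enorm (x - c).
  rewrite /metric_proj; case: xgetP => [q _ []//|/(_ p)].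
  by move=> h; case: h; split.
pose A := K `&` [set c | enorm (x - c) <= enorm x].
have cont := @dist_continuous R n x.
have cA : compact A.
  apply: bounded_closed_compact.
    exists (2 * enorm x); split; first exact: num_real.
    move=> M xM c [_ /= cx]; rewrite (le_trans (ler_norm_enorm _))//.
    have := enorm_triangle x c 0; rewrite !subr0 enormBC => /le_trans; apply.
    by apply: ltW; apply: le_lt_trans xM; lra.
  apply: closedI; first exact: clK.
  exact: (closed_preimage cont (@closed_le _ (enorm x))).
have A0 : A 0 by split => //=; rewrite subr0.
have [p /[!inE] -[Kp px] pmin] :=
  EVT_min_rV (ex_intro _ 0 A0) cA (continuous_subspaceT cont).
exists p; split => // c Kc; have [cx|cx] := leP (enorm (x - c)) (enorm x).
  by apply: pmin; rewrite inE.
exact: le_trans px (ltW cx).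
Qed.

(** Moreau's characterization of the projection onto a cone. *)
Definition cone_proj K (x p : 'rV[R]_n) :=
  [/\ K p, dot (x - p) p = 0 & forall c, K c -> dot (x - p) c <= 0].

(** First order condition at a minimum over the segment [0, 1]. *)
Lemma ge0_lin_sq (a b : R) : (forall t : R, 0 <= t -> t <= 1 -> 0 <= t * a + t ^+ 2 * b) -> 0 <= a.
Proof.
move=> h; rewrite leNgt; apply/negP => a0.
have b0 : 0 < b by have := h 1 ler01 (lexx _); lra.
pose t := Num.min 1 (- a / (2 * b)).
have q0 : 0 < - a / (2 * b) by rewrite divr_gt0//; lra.
have t0 : 0 < t by rewrite lt_min ltr01.
have t1 : t <= 1 by rewrite ge_min lexx.
have tb : t * (2 * b) <= - a.
  by rewrite -ler_pdivlMr ?ge_min ?lexx ?orbT//; lra.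
have := h t (ltW t0) t1; have -> : t * a + t ^+ 2 * b = t * (a + t * b) by ring.
by rewrite pmulr_rge0//; lra.
Qed.

Lemma metric_proj_cone K : closed_convex_cone K -> K 0 -> forall x,
  cone_proj K x (metric_proj K x).
Proof.
move=> cK K0 x; have [Kp pmin] := metric_proj_spec cK K0 x.
set p := metric_proj K x in Kp pmin *.
have key c (s : R) : (forall t, 0 <= t -> t <= 1 -> K (p + (t * s) *: c)) -> s * dot (x - p) c <= 0.
  move=> Kpc; suff : 0 <= - 2 * s * dot (x - p) c by lra.
  apply: (@ge0_lin_sq _ (s ^+ 2 * dot c c)) => t t0 t1.
  have := pmin _ (Kpc t t0 t1); rewrite ler_enorm opprD addrA.
  have -> : dot (x - p - (t * s) *: c) (x - p - (t * s) *: c) =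
    dot (x - p) (x - p) - 2 * t * s * dot (x - p) c + t ^+ 2 * (s ^+ 2 * dot c c).
    by rewrite -[X in dot (X - _) _]/(x - p) !(dotDl (x - p)) !(dotDr (x - p)) !dotNl !dotNr !dotZl !dotZr (dotC c); ring.
  lra.
have [_ _ hK] := cK.
have le0 c : K c -> dot (x - p) c <= 0.
  move=> Kc; rewrite -[leLHS]mul1r; apply: key => t t0 t1.
  by apply: cone_add => //; apply: hK => //; rewrite mulr1.
split => //; apply/eqP; rewrite eq_le le0//=.
suff : -1 * dot (x - p) p <= 0 by lra.
apply: key => t t0 t1; rewrite -[X in X + _]scale1r -scalerDl; apply: hK => //; lra.
Qed.

Lemma cone_proj_uniq K x p q : cone_proj K x p -> cone_proj K x q -> p = q.
Proof.
move=> [Kp pp pc] [Kq qq qc]; apply/eqP; rewrite -subr_eq0; apply/eqP.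
apply: enorm0_eq0; apply/eqP; rewrite eq_le dot_ge0 andbT.
have := pc _ Kq; have := qc _ Kp; move: pp qq; rewrite !dotE (dotC q p); lra.
Qed.

Lemma metric_projE K x p : closed_convex_cone K -> K 0 -> cone_proj K x p ->
  metric_proj K x = p.
Proof. by move=> cK K0; apply: cone_proj_uniq; exact: metric_proj_cone. Qed.

Section one_cone.
Variable K : set 'rV[R]_n.
Hypotheses (cK : closed_convex_cone K) (K0 : K 0).
Local Notation Pi := (metric_proj K).

Lemma dot_projE x : dot x (Pi x) = dot (Pi x) (Pi x).
Proof. by have [_ h _] := metric_proj_cone cK K0 x; move: h; rewrite !dotE; lra. Qed.

Lemma residual_sq x : enorm (x - Pi x) ^+ 2 = dot x x - dot (Pi x) (Pi x).
Proof. by rewrite enorm2 !dotE (dotC (Pi x) x) dot_projE; ring. Qed.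

Lemma dot_proj_ge x y : dot y (Pi x) <= dot (Pi y) (Pi x).
Proof.
have [_ _ h] := metric_proj_cone cK K0 y; have [Kp _ _] := metric_proj_cone cK K0 x.
by have := h _ Kp; rewrite !dotE; lra.
Qed.

Lemma proj_lip x y : enorm (Pi x - Pi y) <= enorm (x - y).
Proof.
set u := Pi x - Pi y.
have h : dot u u <= dot (x - y) u.
  have := dot_proj_ge x y; have := dot_proj_ge y x.
  have := dot_projE x; have := dot_projE y; rewrite /u !dotE (dotC (Pi y) (Pi x)); lra.
have := le_trans h (dot_le _ _); rewrite -enorm2 expr2.
have := enorm_ge0 u; rewrite le0r => /orP[/eqP -> _|u0]; first exact: enorm_ge0.
by rewrite ler_pM2r.
Qed.

(** |Pi x|^2 has gradient 2 Pi x, with a quadratic remainder, although Pi is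
    in general only Lipschitz. *)
Lemma projsq_taylor x y : `|dot (Pi y) (Pi y) - dot (Pi x) (Pi x) - dot (2 *: Pi x) (y - x)|
  <= 2 * enorm (y - x) ^+ 2.
Proof.
have := proj_lip y x; rewrite -(ler_pXn2r (n := 2))// ?nnegrE ?enorm_ge0// => hl.
have := dot_le (Pi y - Pi x) (y - x) => hd.
have hd' : dot (Pi y - Pi x) (y - x) <= enorm (y - x) ^+ 2.
  by rewrite (le_trans hd)// expr2 ler_wpM2r ?enorm_ge0// proj_lip.
have px := dot_projE x; have py := dot_projE y.
(* |y - Pi y|^2 <= |y - Pi x|^2 and the same with x and y exchanged *)
have h1 := dot_ge0 (Pi y - Pi x).
have hxy := dot_proj_ge x y; have hyx := dot_proj_ge y x.
move: hd' h1; rewrite enorm2 ler_norml !dotE !(dotC (Pi _) x) !(dotC (Pi _) y) (dotC (Pi y) (Pi x)) in hxy hyx *.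
rewrite (dotC y x) => hd' h1.
apply/andP; split; lra.
Qed.

End one_cone.

Section lrt_reduction.
Variables (K0 : {vspace 'rV[R]_n}) (K : set 'rV[R]_n).
Hypotheses (K0K : [set` K0] `<=` K) (cK : closed_convex_cone K).

Lemma vspace_closed_convex_cone : closed_convex_cone [set` K0].
Proof.
split.
- have -> : [set` K0] = \bigcap_(i in [set: 'I_n]) [set x : 'rV[R]_n | (projv K0 x - x) ord0 i = 0].
    apply/seteqP; split => x /=.
      by move=> xK i _ /=; rewrite projv_id// subrr mxE.
    move=> h; have -> : x = projv K0 x; last exact: memv_proj.
    apply/esym/eqP; rewrite -subr_eq0; apply/eqP/rowP => i.
    by rewrite h// mxE.
  apply: closed_bigI => i _.
  suff tf : tame (fun x : 'rV[R]_n => (projv K0 x - x) ord0 i).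
    exact: (closed_preimage (tame_continuous tf) (@closed_eq _ 0)).
  rewrite (_ : (fun x : 'rV[R]_n => _) = fun x : 'rV[R]_n =>
      \sum_(j < n) x ord0 j * (projv K0 (delta_mx ord0 j)) ord0 i - x ord0 i).
    by apply: tameB; [apply: tame_sum => j; apply: tameM|]; auto with tame.
  apply/funext => z; rewrite !mxE {1}(row_sum_delta z) linear_sum summxE; congr (_ - _).
  by apply: eq_bigr => j _; rewrite linearZ mxE.
- move=> x y l; rewrite !inE /= => xK yK; apply: rpredD; exact: rpredZ.
- by move=> t x _ /= xK; exact: rpredZ.
Qed.

Let cK0 := vspace_closed_convex_cone.
Let K00 : [set` K0] 0. Proof. exact: mem0v. Qed.
Let Kz : K 0. Proof. exact: K0K. Qed.

Lemma vspace_proj_orth x k : k \in K0 -> dot (x - metric_proj [set` K0] x) k = 0.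
Proof.
have [_ _ h] := metric_proj_cone cK0 K00 x.
move=> kK; apply/eqP; rewrite eq_le h//=.
by have := h (- k); rewrite /= rpredN kK => /(_ isT); rewrite dotNr; lra.
Qed.

Definition cone_part : set 'rV[R]_n :=
  K `&` [set x | forall k, k \in K0 -> dot x k = 0].

Lemma cone_part_ccc : closed_convex_cone cone_part.
Proof.
have [clK cvK hK] := cK; split.
- apply: closedI => //.
  rewrite (_ : [set x | _] = \bigcap_(k in [set` K0]) [set x | dot x k = 0]); last first.
    by apply/seteqP; split => x /=.
  apply: closed_bigI => k _.
  have tf : tame (fun x : 'rV[R]_n => dot x k) by auto with tame.
  exact: (closed_preimage (tame_continuous tf) (@closed_eq _ 0)).
- move=> x y l; rewrite !inE => -[Kx xo] [Ky yo]; split.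
    by have := cvK x y l; rewrite !inE; exact.
  by move=> k kK; rewrite dotDl !dotZl xo// yo// !mulr0 addr0.
- move=> t x t0 [Kx xo]; split; first exact: hK.
  by move=> k kK; rewrite dotZl xo// mulr0.
Qed.

Lemma cone_part0 : cone_part 0.
Proof. by split => // k _; rewrite dot0l. Qed.

Local Notation P0 := (metric_proj [set` K0]).
Local Notation PC := (metric_proj cone_part).

(** K is the orthogonal sum of K0 and of [cone_part]. *)
Lemma proj_decomp x : metric_proj K x = P0 x + PC x.
Proof.
have [K0p pp _] := metric_proj_cone cK0 K00 x.
have [[Kc oc] cc hc] := metric_proj_cone cone_part_ccc cone_part0 x.
have o0 k : k \in K0 -> dot (x - (P0 x + PC x)) k = 0.
  move=> kK; have := vspace_proj_orth x kK; have := oc _ kK; rewrite !dotE; lra.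
apply: metric_projE => //; split.
- by apply: cone_add => //; exact: K0K.
- rewrite dotDr o0//; move: cc (oc _ K0p); rewrite !dotE (dotC (PC x) (P0 x)); lra.
- move=> k Kk; have [K0k _ _] := metric_proj_cone cK0 K00 k.
  have Ck : cone_part (k - P0 k).
    split; last by move=> l lK; exact: vspace_proj_orth.
    by apply: cone_add => //; apply: K0K; rewrite /= rpredN.
  have := hc _ Ck; have := o0 _ K0k; have := vspace_proj_orth k K0p.
  rewrite !dotE (dotC (P0 x) k) (dotC (P0 x) (P0 k)); lra.
Qed.

Lemma lrtE x : lrt [set` K0] K x = dot (PC x) (PC x).
Proof.
rewrite /lrt (residual_sq cK0 K00) (residual_sq cK Kz) proj_decomp.
have [K0p _ _] := metric_proj_cone cK0 K00 x.
have [[_ oc] _ _] := metric_proj_cone cone_part_ccc cone_part0 x.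
by rewrite !dotE (dotC (P0 x) (PC x)) (oc _ K0p); ring.
Qed.

Lemma projsqB x : enorm (metric_proj K x) ^+ 2 - enorm (P0 x) ^+ 2 = dot (PC x) (PC x).
Proof.
rewrite !enorm2 proj_decomp.
have [K0p _ _] := metric_proj_cone cK0 K00 x.
have [[_ oc] _ _] := metric_proj_cone cone_part_ccc cone_part0 x.
by rewrite !dotE (dotC (P0 x) (PC x)) (oc _ K0p); ring.
Qed.

Lemma lrt_shift mu x : mu \in K0 ->
  lrt [set` K0] K (mu + x) = lrt [set` K0] K x.
Proof.
move=> muK; have shift C : closed_convex_cone C -> [set` K0] `<=` C ->
    metric_proj C (mu + x) = mu + metric_proj C x.
  move=> cC KC; have C0 : C 0 by exact: KC.
  have [Cp pp pc] := metric_proj_cone cC C0 x.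
  apply: metric_projE => //; rewrite /cone_proj opprD addrACA subrr add0r.
  split => //; first by apply: cone_add => //; exact: KC.
  rewrite dotDr pp addr0; apply/eqP; rewrite eq_le pc//; last exact: KC.
  by have := pc (- mu); rewrite dotNr oppr_le0 => -> //; apply: KC; rewrite /= rpredN.
by rewrite /lrt !shift// !opprD !addrA ![mu + x]addrC -!addrA !(addrA mu) !(addrN mu) !add0r.
Qed.

End lrt_reduction.
End projection.


(** * The normal law on the line and in the plane *)

Section push_measure.
Context d d' (T1 : measurableType d) (T2 : measurableType d') (R : realType).
Variables (m : {measure set T1 -> \bar R}) (f : T1 -> T2).
Hypothesis mf : measurable_fun [set: T1] f.

(** The image measure, packed with its structure: inference cannot recover the
    measurability proof from the bare set function. *)
Definition push_measure : {measure set T2 -> \bar R} :=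
  measure_function_pushforward__canonical__measure_function_Measure m mf.

Lemma push_measureE A : push_measure A = m (f @^-1` A).
Proof. by []. Qed.

End push_measure.

Section normal1.
Context {R : realType}.
Local Notation leb := (@lebesgue_measure R).
Local Notation gam := (normal_prob (0 : R) 1).
Local Notation phi := (normal_pdf (0 : R) 1).

Lemma normal_pdf01 x : phi x = normal_peak 1 * expR (- x ^+ 2 / 2).
Proof. by rewrite /normal_pdf oner_eq0 /= /normal_fun subr0 expr1n. Qed.

Lemma phi_gt0 x : 0 < phi x.
Proof. by rewrite normal_pdf01 mulr_gt0 ?expR_gt0// normal_peak_gt0// oner_neq0. Qed.

Lemma phi_continuous : continuous phi.
Proof. by apply: continuous_normal_pdf; exact: oner_neq0. Qed.

Lemma measurable_phi : measurable_fun setT phi.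
Proof. exact: measurable_normal_pdf. Qed.

Lemma ge0_integral_normal (f : R -> \bar R) : measurable_fun setT f ->
  (forall x, 0 <= f x)%E ->
  (\int[gam]_x f x = \int[leb]_x (f x * (phi x)%:E))%E.
Proof.
move=> mf f0.
have dom : gam `<< leb := normal_prob_dominates 0 1.
rewrite -(Radon_Nikodym_SigmaFinite.change_of_variables dom f0 measurableT mf).
have iRN := Radon_Nikodym_SigmaFinite.f_integrable dom.
apply: ae_eq_integral => //.
- by apply: emeasurable_funM => //; exact: measurable_int iRN.
- by apply: emeasurable_funM => //; apply/measurable_EFinP; exact: measurable_phi.
- apply: ae_eqe_mul2l; apply: integral_ae_eq => //.
    by apply/measurable_EFinP; exact: measurable_phi.
  by move=> A _ mA; rewrite -Radon_Nikodym_SigmaFinite.f_integral.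
Qed.

Lemma lebesgue_affine (a b : R) : 0 < a -> forall A, measurable A ->
  (a%:E * leb ((fun x => a * x + b)%R @^-1` A) = leb A)%E.
Proof.
move=> a0.
pose g : measurableTypeR R -> measurableTypeR R := fun x => a * x + b.
have mg : measurable_fun [set: measurableTypeR R] g.
  by apply: measurable_funD => //; exact: measurable_funM.
pose nu : {measure set (measurableTypeR R) -> \bar R} :=
  mscale (NngNum (ltW a0)) (push_measure leb mg).
suff h : forall X, ocitv X -> leb X = nu X.
  by move=> A mA; rewrite (@lebesgue_measure_unique _ nu h A mA).
move=> X [[u v] _ <-] /=.
have E : g @^-1` `]u, v]%classic = `](u - b) / a, (v - b) / a]%classic.
  apply/seteqP; split => x /=; rewrite /g !in_itv/= ltr_pdivrMr// ler_pdivlMr//;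
  rewrite (mulrC x) ltrBlDr lerBrDr//.
transitivity (a%:E * leb (g @^-1` `]u, v]%classic))%E; last by [].
rewrite E !lebesgue_measure_itv/= !lte_fin ltr_pM2r ?invr_gt0// ltrD2r.
case: ifPn => _; last by rewrite mule0.
by rewrite -!EFinB -EFinM; congr EFin; field; rewrite gt_eqF.
Qed.

Lemma ge0_integral_affine (a b : R) (f : R -> \bar R) : 0 < a ->
  measurable_fun setT f -> (forall x, 0 <= f x)%E ->
  (\int[leb]_x f x = a%:E * \int[leb]_x f (a * x + b)%R)%E.
Proof.
move=> a0 mf f0.
pose g : measurableTypeR R -> measurableTypeR R := fun x => a * x + b.
have mg : measurable_fun [set: measurableTypeR R] g.
  by apply: measurable_funD => //; exact: measurable_funM.
pose nu : {measure set (measurableTypeR R) -> \bar R} :=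
  mscale (NngNum (ltW a0)) (push_measure leb mg).
transitivity (\int[nu]_x f x)%E.
  by apply: eq_measure_integral => A mA _; exact: esym (lebesgue_affine b a0 mA).
rewrite ge0_integral_mscale//; congr (_ * _)%E.
by rewrite ge0_integral_pushforward// => x _; exact: f0.
Qed.

(** The rotation is the composite of two maps that are affine in one variable
    when the other one is fixed; their Jacobians are c and 1 / c. *)
Lemma lebesgue_rotation (c s : R) (f : R * R -> \bar R) : 0 < c ->
  c ^+ 2 + s ^+ 2 = 1 -> measurable_fun setT f -> (forall z, 0 <= f z)%E ->
  (\int[leb]_x \int[leb]_y f (c * x + s * y, c * y - s * x)%R =
   \int[leb]_x \int[leb]_y f (x, y))%E.
Proof.
move=> c0 cs mf f0; have c0' : c != 0 by rewrite gt_eqF.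
have m1 : measurable_fun [set: R * R] (fun z => f (c * z.1 + s * z.2, c * z.2 - s * z.1)).
  apply: (measurableT_comp mf); apply: measurable_fun_pair => /=.
    by apply: measurable_funD; apply: measurable_funM => //.
  by apply: measurable_funB; apply: measurable_funM => //.
have m2 : measurable_fun [set: R * R] (fun z => f (z.1, c^-1 * z.2 + - (s * z.1 / c))).
  apply: (measurableT_comp mf); apply: measurable_fun_pair => //=.
  apply: measurable_funD; first exact: measurable_funM.
  apply: measurableT_comp => //; apply: measurable_funM => //.
  exact: measurable_funM.
transitivity (\int[leb]_y \int[leb]_x f (c * x + s * y, c * y - s * x)%R)%E.
  exact: (@fubini_tonelli _ _ _ _ R leb leb _ m1).
transitivity (\int[leb]_y \int[leb]_x (c^-1%:E * f (x, c^-1 * y + - (s * x / c))%R))%E.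
  apply: eq_integral => y _.
  rewrite (_ : (\int[leb]_x f _ = \int[leb]_x
    (fun u => f (u, c^-1 * y + - (s * u / c))%R) (c * x + s * y)%R)%E); last first.
    apply: eq_integral => x _ /=; congr (f (_, _)).
    have -> : c^-1 * y = c^-1 * ((c ^+ 2 + s ^+ 2) * y) by rewrite cs mul1r.
    by field.
  rewrite ge0_integralZl//; last 2 first.
  - apply: (measurableT_comp mf); apply: measurable_fun_pair => //=.
    apply: measurable_funD; first exact: measurable_cst.
    by apply: measurableT_comp => //; apply: measurable_funM => //; exact: measurable_funM.
  - by rewrite lee_fin invr_ge0 ltW.
  rewrite [in RHS](ge0_integral_affine (s * y) c0)//; last first.
    apply: (measurableT_comp mf); apply: measurable_fun_pair => //=.
    apply: measurable_funD; first exact: measurable_cst.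
    by apply: measurableT_comp => //; apply: measurable_funM => //; exact: measurable_funM.
  by rewrite muleA -EFinM mulVf// mul1e.
transitivity (\int[leb]_x \int[leb]_y (c^-1%:E * f (x, c^-1 * y + - (s * x / c))%R))%E.
  apply/esym; apply: (@fubini_tonelli _ _ _ _ R leb leb
    (fun z => c^-1%:E * f (z.1, c^-1 * z.2 + - (s * z.1 / c))%R)%E).
    exact: emeasurable_funM.
  by move=> z; rewrite mule_ge0// lee_fin invr_ge0 ltW.
apply: eq_integral => x _.
rewrite [RHS](ge0_integral_affine (- (s * x / c)) (_ : 0 < c^-1)) ?invr_gt0//; last first.
  by apply: (measurableT_comp mf); apply: measurable_fun_pair => //=.
rewrite ge0_integralZl//; last by rewrite lee_fin invr_ge0 ltW.
apply: (measurableT_comp mf); apply: measurable_fun_pair => //=.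
by apply: measurable_funD => //; exact: measurable_funM.
Qed.

Lemma normal2E (S : set (R * R)) : measurable S ->
  ((gam \x gam) S = \int[leb]_x \int[leb]_y (\1_S (x, y) * (phi x * phi y))%:E)%E.
Proof.
move=> mS.
have mi : measurable_fun [set: R * R] (fun z => (\1_S z : R)%:E) by apply: measurableT_comp => //; exact: measurable_indic.
rewrite -[in LHS](setIT S) -integral_indic// fubini_tonelli1//= /fubini_F.
rewrite ge0_integral_normal//; last 2 first.
- apply: (measurable_fun_fubini_tonelli_F (m2 := gam) (fun z => (\1_S z : R)%:E));
    first [exact: mi | by move=> z; rewrite lee_fin].
- by move=> x; apply: integral_ge0 => y _; rewrite lee_fin.
apply: eq_integral => x _.
have mSx : measurable_fun [set: R] (fun y => (\1_S (x, y) : R)%:E).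
  by apply: (measurableT_comp mi); apply: measurable_fun_pair.
rewrite [X in (X * _)%E]ge0_integral_normal//.
rewrite muleC -ge0_integralZl//; last 3 first.
- by apply: emeasurable_funM => //; apply/measurable_EFinP; exact: measurable_phi.
- by move=> y _; rewrite mule_ge0// lee_fin// ltW// phi_gt0.
- by rewrite lee_fin ltW// phi_gt0.
by apply: eq_integral => y _; rewrite -!EFinM; congr EFin; ring.
Qed.

Lemma normal_rotation (c s : R) (A B : set R) : 0 < c -> c ^+ 2 + s ^+ 2 = 1 ->
  measurable A -> measurable B ->
  ((gam \x gam) [set z : R * R | A (c * z.1 + s * z.2)%R /\ B (c * z.2 - s * z.1)%R] = gam A * gam B)%E.
Proof.
move=> c0 cs mA mB.
transitivity ((gam \x gam) (A `*` B))%E; last exact: product_measure1E.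
pose rot (z : R * R) := (c * z.1 + s * z.2, c * z.2 - s * z.1).
have mrot : measurable_fun setT rot.
  apply: measurable_fun_pair => /=.
    by apply: measurable_funD; apply: measurable_funM => //.
  by apply: measurable_funB; apply: measurable_funM => //.
have mAB : measurable (A `*` B) by exact: measurableX.
have mS : measurable (rot @^-1` (A `*` B)).
  by rewrite -[X in measurable X]setTI; exact: mrot.
rewrite (normal2E mS) (normal2E mAB).
pose f (z : R * R) := (\1_(A `*` B) z * (phi z.1 * phi z.2))%:E.
have mf : measurable_fun setT f.
  apply/measurable_EFinP; apply: measurable_funM; first exact: measurable_indic.
  by apply: measurable_funM; exact: (measurableT_comp measurable_phi).
have f0 z : (0 <= f z)%E by rewrite lee_fin !mulr_ge0// ltW// phi_gt0.
apply: (etrans _ (lebesgue_rotation c0 cs mf f0)).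
apply: eq_integral => x _; apply: eq_integral => y _; rewrite /f /=; congr (EFin (_ * _)).
rewrite !normal_pdf01 [LHS]mulrACA [RHS]mulrACA -!expRD; congr (_ * expR _).
have -> : - x ^+ 2 / 2 + - y ^+ 2 / 2 = - ((c ^+ 2 + s ^+ 2) * (x ^+ 2 + y ^+ 2)) / 2.
  by rewrite cs mul1r; ring.
by ring.
Qed.

End normal1.


(** * One-dimensional calculus and normal moments *)

Section calculus1.
Context {R : realType}.
Local Notation leb := (@lebesgue_measure R).

(** Pointwise forms of the differentiation rules, for functions written as
    lambda-terms. *)
Lemma derivRD (f g : R -> R) (x a b : R) : is_derive x 1 f a -> is_derive x 1 g b ->
  is_derive x 1 (fun y => f y + g y) (a + b).
Proof. by move=> df dg; exact: is_deriveD. Qed.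

Lemma derivRM (f g : R -> R) (x a b : R) : is_derive x 1 f a -> is_derive x 1 g b ->
  is_derive x 1 (fun y => f y * g y) (a * g x + f x * b).
Proof.
move=> df dg; apply: (is_derive_eq (@is_deriveM _ _ f g x 1 a b df dg)).
by rewrite /GRing.scale /= addrC mulrC.
Qed.

Lemma derivR_comp (f g : R -> R) (x a b : R) : is_derive (g x) 1 f a ->
  is_derive x 1 g b -> is_derive x 1 (fun y => f (g y)) (a * b).
Proof. by move=> df dg; exact: is_derive1_comp. Qed.

Lemma derivR_cst (c x : R) : is_derive x 1 (fun _ : R => c) 0.
Proof. exact: is_derive_cst. Qed.

Lemma derivR_id (x : R) : is_derive x 1 (fun y : R => y) 1.
Proof. exact: is_derive_id. Qed.

Lemma is_derive_continuous (F f : R -> R) :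
  (forall x : R, is_derive x 1 F (f x)) -> continuous F.
Proof.
move=> dF x; apply: differentiable_continuous; apply/derivable1_diffP.
exact: (@ex_derive _ _ _ _ _ _ _ (dF x)).
Qed.

Lemma continuous_itv_integrable (f : R -> R) (a b : R) : continuous f ->
  leb.-integrable `[a, b] (EFin \o f).
Proof.
move=> cf; apply: continuous_compact_integrable; first exact: segment_compact.
exact: continuous_subspaceT.
Qed.

Lemma FTC (F f : R -> R) (a b : R) : a <= b ->
  (forall x : R, is_derive x 1 F (f x)) -> continuous f ->
  \int[leb]_(x in `[a, b]) f x = F b - F a.
Proof.
move=> ab dF cf; have cF := is_derive_continuous dF.
move: ab; rewrite le_eqVlt => /predU1P[<-|ab].
  by rewrite set_itv1 Rintegral_set1 subrr.
rewrite /Rintegral (@continuous_FTC2 _ f F)//.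
- exact: continuous_subspaceT.
- split; first by move=> x _; exact: (@ex_derive _ _ _ _ _ _ _ (dF x)).
    by apply: cvg_at_right_filter; exact: cF.
  by apply: cvg_at_left_filter; exact: cF.
- by move=> x _; rewrite derive1E; exact: (@derive_val _ _ _ _ _ _ _ (dF x)).
Qed.

Lemma ge0_FTCy (F f : R -> R) (a l : R) : (forall x, a <= x -> 0 <= f x) ->
  (forall x : R, is_derive x 1 F (f x)) -> continuous f ->
  F x @[x --> +oo] --> l ->
  \int[leb]_(x in `[a, +oo[) f x = l - F a.
Proof.
move=> f0 dF cf Fl; have cF := is_derive_continuous dF.
apply: (@Rintegral_ge0_continuous_FTC2y _ f F a l f0 _ Fl).
- exact: continuous_subspaceT.
- by move=> x _; exact: (@ex_derive _ _ _ _ _ _ _ (dF x)).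
- by apply: cvg_at_right_filter; exact: cF.
- by move=> x _; rewrite derive1E; exact: (@derive_val _ _ _ _ _ _ _ (dF x)).
Qed.

End calculus1.

Section normal_moments.
Context {R : realType}.
Local Notation leb := (@lebesgue_measure R).
Local Notation gam := (normal_prob (0 : R) 1).
Local Notation phi := (normal_pdf (0 : R) 1).

Lemma pow_le_expR (y : R) k : 0 <= y -> y ^+ k <= k`!%:R * expR y.
Proof.
move=> y0; case: k => [|k].
  by rewrite expr0 fact0 mul1r -[leLHS]expR0 ler_expR.
have := expR_ge1Dxn k y0; have f0 : (0 : R) < k.+1`!%:R by rewrite ltr0n fact_gt0.
by rewrite -ler_pdivrMl// mulrC; lra.
Qed.

(** Trading powers of x for a larger variance, so that integrability follows
    from that of the wider normal density. *)
Lemma pow_phi_le k : exists2 C : R, 0 <= C &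
  forall x : R, `|x| ^+ k * phi x <= C * normal_pdf 0 (Num.sqrt 2) x.
Proof.
have s2 : Num.sqrt 2 != 0 :> R by rewrite gt_eqF// sqrtr_gt0.
have p2 : 0 < normal_peak (Num.sqrt 2 : R) by exact: normal_peak_gt0.
have p1 : 0 < normal_peak (1 : R) by exact: normal_peak_gt0 (oner_neq0 _).
pose D : R := 1 + 4 ^+ k * k`!%:R.
have D0 : 0 <= D by rewrite addr_ge0// mulr_ge0// exprn_ge0.
exists (normal_peak 1 * D / normal_peak (Num.sqrt 2)).
  by rewrite divr_ge0 ?mulr_ge0// ltW.
move=> x; rewrite normal_pdf01 /normal_pdf (negbTE s2) /= /normal_fun subr0 sqr_sqrtr//.
set e2 := expR (- x ^+ 2 / (2 *+ 2)).
rewrite (_ : _ / _ * _ = normal_peak 1 * (D * e2)); last by field; rewrite gt_eqF.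
rewrite mulrCA (ler_wpM2l (ltW p1))// /e2.
have -> : - x ^+ 2 / 2 = - (x ^+ 2 / 4) + (- x ^+ 2 / (2 *+ 2)) by field.
rewrite expRD [leLHS]mulrA ler_wpM2r ?expR_ge0// expRN ler_pdivrMr ?expR_gt0//.
have x4 : 0 <= x ^+ 2 / 4 by rewrite divr_ge0// sqr_ge0.
have e1 : 1 <= expR (x ^+ 2 / 4) by rewrite -[leLHS]expR0 ler_expR.
rewrite /D mulrDl mul1r; have [x1|x1] := leP `|x| 1.
  apply: (@le_trans _ _ 1); first exact: exprn_ile1.
  rewrite (le_trans e1)// lerDl.
  by rewrite !mulr_ge0 ?expR_ge0// exprn_ge0.
apply: (@le_trans _ _ ((`|x| ^+ 2) ^+ k)).
  by rewrite -exprM ler_weXn2l ?(ltW x1)//; lia.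
have xy : x ^+ 2 = 4 * (x ^+ 2 / 4) by field.
rewrite real_normK ?num_real// {1}xy exprMn.
apply: (@le_trans _ _ (4 ^+ k * (k`!%:R * expR (x ^+ 2 / 4)))).
  by rewrite ler_wpM2l ?exprn_ge0// pow_le_expR.
by rewrite mulrA lerDr expR_ge0.
Qed.

Lemma integrable_pow_phi k : leb.-integrable setT (fun x => (`|x| ^+ k * phi x)%:E).
Proof.
have [C C0 hC] := pow_phi_le k.
apply: (le_integrable measurableT _ _ (integrableZl measurableT C (integrable_normal_pdf 0 (Num.sqrt 2)))).
  apply/measurable_EFinP; apply: measurable_funM; last exact: measurable_phi.
  by apply: measurable_funX; exact: normr_measurable.
move=> x _ /=; rewrite lee_fin ger0_norm ?mulr_ge0 ?exprn_ge0//; last by rewrite ltW// phi_gt0.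
exact: le_trans (hC x) (ler_norm _).
Qed.

Lemma normal_moment k : gam.-integrable setT (fun x : R => (`|x| ^+ k)%:E).
Proof.
have mk : measurable_fun [set: R] (fun x : R => `|x| ^+ k).
  by apply: measurable_funX; exact: normr_measurable.
apply/integrableP; split; first exact/measurable_EFinP.
have /integrableP[_] := integrable_pow_phi k; apply: le_lt_trans.
rewrite ge0_integral_normal//; last first.
  by apply: measurableT_comp => //; exact/measurable_EFinP.
apply: ge0_le_integral => //.
- by move=> x _; rewrite mule_ge0// lee_fin ltW// phi_gt0.
- apply: emeasurable_funM; last by apply/measurable_EFinP; exact: measurable_phi.
  by apply: measurableT_comp => //; exact/measurable_EFinP.
- apply: measurableT_comp => //; apply/measurable_EFinP.
  by apply: measurable_funM => //; exact: measurable_phi.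
- by move=> x _; rewrite /= normrM (ger0_norm (ltW (phi_gt0 _))).
Qed.

Lemma is_derive_phi (x : R) : is_derive x 1 phi (- x * phi x).
Proof.
rewrite (_ : phi = fun x => normal_peak 1 * expR (- x ^+ 2 / 2)); last first.
  by apply/funext => y; rewrite normal_pdf01.
have h : is_derive x 1 (fun y : R => - y ^+ 2 / 2) (- x).
  rewrite (_ : (fun y : R => _) = (fun y => (- 2^-1) * (y * y))).
    apply: (is_derive_eq (derivRM (derivR_cst (- 2^-1) x) (derivRM (derivR_id x) (derivR_id x)))).
    by field.
  by apply/funext => y; rewrite expr2; ring.
apply: (is_derive_eq (derivRM (derivR_cst (normal_peak 1) x) (derivR_comp (is_derive_expR _) h))).
by ring.
Qed.

(** The derivative of - x phi x is x^2 phi x - phi x. *)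
Lemma normal_variance : (\int[gam]_x (x ^+ 2)%:E = 1)%E.
Proof.
pose F (x : R) := -1 * x * phi x.
pose f (x : R) := x ^+ 2 * phi x - phi x.
have dF (x : R) : is_derive x 1 F (f x).
  have := is_derive_phi x => dphi; rewrite /F.
  have dx := derivRM (derivR_cst (-1) x) (derivR_id x).
  apply: (is_derive_eq (derivRM dx dphi)).
  by rewrite /f; ring.
have cphi := @phi_continuous R.
have cX : continuous (fun x : R => x ^+ 2) by move=> x; exact: exprn_continuous.
have c2 : continuous (fun x : R => x ^+ 2 * phi x).
  by move=> x; apply: cvgM; [exact: cX|exact: cphi].
have cf : continuous f by move=> x; apply: cvgB; [exact: c2|exact: cphi].
have F0 : F x @[x --> +oo] --> 0.
  have [C C0 hC] := pow_phi_le 2.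
  pose D := C * normal_peak (Num.sqrt 2).
  have D0 : 0 <= D by rewrite mulr_ge0// normal_peak_ge0.
  apply/cvgrPdist_le => e e0; near=> x.
  have x0 : 0 < x by near: x; exact: nbhs_pinfty_gt.
  rewrite sub0r normrN /F !normrM normrN1 mul1r (ger0_norm (ltW x0)) (ger0_norm (ltW (phi_gt0 _))).
  apply: (@le_trans _ _ (D / x)).
    rewrite ler_pdivlMr// mulrAC -expr2 (le_trans (_ : _ <= `|x| ^+ 2 * phi x))//.
      by rewrite (ger0_norm (ltW x0)).
    rewrite (le_trans (hC x))// ler_wpM2l// normal_pdf_ub// gt_eqF// sqrtr_gt0//.
  by rewrite ler_pdivrMr// mulrC -ler_pdivrMr//.
have i2 : leb.-integrable setT (EFin \o (fun x : R => x ^+ 2 * phi x)).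
  apply: eq_integrable (integrable_pow_phi 2) => // x _ /=.
  by rewrite real_normK ?num_real.
have i0 : leb.-integrable setT (EFin \o phi) := integrable_normal_pdf 0 1.
have ifT : leb.-integrable setT (EFin \o f).
  by have := integrableB measurableT i2 i0; apply: eq_integrable => // x _.
have ifp : leb.-integrable `[0, +oo[ (EFin \o f).
  by apply: (integrableS measurableT _ (subsetT _) ifT).
have I0 : \int[leb]_(x in `[0, +oo[) f x = 0.
  have := @Rintegral_itvB R f (BLeft 0) +oo%O 1 ifp.
  rewrite !bnd_simp => /(_ ler01 isT) /eqP; rewrite subr_eq => /eqP ->.
  rewrite Rintegral_itv_obnd_cbnd; last first.
    by apply: (integrableS measurableT _ (subsetT _) ifT).
  rewrite (@ge0_FTCy _ F f 1 0)//; last first.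
    move=> x x1; rewrite /f -[X in _ - X]mul1r -mulrBl mulr_ge0 ?(ltW (phi_gt0 _))// subr_ge0.
    exact: exprn_ege1.
  by rewrite (@FTC _ F f 0 1)// /F; lra.
have E : (\int[leb]_(x in `[0%R, +oo[) (x ^+ 2 * phi x)%:E =
          \int[leb]_(x in `[0%R, +oo[) (phi x)%:E)%E.
  have i2' : leb.-integrable `[0, +oo[ (EFin \o (fun x : R => x ^+ 2 * phi x)).
    by apply: (integrableS measurableT _ (subsetT _) i2).
  have i0' : leb.-integrable `[0, +oo[ (EFin \o phi).
    by apply: (integrableS measurableT _ (subsetT _) i0).
  move: I0; rewrite RintegralB// => /eqP; rewrite subr_eq0 => /eqP I0.
  rewrite -[LHS]fineK; last exact: integrable_fin_num i2'.
  rewrite -[RHS]fineK; last exact: integrable_fin_num i0'.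
  by congr EFin.
rewrite ge0_integral_normal//; last 2 first.
- by apply/measurable_EFinP; exact: measurable_funX.
- by move=> x; rewrite lee_fin sqr_ge0.
have sym x : phi (- x) = phi x by rewrite !normal_pdf01 sqrrN.
transitivity (\int[leb]_x (phi x)%:E)%E; last exact: integral_normal_pdf.
rewrite [RHS]ge0_symfun_integralT//; last 2 first.
- by move=> x; exact: ltW (phi_gt0 _).
- by move=> x /=; rewrite sym.
under eq_integral do rewrite -EFinM.
rewrite ge0_symfun_integralT//; last 2 first.
- by move=> x; rewrite mulr_ge0 ?sqr_ge0// ltW// phi_gt0.
- by move=> x /=; rewrite sym sqrrN.
by rewrite -set_itvcy E.
Unshelve. all: by end_near. Qed.

End normal_moments.


(** * Measurability and laws of random vectors *)

Section measurable_tame.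
Context {R : realType} d (T : measurableType d) (n : nat) (X : T -> 'rV[R]_n).
Hypothesis mX : forall i, measurable_fun [set: T] (fun w => X w ord0 i).

Let lattice k w : 'rV[int]_n := \row_i Num.floor (k.+1%:R * X w ord0 i).
Let scaled k (z : 'rV[int]_n) : 'rV[R]_n := \row_i ((z ord0 i)%:~R / k.+1%:R).

Let scaled_dist k w : enorm (X w - scaled k (lattice k w)) <= n%:R / k.+1%:R.
Proof.
rewrite (le_trans (ler_enorm_sum _))//.
apply: (@le_trans _ _ (\sum_(i < n) k.+1%:R^-1)); last first.
  by rewrite sumr_const card_ord -[leLHS]mulr_natl.
apply: ler_sum => i _; rewrite !mxE.
have k0 : (0 : R) < k.+1%:R by rewrite ltr0n.
have := floor_itv (k.+1%:R * X w ord0 i); rewrite intrD => /andP[].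
set z := (Num.floor _)%:~R => h1 h2.
rewrite -[X in `|X - _|](mulKf (lt0r_neq0 k0)) mulrC -mulrBl normrM.
rewrite (ger0_norm (_ : 0 <= k.+1%:R^-1)) ?invr_ge0// ler_piMl ?invr_ge0//.
by rewrite ger0_norm ?subr_ge0//; lra.
Qed.

(** Rounding the coordinates to the lattice of step 1 / (k + 1) gives functions
    with countably many values, which converge by continuity. *)
Lemma measurable_tame (g : 'rV[R]_n -> R) : tame g ->
  measurable_fun [set: T] (fun w => g (X w)).
Proof.
move=> tg; apply: (@measurable_fun_cvg _ _ _ setT
  (fun k w => g (scaled k (lattice k w)))).
  move=> k _ Y mY; rewrite setTI.
  rewrite (_ : _ @^-1` Y = \bigcup_(z : 'rV[int]_n)
    (if g (scaled k z) \in Y then \bigcap_(i in [set: 'I_n])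
       [set w | (z ord0 i)%:~R <= k.+1%:R * X w ord0 i < (z ord0 i + 1)%:~R]
     else set0)); last first.
    apply/seteqP; split => w.
      move=> /= Yw; exists (lattice k w) => //; rewrite mem_set// => i _ /=.
      by rewrite mxE floor_itv.
    move=> [z _]; case: ifPn => //; rewrite inE => Yz h /=.
    suff -> : lattice k w = z by [].
    by apply/rowP => i; rewrite mxE; apply/eqP; rewrite floor_eq; exact: h.
  apply: countable_bigcupT_measurable => [|z]; first exact: countableP.
  case: ifPn => // _; apply: fin_bigcap_measurable => // i _.
  rewrite (_ : [set w | _] = (fun w => k.+1%:R * X w ord0 i) @^-1`
     `[(z ord0 i)%:~R, (z ord0 i + 1)%:~R[%classic); last first.
    by apply/seteqP; split => w /=; rewrite in_itv.
  rewrite -[X in measurable X]setTI.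
  by apply: (measurable_funM (measurable_cst _) (mX i)) => //; exact: measurable_itv.
move=> w _; move: tg => [C C0 [l gC]].
pose M := C * (wt (X w) * (wt (X w) + n%:R)) ^+ l * n%:R.
have M0 : 0 <= M by rewrite !mulr_ge0// exprn_ge0// mulr_ge0 ?wt_ge0// addr_ge0 ?wt_ge0.
apply/cvgrPdist_le => e e0; near=> k.
have k0 : (0 : R) < k.+1%:R by rewrite ltr0n.
have nk : n%:R / k.+1%:R <= n%:R :> R.
  by rewrite ler_pdivrMr// ler_peMr// -[leLHS](mulr1n 1) ler_nat.
set z := scaled k _; have dz : enorm (X w - z) <= n%:R / k.+1%:R := scaled_dist k w.
have wz : wt z <= wt (X w) + n%:R.
  have : enorm z <= enorm (X w - z) + enorm (X w).
    by have := enorm_triangle (X w) z 0; rewrite !subr0 (enormBC z).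
  have := le_trans dz nk; rewrite !wtE => h1 h2.
  by rewrite -addrA lerD2l [leRHS]addrC; apply: (le_trans h2); exact: lerD.
rewrite (le_trans (gC _ _))//.
apply: (@le_trans _ _ (M / k.+1%:R)).
  rewrite (_ : M / _ = C * (wt (X w) * (wt (X w) + n%:R)) ^+ l * (n%:R / k.+1%:R)); last first.
    by rewrite /M; ring.
  apply: ler_pM => //; rewrite ?mulr_ge0 ?wtMX_ge0 ?enorm_ge0//.
  rewrite ler_wpM2l// lerXn2r ?nnegrE ?mulr_ge0 ?addr_ge0 ?wt_ge0//.
  by rewrite ler_wpM2l ?wt_ge0.
rewrite ler_pdivrMr// mulrC -ler_pdivrMr//.
rewrite -natr1 (@le_trans _ _ k%:R)// ?lerDl//.
by near: k; exact: nbhs_infty_ger.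
Unshelve. all: by end_near. Qed.

End measurable_tame.

(** The joint law of a random row vector, as a measure on tuples: they carry
    the product sigma-algebra. *)
Section tuple_law.
Context {R : realType} {n : nat}.

Definition tuple_of_row (x : 'rV[R]_n) : n.-tuple R := [tuple x ord0 i | i < n].
Definition row_of_tuple (t : n.-tuple R) : 'rV[R]_n := \row_i tnth t i.

Lemma tuple_of_rowK : cancel tuple_of_row row_of_tuple.
Proof. by move=> x; apply/rowP => i; rewrite mxE tnth_mktuple. Qed.

Lemma measurable_tuple_of_row d (T : measurableType d) (X : T -> 'rV[R]_n) :
  (forall i, measurable_fun [set: T] (fun w => X w ord0 i)) ->
  measurable_fun [set: T] (fun w => tuple_of_row (X w)).
Proof.
move=> mX; apply/measurable_fun_tnthP => i.
rewrite (_ : _ \o _ = fun w => X w ord0 i)//.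
by apply/funext => w /=; rewrite tnth_mktuple.
Qed.

Definition boxes : set (set (n.-tuple R)) :=
  [set A | exists B : 'I_n -> set R, (forall i, measurable (B i)) /\
     A = [set t | forall i, B i (tnth t i)]].

Lemma measurable_box (B : 'I_n -> set R) : (forall i, measurable (B i)) ->
  measurable [set t : n.-tuple R | forall i, B i (tnth t i)].
Proof.
move=> mB; rewrite (_ : [set t | _] =
  \bigcap_(i in [set: 'I_n]) ((fun t : n.-tuple R => tnth t i) @^-1` B i)).
  apply: fin_bigcap_measurable => // i _; rewrite -[X in measurable X]setTI.
  by apply: measurable_tnth => //; exact: mB.
by apply/seteqP; split => t h i => [_|]; exact: h.
Qed.

Lemma measurable_boxes : (@measurable _ (n.-tuple R)) = <<s boxes >>.
Proof.
apply/seteqP; split; last first.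
  apply: smallest_sub; first exact: sigma_algebra_measurable.
  by move=> _ [B [mB ->]]; exact: measurable_box.
apply: smallest_sub; first exact: smallest_sigma_algebra.
apply: (big_ind (fun X => X `<=` <<s boxes>>)) => [//|X Y hX hY|i _ A [B mB <-]].
  by rewrite subUset.
apply: sub_sigma_algebra.
exists (fun j => if j == i then B else setT); split.
  by move=> j; case: ifPn.
apply/seteqP; split => t /=.
  by move=> [_ Bt] j; case: eqP => // ->.
by move=> /(_ i); rewrite eqxx.
Qed.

Lemma boxesI : setI_closed boxes.
Proof.
move=> _ _ [A [mA ->]] [B [mB ->]]; exists (fun i => A i `&` B i).
split; first by move=> i; exact: measurableI.
apply/seteqP; split => t /=; first by move=> [hA hB] i; split; [exact: hA|exact: hB].
by move=> h; split => i; have [] := h i.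
Qed.

Lemma tuple_law_unique d1 (T1 : measurableType d1) (P : probability T1 R)
    d2 (T2 : measurableType d2) (Q : probability T2 R)
    (X : T1 -> 'rV[R]_n) (Y : T2 -> 'rV[R]_n) :
  standard_gaussian P X -> standard_gaussian Q Y -> forall A, measurable A ->
  P ((fun w => tuple_of_row (X w)) @^-1` A) = Q ((fun w => tuple_of_row (Y w)) @^-1` A).
Proof.
move=> [mX PX] [mY QY] A mA.
pose m1 := push_measure P (measurable_tuple_of_row mX).
pose m2 := push_measure Q (measurable_tuple_of_row mY).
suff : m1 A = m2 A by [].
apply: (measure_unique boxes (fun _ => setT)) => //.
- exact: measurable_boxes.
- exact: boxesI.
- move=> _; exists (fun _ => setT); split => //.
  by apply/seteqP; split.
- by apply/seteqP; split => // x _; exists 0%N.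
- move=> _ [B [mB ->]]; rewrite /m1 /m2 !push_measureE.
  transitivity (P [set w | forall i, B i (X w ord0 i)]).
    by congr (P _); apply/seteqP; split => w /= h i; have := h i; rewrite tnth_mktuple.
  rewrite PX// -QY//.
  by congr (Q _); apply/seteqP; split => w /= h i; have := h i; rewrite tnth_mktuple.
- move=> _; rewrite /m1 push_measureE preimage_setT.
  by rewrite (le_lt_trans (probability_le1 _ _))// ltry.
Qed.

End tuple_law.


(** * Gaussian expectations *)

Section gaussian_vector.
Context {R : realType} d (Omega : measurableType d) (P : probability Omega R).
Context {n : nat} (xi : Omega -> 'rV[R]_n).
Hypothesis gxi : standard_gaussian P xi.
Local Notation gam := (normal_prob (0 : R) 1).

Let mxi := gxi.1.

Lemma gauss_coord i B : measurable B ->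
  P ((fun w => xi w ord0 i) @^-1` B) = gam B.
Proof.
move=> mB; have := gxi.2 (fun j => if j == i then B else setT).
rewrite (bigD1 i)//= eqxx big1 ?mule1; last first.
  by move=> j /negbTE ->; exact: probability_setT.
move=> <-; last by move=> j; case: ifPn.
congr (P _); apply/seteqP; split => w /=.
  by move=> Bw j; case: eqP => // ->.
by move=> /(_ i); rewrite eqxx.
Qed.

Lemma gauss_coord_integral i (f : R -> \bar R) : measurable_fun setT f ->
  (forall x, 0 <= f x)%E ->
  (\int[P]_w f (xi w ord0 i) = \int[gam]_x f x)%E.
Proof.
move=> mf f0.
pose X : Omega -> measurableTypeR R := fun w => xi w ord0 i.
have mX : measurable_fun [set: Omega] X := mxi i.
pose nu : {measure set (measurableTypeR R) -> \bar R} := push_measure P mX.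
transitivity (\int[nu]_x f x)%E.
  by rewrite ge0_integral_pushforward// => x _; exact: f0.
by apply: eq_measure_integral => A mA _; exact: gauss_coord.
Qed.

Definition all_moments (X : Omega -> R) := measurable_fun setT X /\
  forall k, P.-integrable setT (fun w => (`|X w| ^+ k)%:E).

Lemma all_moments_coord i : all_moments (fun w => xi w ord0 i).
Proof.
split => [|k]; first exact: mxi.
have mk : measurable_fun [set: R] (fun x : R => `|x| ^+ k).
  by apply: measurable_funX; exact: normr_measurable.
apply/integrableP; split.
  by apply/measurable_EFinP; exact: (measurableT_comp mk (mxi i)).
have /integrableP[_] := @normal_moment R k; apply: le_lt_trans.
rewrite -(gauss_coord_integral i)//.
by apply: measurableT_comp => //; exact/measurable_EFinP.
Qed.

Lemma all_moments_cst c : all_moments (fun _ => c).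
Proof.
split => // k; exact: finite_measure_integrable_cst.
Qed.

Lemma all_momentsD (X Y : Omega -> R) : all_moments X -> all_moments Y ->
  all_moments (fun w => X w + Y w).
Proof.
move=> [mX iX] [mY iY]; split => [|k]; first exact: measurable_funD.
have i2 := integrableZl measurableT (2 ^+ k) (integrableD measurableT (iX k) (iY k)).
apply: (le_integrable measurableT _ _ i2).
  apply/measurable_EFinP; apply: measurable_funX.
  by apply: (measurableT_comp (@normr_measurable _ _)); exact: measurable_funD.
move=> w _ /=; rewrite lee_fin normrX normr_id.
rewrite [leRHS]ger0_norm ?mulr_ge0 ?addr_ge0 ?exprn_ge0//.
set a := `|X w|; set b := `|Y w|.
have a0 : 0 <= a by exact: normr_ge0.
have b0 : 0 <= b by exact: normr_ge0.
apply: (@le_trans _ _ ((2 * Num.max a b) ^+ k)).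
  apply: lerXn2r; rewrite ?nnegrE ?normr_ge0 ?mulr_ge0 ?le_max ?a0//.
  apply: (le_trans (ler_normD _ _)); rewrite -/a -/b mulr_natl mulr2n.
  by rewrite lerD// le_max lexx ?orbT.
rewrite exprMn ler_wpM2l ?exprn_ge0//.
by have [ab|ab] := leP a b; rewrite ?lerDl ?lerDr exprn_ge0.
Qed.

Lemma all_moments_le (X Y : Omega -> R) : measurable_fun setT X -> all_moments Y ->
  (forall w, `|X w| <= `|Y w|) -> all_moments X.
Proof.
move=> mX [mY iY] XY; split => // k.
apply: (le_integrable measurableT _ _ (iY k)).
  apply/measurable_EFinP; apply: measurable_funX.
  exact: (measurableT_comp (@normr_measurable _ _)).
move=> w _ /=; rewrite lee_fin !normrX !normr_id.
by rewrite lerXn2r ?nnegrE.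
Qed.

Lemma all_moments_wt : all_moments (fun w => wt (xi w)).
Proof.
apply: (@all_moments_le _ (fun w => 1 + \sum_(i < n) `|xi w ord0 i|)).
- by apply: measurable_tame => //; auto with tame.
- apply: all_momentsD; first exact: all_moments_cst.
  elim: (index_enum _) => [|i r ih].
    by under eq_fun do rewrite big_nil; exact: all_moments_cst.
  under eq_fun do rewrite big_cons; apply: all_momentsD => //.
  apply: all_moments_le (all_moments_coord i) _.
    exact: (measurableT_comp (@normr_measurable _ _)).
  by move=> w; rewrite normr_id.
- move=> w; rewrite ger0_norm ?wt_ge0// ger0_norm ?addr_ge0 ?sumr_ge0//.
  by rewrite wtE lerD2l ler_enorm_sum.
Qed.

Lemma tame_integrable (g : 'rV[R]_n -> R) : tame g ->
  P.-integrable setT (fun w => (g (xi w))%:E).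
Proof.
move=> tg; have [C C0 [k gC]] := tame_polybd tg.
apply: (le_integrable measurableT _ _
  (integrableZl measurableT C (all_moments_wt.2 k))).
  by apply/measurable_EFinP; exact: measurable_tame.
move=> w _ /=; rewrite lee_fin (le_trans (gC _))//.
by rewrite (ger0_norm (wt_ge0 _)) ler_norm.
Qed.

End gaussian_vector.

Section gaussian_expectation.
Context {R : realType}.

Definition gE d (Omega : measurableType d) (P : probability Omega R) n
  (xi : Omega -> 'rV[R]_n) (g : 'rV[R]_n -> R) : R := \int[P]_w g (xi w).

Section fixed.
Context d (Omega : measurableType d) (P : probability Omega R).
Context {n : nat} (xi : Omega -> 'rV[R]_n).
Hypothesis gxi : standard_gaussian P xi.
Local Notation E := (gE P xi).

Lemma gE_EFin g : tame g -> (\int[P]_w (g (xi w))%:E = (E g)%:E)%E.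
Proof. by move=> tg; rewrite fineK//; apply: integrable_fin_num => //; exact: tame_integrable. Qed.

Lemma gE_eq f g : f =1 g -> E f = E g.
Proof. by move=> fg; apply: eq_Rintegral => w _; exact: fg. Qed.

Lemma gED f g : tame f -> tame g -> E (fun x => f x + g x) = E f + E g.
Proof. by move=> tf tg; apply: RintegralD => //; exact: tame_integrable. Qed.

Lemma gEZ a f : tame f -> E (fun x => a * f x) = a * E f.
Proof. by move=> tf; apply: RintegralZl => //; exact: tame_integrable. Qed.

Lemma gEB f g : tame f -> tame g -> E (fun x => f x - g x) = E f - E g.
Proof. by move=> tf tg; apply: RintegralB => //; exact: tame_integrable. Qed.

Lemma gEN f : tame f -> E (fun x => - f x) = - E f.
Proof.
move=> tf; rewrite -mulN1r -gEZ//; apply: gE_eq => x; by rewrite mulN1r.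
Qed.

Lemma gE_cst a : E (fun _ => a) = a.
Proof.
rewrite /gE Rintegral_cst// -[RHS]mulr1; congr (_ * _).
exact: (congr1 fine (probability_setT P)).
Qed.

Lemma gE_sum (I : Type) (r : seq I) (f : I -> 'rV[R]_n -> R) :
  (forall i, tame (f i)) ->
  E (fun x => \sum_(i <- r) f i x) = \sum_(i <- r) E (f i).
Proof.
move=> tf; elim: r => [|i r ih].
  by under gE_eq do rewrite big_nil; rewrite gE_cst big_nil.
rewrite big_cons -ih -gED//; last by auto with tame.
by apply: gE_eq => x; rewrite big_cons.
Qed.

Lemma gE_le f g : tame f -> tame g -> (forall x, f x <= g x) -> E f <= E g.
Proof. by move=> tf tg fg; apply: le_Rintegral => //; exact: tame_integrable. Qed.

Lemma gE_ge0 f : (forall x, 0 <= f x) -> 0 <= E f.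
Proof. by move=> f0; apply: Rintegral_ge0 => w _; exact: f0. Qed.

Lemma gE_abs_le f g : tame f -> tame g -> (forall x, `|f x| <= g x) ->
  `|E f| <= E g.
Proof.
move=> tf tg fg; rewrite ler_norml -gEN//.
by apply/andP; split; apply: gE_le; auto with tame => x;
   have := fg x; rewrite ler_norml => /andP[].
Qed.

(** Cauchy--Schwarz against the constant 1. *)
Lemma gE_abs_sqr f : tame f -> `|E f| <= Num.sqrt (E (fun x => f x ^+ 2)).
Proof.
move=> tf; rewrite -(ler_pXn2r (n := 2))// ?nnegrE ?normr_ge0 ?sqrtr_ge0//.
rewrite sqr_sqrtr; last by apply: gE_ge0 => x; exact: sqr_ge0.
rewrite real_normK ?num_real//.
have : 0 <= E (fun x => (f x - E f) ^+ 2) by apply: gE_ge0 => x; exact: sqr_ge0.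
rewrite (gE_eq (_ : _ =1 fun x => f x ^+ 2 - (2 * E f * f x - E f ^+ 2))); last first.
  by move=> x; ring.
have t1 : tame (fun x => 2 * E f * f x) by exact: tameZ.
have tc : tame (fun _ : 'rV[R]_n => E f ^+ 2) by exact: tame_cst.
rewrite gEB//; [|exact: tameX|exact: tameB].
by rewrite gEB// gEZ// gE_cst expr2; lra.
Qed.

End fixed.

Lemma gE_law d1 (T1 : measurableType d1) (P : probability T1 R)
    d2 (T2 : measurableType d2) (Q : probability T2 R) n
    (X : T1 -> 'rV[R]_n) (Y : T2 -> 'rV[R]_n) (g : 'rV[R]_n -> R) :
  standard_gaussian P X -> standard_gaussian Q Y -> tame g -> gE P X g = gE Q Y g.
Proof.
move=> gX gY tg.
pose m1 := push_measure P (measurable_tuple_of_row gX.1).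
pose m2 := push_measure Q (measurable_tuple_of_row gY.1).
have mg : measurable_fun [set: n.-tuple R] (fun t => (g (row_of_tuple t))%:E).
  apply/measurable_EFinP; apply: measurable_tame => // i.
  rewrite (_ : (fun w => _) = (fun t : n.-tuple R => tnth t i)).
    exact: measurable_tnth.
  by apply/funext => t; rewrite mxE.
transitivity (fine (\int[m1]_t (g (row_of_tuple t))%:E)%E).
  congr fine; rewrite integral_pushforward//; last 2 first.
  - exact: measurable_tuple_of_row gX.1.
  - rewrite preimage_setT; apply: eq_integrable (tame_integrable gX tg) => // w _ /=.
    by rewrite tuple_of_rowK.
  by rewrite preimage_setT; apply: eq_integral => w _ /=; rewrite tuple_of_rowK.
transitivity (fine (\int[m2]_t (g (row_of_tuple t))%:E)%E).
  by congr fine; apply: eq_measure_integral => A mA _; exact: tuple_law_unique.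
congr fine; rewrite integral_pushforward//; last 2 first.
- exact: measurable_tuple_of_row gY.1.
- rewrite preimage_setT; apply: eq_integrable (tame_integrable gY tg) => // w _ /=.
  by rewrite tuple_of_rowK.
by rewrite preimage_setT; apply: eq_integral => w _ /=; rewrite tuple_of_rowK.
Qed.

End gaussian_expectation.


(** * Rotation invariance *)

Section gaussian_constructions.
Context {R : realType}.
Local Notation gam := (normal_prob (0 : R) 1).

Lemma measurable_box_event d (T : measurableType d) n (X : T -> 'rV[R]_n)
    (D : set 'I_n) (B : 'I_n -> set R) :
  (forall i, measurable_fun [set: T] (fun w => X w ord0 i)) ->
  (forall i, measurable (B i)) ->
  measurable [set w | forall i, D i -> B i (X w ord0 i)].
Proof.
move=> mX mB; rewrite (_ : [set w | _] =
    \bigcap_(i in D) ((fun w => X w ord0 i) @^-1` B i)); last by apply/seteqP; split.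
apply: fin_bigcap_measurable; first exact: finite_finset.
by move=> i _; rewrite -[X in measurable X]setTI; apply: mX.
Qed.

Lemma gaussian_row_mx d1 (T1 : measurableType d1) (P : probability T1 R)
    d2 (T2 : measurableType d2) (Q : probability T2 R) n m
    (X : T1 -> 'rV[R]_n) (Y : T2 -> 'rV[R]_m) :
  standard_gaussian P X -> standard_gaussian Q Y ->
  standard_gaussian (P \x Q)%E (fun w => row_mx (X w.1) (Y w.2)).
Proof.
move=> [mX PX] [mY QY]; split.
  move=> i; case: (split_ordP i) => j -> /=.
    under eq_fun do rewrite row_mxEl.
    exact: (measurableT_comp (mX j)).
  under eq_fun do rewrite row_mxEr.
  exact: (measurableT_comp (mY j)).
move=> B mB; rewrite big_split_ord/=.
rewrite -(PX (fun i => B (lshift m i)))// -(QY (fun i => B (rshift n i)))//.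
rewrite -product_measure1E; last 2 first.
- have := @measurable_box_event _ _ _ _ setT (fun i => B (lshift m i)) mX.
  move=> /(_ (fun i => mB _)); congr measurable.
  by apply/seteqP; split => w /= h i => [|_]; exact: h.
- have := @measurable_box_event _ _ _ _ setT (fun i => B (rshift n i)) mY.
  move=> /(_ (fun i => mB _)); congr measurable.
  by apply/seteqP; split => w /= h i => [|_]; exact: h.
congr ((P \x Q)%E _); apply/seteqP; split => -[w1 w2] /=.
  move=> h; split => i.
    by have := h (lshift m i); rewrite row_mxEl.
  by have := h (rshift n i); rewrite row_mxEr.
move=> [h1 h2] i; case: (split_ordP i) => j -> /=.
  by rewrite row_mxEl.
by rewrite row_mxEr.
Qed.

Lemma gaussian_lsubmx d (T : measurableType d) (P : probability T R) n m
    (X : T -> 'rV[R]_(n + m)) :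
  standard_gaussian P X -> standard_gaussian P (fun w => lsubmx (X w)).
Proof.
move=> [mX PX]; split.
  by move=> i; under eq_fun do rewrite mxE; exact: mX.
move=> B mB.
have := PX (fun k => match fintype.split k with inl i => B i | inr _ => setT end).
rewrite big_split_ord/= [X in (_ * X)%E]big1 ?mule1; last first.
  by move=> i _; rewrite (fintype.unsplitK (inr i)) probability_setT.
under eq_bigr do rewrite (fintype.unsplitK (inl _)).
move=> <-; last by move=> k; case: (fintype.split k).
congr (P _); apply/seteqP; split => w /= h i.
  by case: split_ordP => j -> //; have := h j; rewrite mxE.
by have := h (lshift m i); rewrite (fintype.unsplitK (inl i)) mxE.
Qed.

Lemma gaussian_rsubmx d (T : measurableType d) (P : probability T R) n m
    (X : T -> 'rV[R]_(n + m)) :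
  standard_gaussian P X -> standard_gaussian P (fun w => rsubmx (X w)).
Proof.
move=> [mX PX]; split.
  by move=> i; under eq_fun do rewrite mxE; exact: mX.
move=> B mB.
have := PX (fun k => match fintype.split k with inr i => B i | inl _ => setT end).
rewrite big_split_ord/= [X in (X * _)%E]big1 ?mul1e; last first.
  by move=> i _; rewrite (fintype.unsplitK (inl i)) probability_setT.
under eq_bigr do rewrite (fintype.unsplitK (inr _)).
move=> <-; last by move=> k; case: (fintype.split k).
congr (P _); apply/seteqP; split => w /= h i.
  by case: split_ordP => j -> //; have := h j; rewrite mxE.
by have := h (rshift n i); rewrite (fintype.unsplitK (inr i)) mxE.
Qed.

Definition rotij n (c s : R) (i j : 'I_n) (x : 'rV[R]_n) : 'rV[R]_n :=
  \row_k if k == i then c * x ord0 i + s * x ord0 j else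
         if k == j then c * x ord0 j - s * x ord0 i else x ord0 k.

(** On the event fixed by the other coordinates, the law of the pair (i, j) is
    a multiple of the two-dimensional normal law, which is rotation
    invariant. *)
Lemma gaussian_rotij d (T : measurableType d) (P : probability T R) n
    (X : T -> 'rV[R]_n) (c s : R) (i j : 'I_n) :
  0 < c -> c ^+ 2 + s ^+ 2 = 1 -> i != j ->
  standard_gaussian P X -> standard_gaussian P (fun w => rotij c s i j (X w)).
Proof.
move=> c0 cs ij [mX PX]; split.
  move=> k; under eq_fun do rewrite mxE.
  have [_|_] := eqVneq k i.
    by apply: measurable_funD; apply: measurable_funM => //; exact: measurable_cst.
  have [_|_] := eqVneq k j; last exact: mX.
  by apply: measurable_funB; apply: measurable_funM => //; exact: measurable_cst.
move=> B mB.
pose S0 := [set w | forall k, k != i /\ k != j -> B k (X w ord0 k)].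
have mS0 : measurable S0 := @measurable_box_event _ _ _ _ [set k | k != i /\ k != j] B mX mB.
pose XY : T -> measurableTypeR R * measurableTypeR R := fun w => (X w ord0 i, X w ord0 j).
have mXY : measurable_fun [set: T] XY.
  by apply: measurable_fun_pair; exact: mX.
pose kappa := (\prod_(k < n | (k != i) && (k != j)) gam (B k))%E.
have k0 : (0 <= kappa)%E by apply: prode_ge0 => k _; exact: measure_ge0.
have kfin : kappa \is a fin_num.
  apply: prode_fin_num => k _.
  rewrite ge0_fin_numE; last exact: measure_ge0.
  have := @probability_le1 _ _ R gam (B k) (mB k).
  by move=> /le_lt_trans; apply; exact: ltry.
have kr0 : 0 <= fine kappa by exact: fine_ge0.
pose m' := push_measure (mrestr P mS0) mXY.
have m'E A1 A2 : measurable A1 -> measurable A2 ->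
    m' (A1 `*` A2) = ((fine kappa)%:E * (gam A1 * gam A2))%E.
  move=> mA1 mA2; rewrite /m' push_measureE /mrestr.
  pose B' k := if k == i then A1 else if k == j then A2 else B k.
  have mB' k : measurable (B' k).
    by rewrite /B'; case: ifPn => // _; case: ifPn => // _; exact: mB.
  have := PX B' mB'.
  rewrite (bigD1 i)//= (bigD1 j)//=; last by rewrite eq_sym.
  have -> : B' i = A1 by rewrite /B' eqxx.
  have -> : B' j = A2 by rewrite /B' eq_sym (negbTE ij) eqxx.
  rewrite (eq_bigr (fun k => gam (B k))); last first.
    by move=> k /andP[/negbTE ki /negbTE kj]; rewrite /B' ki kj.
  rewrite fineK// muleA [RHS]muleC -/kappa => <-.
  congr (P _); apply/seteqP; split => w /=.
    move=> [[A1w A2w] hw] k; rewrite /B'; case: eqP => [->//|/eqP ki].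
    by case: eqP => [->//|/eqP kj]; exact: hw.
  move=> h; split; last first.
    by move=> k [/negbTE ki /negbTE kj]; have := h k; rewrite /B' ki kj.
  split; first by have := h i; rewrite /B' eqxx.
  by have := h j; rewrite /B' eq_sym (negbTE ij) eqxx.
pose gk := mscale (NngNum kr0) gam.
have m'U A : measurable A -> m' A = ((fine kappa)%:E * (gam \x gam) A)%E.
  move=> mA.
  have <- : ((gk \x gam) A = (fine kappa)%:E * (gam \x gam) A)%E.
    rewrite /product_measure1 ge0_integral_mscale//.
    exact: measurable_fun_xsection.
  apply/esym; apply: (@product_measure_unique _ _ _ _ R
    (mscale (NngNum kr0) gam) gam m') => // A1 A2 mA1 mA2.
  by rewrite m'E// /gk /mscale/= muleA.
pose rA := [set z : R * R | B i (c * z.1 + s * z.2) /\ B j (c * z.2 - s * z.1)].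
have mrA : measurable rA.
  have mrot : measurable_fun setT (fun z : R * R => (c * z.1 + s * z.2, c * z.2 - s * z.1)).
    apply: measurable_fun_pair => /=.
      by apply: measurable_funD; apply: measurable_funM => //.
    by apply: measurable_funB; apply: measurable_funM => //.
  rewrite -[X in measurable X]setTI.
  by apply: (mrot _ (B i `*` B j)) => //; exact: measurableX.
transitivity (m' rA).
  rewrite /m' push_measureE /mrestr; congr (P _); apply/seteqP; split => w /=.
    move=> h; split; last first.
      by move=> k [/negbTE ki /negbTE kj]; have := h k; rewrite mxE ki kj.
    split; first by have := h i; rewrite mxE eqxx.
    by have := h j; rewrite mxE eq_sym (negbTE ij) eqxx.
  move=> [[Ai Aj] hw] k; rewrite mxE; case: eqP => [->//|/eqP ki].
  by case: eqP => [->//|/eqP kj]; exact: hw.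
rewrite m'U// normal_rotation// fineK//.
rewrite (bigD1 i)//= (bigD1 j)//=; last by rewrite eq_sym.
by rewrite muleA [RHS]muleC.
Qed.

(** Rotation of all the planes spanned by a coordinate and its copy. *)
Definition rotate n (c s : R) (z : 'rV[R]_(n + n)) : 'rV[R]_(n + n) :=
  row_mx (c *: lsubmx z + s *: rsubmx z) (c *: rsubmx z - s *: lsubmx z).

(* one plane at a time *)
Lemma gaussian_rotate d (T : measurableType d) (P : probability T R) n
    (Z : T -> 'rV[R]_(n + n)) (c s : R) :
  0 < c -> c ^+ 2 + s ^+ 2 = 1 ->
  standard_gaussian P Z -> standard_gaussian P (fun w => rotate c s (Z w)).
Proof.
move=> c0 cs gZ.
pose part (r : seq 'I_n) (z : 'rV[R]_(n + n)) : 'rV[R]_(n + n) :=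
  row_mx (\row_k if k \in r then c * z ord0 (lshift n k) + s * z ord0 (rshift n k)
                 else z ord0 (lshift n k))
         (\row_k if k \in r then c * z ord0 (rshift n k) - s * z ord0 (lshift n k)
                 else z ord0 (rshift n k)).
have partl r z k : part r z ord0 (lshift n k) =
    if k \in r then c * z ord0 (lshift n k) + s * z ord0 (rshift n k)
    else z ord0 (lshift n k) by rewrite /part row_mxEl mxE.
have partr r z k : part r z ord0 (rshift n k) =
    if k \in r then c * z ord0 (rshift n k) - s * z ord0 (lshift n k)
    else z ord0 (rshift n k) by rewrite /part row_mxEr mxE.
have step k r z : k \notin r ->
    rotij c s (lshift n k) (rshift n k) (part r z) = part (k :: r) z.
  move=> /negbTE kr; apply/rowP => i; rewrite mxE.
  case: (split_ordP i) => l ->.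
    rewrite (inj_eq (@lshift_inj _ _)) eq_lrshift !partl partr inE kr.
    by have [->|lk] := eqVneq l k.
  rewrite eq_rlshift (inj_eq (@rshift_inj _ _)) !partr partl inE kr.
  by have [->|lk] := eqVneq l k.
have gpart r : uniq r -> standard_gaussian P (fun w => part r (Z w)).
  elim: r => [_|k r ih /= /andP[kr ur]].
    suff -> : (fun w => part [::] (Z w)) = Z by [].
    apply/funext => w; rewrite -[RHS]hsubmxK; congr row_mx; apply/rowP => k;
    by rewrite !mxE.
  rewrite (_ : (fun w => _) = fun w =>
    rotij c s (lshift n k) (rshift n k) (part r (Z w))).
    by apply: gaussian_rotij => //; [rewrite eq_lrshift|exact: ih].
  by apply/funext => w; rewrite step.
have := gpart _ (enum_uniq 'I_n).
rewrite (_ : (fun w => part _ (Z w)) = fun w => rotate c s (Z w))//.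
by apply/funext => w; congr row_mx; apply/rowP => k; rewrite !mxE mem_enum.
Qed.

End gaussian_constructions.


(** * Gaussian integration by parts *)

(** An independent copy of the Gaussian vector lives on the square of the
    probability space. *)
Section independent_copy.
Context {R : realType} d (Omega : measurableType d) (P : probability Omega R).
Context {n : nat} (xi : Omega -> 'rV[R]_n).
Hypothesis gxi : standard_gaussian P xi.

Definition xi2 (w : Omega * Omega) : 'rV[R]_(n + n) := row_mx (xi w.1) (xi w.2).
Definition P2 : probability (Omega * Omega)%type R := (P \x P)%E.

Lemma gaussian_xi2 : standard_gaussian P2 xi2.
Proof. exact: gaussian_row_mx. Qed.

Local Notation E := (gE P xi).
Local Notation E2 := (gE P2 xi2).

Lemma gE2_l g : tame g -> E2 (fun z => g (lsubmx z)) = E g.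
Proof. by move=> tg; apply: (gE_law (gaussian_lsubmx gaussian_xi2) gxi tg). Qed.

Lemma gE2_r g : tame g -> E2 (fun z => g (rsubmx z)) = E g.
Proof. by move=> tg; apply: (gE_law (gaussian_rsubmx gaussian_xi2) gxi tg). Qed.

Lemma gE2_rotate c s g : 0 < c -> c ^+ 2 + s ^+ 2 = 1 -> tame g ->
  E2 (fun z => g (rotate c s z)) = E2 g.
Proof.
move=> c0 cs tg.
exact: (gE_law (gaussian_rotate c0 cs gaussian_xi2) gaussian_xi2 tg).
Qed.

Lemma gE2_rotij c s i j g : 0 < c -> c ^+ 2 + s ^+ 2 = 1 -> i != j -> tame g ->
  E2 (fun z => g (rotij c s i j z)) = E2 g.
Proof.
move=> c0 cs ij tg.
exact: (gE_law (gaussian_rotij c0 cs ij gaussian_xi2) gaussian_xi2 tg).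
Qed.

Lemma tame_l (g : 'rV[R]_n -> R) : tame g -> tame (fun z : 'rV[R]_(n + n) => g (lsubmx z)).
Proof. by move=> tg; apply: tame_comp => //; exact: tamev_lsubmx. Qed.

Lemma tame_r (g : 'rV[R]_n -> R) : tame g -> tame (fun z : 'rV[R]_(n + n) => g (rsubmx z)).
Proof. by move=> tg; apply: tame_comp => //; exact: tamev_rsubmx. Qed.

Lemma gE2_prod f g : tame f -> tame g ->
  E2 (fun z => f (lsubmx z) * g (rsubmx z)) = E f * E g.
Proof.
move=> tf tg; have tfg := tameM (tame_l tf) (tame_r tg).
have ifg := tame_integrable gaussian_xi2 tfg.
apply: EFin_inj; rewrite -(gE_EFin gaussian_xi2 tfg).
transitivity (\int[P]_x \int[P]_y (f (xi x) * g (xi y))%:E)%E.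
  rewrite -(integral12_prod_meas1 ifg).
  apply: eq_integral => x _; apply: eq_integral => y _ /=.
  by rewrite /xi2 row_mxKl row_mxKr.
transitivity (\int[P]_x (E g * f (xi x))%:E)%E.
  apply: eq_integral => x _.
  rewrite mulrC EFinM -(gE_EFin gxi tg) -integralZl//; last exact: tame_integrable.
transitivity ((E g)%:E * \int[P]_x (f (xi x))%:E)%E.
  by rewrite -integralZl//; exact: tame_integrable.
by rewrite gE_EFin// -EFinM mulrC.
Qed.

Lemma gE_coord_sqr i : E (fun x => x ord0 i ^+ 2) = 1.
Proof.
rewrite /gE /Rintegral (gauss_coord_integral gxi i (f := fun x => (x ^+ 2)%:E)).
- by rewrite normal_variance.
- by apply/measurable_EFinP; exact: measurable_funX.
- by move=> x; rewrite lee_fin sqr_ge0.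
Qed.

(** Rotating by the angle of cosine 3/5 multiplies the mean by 3/5 - 4/5 and
    keeps the law. *)
Lemma gE_coord i : E (fun x => x ord0 i) = 0.
Proof.
have ti : tame (fun x : 'rV[R]_n => x ord0 i) by exact: tame_coord.
have cs : (3 / 5 : R) ^+ 2 + (4 / 5) ^+ 2 = 1 by field.
have c0 : (0 : R) < 3 / 5 by lra.
have tl : tame (fun z : 'rV[R]_(n + n) => lsubmx z ord0 i) := tame_l ti.
have tr : tame (fun z : 'rV[R]_(n + n) => rsubmx z ord0 i) := tame_r ti.
have hl : E2 (fun z => lsubmx z ord0 i) = E (fun x => x ord0 i) := gE2_l ti.
have hr : E2 (fun z => rsubmx z ord0 i) = E (fun x => x ord0 i) := gE2_r ti.
have h : E2 (fun z => 3 / 5 * rsubmx z ord0 i - 4 / 5 * lsubmx z ord0 i) =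
    E2 (fun z => rsubmx z ord0 i).
  rewrite -(gE2_rotate c0 cs tr); apply: gE_eq => z.
  by rewrite /rotate row_mxKr !mxE.
move: h; rewrite (gEB gaussian_xi2); [|exact: tameZ..].
rewrite !(gEZ gaussian_xi2)// hl hr; lra.
Qed.

(** [W] is the partial derivative of [H] along the axis [j]. *)
Definition dtaylor m (j : 'I_m) (H W : 'rV[R]_m -> R) := exists2 C : R, 0 <= C &
  exists k, forall x t, `|H (x + t *: delta_mx ord0 j) - H x - t * W x| <=
    C * (wt x * (1 + `|t|)) ^+ k * t ^+ 2.

(** Gaussian integration by parts. The function
    (c y_j - s x_j) H(x + ((c - 1) x_j + s y_j) e_j) is the image of y_j H(x)
    under the rotation of the plane (x_j, y_j), hence has mean 0; at first
    order in s its mean is s (E W - E x_j H). *)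
Lemma gaussian_ibp j (H W : 'rV[R]_n -> R) : tame H -> tame W -> dtaylor j H W ->
  E (fun x => x ord0 j * H x) = E W.
Proof.
move=> tH tW [C C0 [k HW]].
have tx : tame (fun x : 'rV[R]_n => x ord0 j) by exact: tame_coord.
pose X (z : 'rV[R]_(n + n)) := lsubmx z ord0 j.
pose Y (z : 'rV[R]_(n + n)) := rsubmx z ord0 j.
have tX : tame X by exact: tame_l tx.
have tY : tame Y by exact: tame_r tx.
have tHl := tame_l tH; have tWl := tame_l tW.
pose S (z : 'rV[R]_(n + n)) := wt (lsubmx z) * wt (rsubmx z).
have tS : tame S by apply: tameM; apply: tame_wt; [exact: tamev_lsubmx|exact: tamev_rsubmx].
have XS z : `|X z| <= S z.
  rewrite (le_trans (ler_coord_enorm _ _))// (le_trans (enorm_le_wt _))//.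
  by rewrite /S ler_peMr ?wt_ge0 ?wt_ge1.
have YS z : `|Y z| <= S z.
  rewrite (le_trans (ler_coord_enorm _ _))// (le_trans (enorm_le_wt _))//.
  by rewrite /S ler_peMl ?wt_ge0 ?wt_ge1.
have S1 z : 1 <= S z by rewrite -[1]mulr1 ler_pM ?wt_ge1.
have S0 z : 0 <= S z by exact: le_trans (S1 z).
have tx2W : tame (fun x : 'rV[R]_n => x ord0 j ^+ 2 * W x) by apply: tameM => //; exact: tameX.
pose K := `|E W| + `|E (fun x => x ord0 j ^+ 2 * W x)| +
   C * E2 (fun z => 8 * S z ^+ 3 * (3 * S z ^+ 2) ^+ k).
suff key s : 0 < s -> s <= 2^-1 -> `|E W - E (fun x => x ord0 j * H x)| <= s * K.
  apply/esym/eqP; rewrite -subr_eq0 -normr_le0 leNgt; apply/negP => a0.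
  set a := `|_ - _| in a0 key.
  have K0 : 0 <= K.
    by have := key 2^-1 ltac:(lra) (lexx _); lra.
  have b0 : 0 < a / (2 * (K + a)) by rewrite divr_gt0//; lra.
  pose s := Num.min 2^-1 (a / (2 * (K + a))).
  have s0 : 0 < s by rewrite lt_min b0 andbT; lra.
  have := key s s0 ltac:(by rewrite /s ge_min lexx).
  have : s * (2 * (K + a)) <= a by rewrite -ler_pdivlMr ?ge_min ?lexx ?orbT//; lra.
  have := mulr_gt0 s0 a0; lra.
move=> s0 s1; have s1' : s <= 1 by lra.
have s2 : s ^+ 2 <= 4^-1.
  rewrite (_ : 4^-1 = 2^-1 ^+ 2); last by field.
  by apply: lerXn2r; rewrite ?nnegrE ?(ltW s0).
pose c := Num.sqrt (1 - s ^+ 2).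
have c2 : c ^+ 2 = 1 - s ^+ 2 by rewrite sqr_sqrtr//; lra.
have c0 : 0 < c by rewrite sqrtr_gt0; lra.
have c1 : c <= 1 by rewrite -(ler_pXn2r (n := 2))// ?nnegrE ?(ltW c0)// c2 expr1n; have := sqr_ge0 s; lra.
have c1' : 1 - c <= s ^+ 2.
  rewrite (_ : s ^+ 2 = (1 - c) * (1 + c)); last by rewrite -[LHS]opprK -[- s ^+ 2](addKr 1) -c2; ring.
  by rewrite ler_peMr; lra.
have cs : c ^+ 2 + s ^+ 2 = 1 by rewrite c2; ring.
pose t z := (c - 1) * X z + s * Y z.
have ts z : `|t z| <= s * (2 * S z).
  rewrite (le_trans (ler_normD _ _))// !normrM (ger0_norm (ltW s0)).
  rewrite (_ : s * (2 * S z) = s * S z + s * S z); last by ring.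
  rewrite lerD//; last by rewrite ler_wpM2l ?(ltW s0).
  apply: ler_pM => //; rewrite distrC ger0_norm; last lra.
  rewrite (le_trans c1')// expr2 ler_piMr ?(ltW s0)//; lra.
pose Phi z := (c * Y z - s * X z) * H (lsubmx z + t z *: delta_mx ord0 j).
have tt : tame t by apply: tameD; exact: tameZ.
have tHt : tame (fun z : 'rV[R]_(n + n) => H (lsubmx z + t z *: delta_mx ord0 j)).
  apply: (tame_comp tH); apply: tamevD; first exact: tamev_lsubmx.
  by apply: tamevZ => //; exact: tamev_cst.
have tYX : tame (fun z => c * Y z - s * X z) by apply: tameB; exact: tameZ.
have E0 : E2 Phi = 0.
  rewrite -[RHS](mul0r (E (fun x => H x))) -(gE_coord j) mulrC -(gE2_prod tH tx).
  have := gE2_rotij c0 cs (_ : lshift n j != rshift n j) (tameM tHl tY).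
  rewrite eq_lrshift => /(_ isT) <-; apply: gE_eq => z.
  rewrite /Phi mulrC; congr (H _ * _); last first.
    by rewrite /Y /X !mxE eq_rlshift eqxx.
  apply/rowP => i; rewrite !mxE eq_lrshift (inj_eq (@lshift_inj _ _)) /t /X /Y !mxE eqxx/=.
  by have [->|ij] := eqVneq i j; rewrite ?mulr1 ?mulr0 ?addr0//; ring.
pose r z := H (lsubmx z + t z *: delta_mx ord0 j) - H (lsubmx z) - t z * W (lsubmx z).
have tr : tame r by apply: tameB; [exact: tameB|exact: tameM].
have tr' : tame (fun z => (c * Y z - s * X z) * r z) by exact: tameM.
have rb z : `|(c * Y z - s * X z) * r z| <= s ^+ 2 * (C * (8 * S z ^+ 3 * (3 * S z ^+ 2) ^+ k)).
  have tz := ts z; have Sz1 := S1 z; have Sz0 := S0 z.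
  have h1 : `|c * Y z - s * X z| <= 2 * S z.
    rewrite (le_trans (ler_normB _ _))// !normrM (ger0_norm (ltW s0)) (ger0_norm (ltW c0)).
    have hc : c * `|Y z| <= S z by apply: le_trans (YS z); rewrite ler_piMl.
    have hs : s * `|X z| <= S z by apply: le_trans (XS z); rewrite ler_piMl//; lra.
    lra.
  have h2 : `|t z| <= 2 * S z.
    by apply: (le_trans tz); apply: ler_piMl; [rewrite mulr_ge0|exact: s1'].
  have h3 : wt (lsubmx z) * (1 + `|t z|) <= 3 * S z ^+ 2.
    apply: (@le_trans _ _ (S z * (3 * S z))); last by rewrite expr2; lra.
    apply: ler_pM; rewrite ?wt_ge0 ?addr_ge0//.
      by rewrite /S ler_peMr ?wt_ge0 ?wt_ge1.
    by rewrite (_ : 3 * S z = S z + 2 * S z); [rewrite lerD|ring].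
  have h4 : t z ^+ 2 <= s ^+ 2 * (4 * S z ^+ 2).
    rewrite -real_normK ?num_real// (_ : _ * _ = (s * (2 * S z)) ^+ 2); last by ring.
    by apply: lerXn2r; rewrite ?nnegrE// mulr_ge0 ?(ltW s0)// mulr_ge0.
  rewrite normrM (_ : s ^+ 2 * _ = (2 * S z) * (C * (3 * S z ^+ 2) ^+ k * (s ^+ 2 * (4 * S z ^+ 2)))); last by ring.
  apply: ler_pM => //; apply: (le_trans (HW _ _)).
  apply: ler_pM; rewrite ?sqr_ge0//.
    by rewrite mulr_ge0// exprn_ge0// mulr_ge0 ?wt_ge0// addr_ge0.
  rewrite ler_wpM2l// lerXn2r ?nnegrE ?mulr_ge0 ?wt_ge0 ?addr_ge0 ?sqr_ge0//.
have dec : E2 Phi = - s * E (fun x => x ord0 j * H x) + c * s * E W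
    - s * (c - 1) * E (fun x => x ord0 j ^+ 2 * W x)
    + E2 (fun z => (c * Y z - s * X z) * r z).
  pose f1 z := - s * (X z * H (lsubmx z)) + c * s * (W (lsubmx z) * Y z ^+ 2)
    - s * (c - 1) * (X z ^+ 2 * W (lsubmx z)).
  pose f2 z := c * (H (lsubmx z) * Y z) + (c * (c - 1) - s ^+ 2) * (X z * W (lsubmx z) * Y z).
  have tHX : tame (fun z => X z * H (lsubmx z)) by exact: tameM.
  have tWY : tame (fun z => W (lsubmx z) * Y z ^+ 2) by apply: tameM => //; exact: tameX.
  have tXW : tame (fun z => X z ^+ 2 * W (lsubmx z)) by apply: tameM => //; exact: tameX.
  have tHY : tame (fun z => H (lsubmx z) * Y z) by exact: tameM.
  have tXWY : tame (fun z => X z * W (lsubmx z) * Y z) by do 2 apply: tameM => //.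
  have tf1 : tame f1 by apply: tameB; [apply: tameD|]; exact: tameZ.
  have tf2 : tame f2 by apply: tameD; exact: tameZ.
  have g2 := gaussian_xi2.
  have -> : E2 Phi = E2 f1 + E2 f2 + E2 (fun z => (c * Y z - s * X z) * r z).
    rewrite -!gED//; last exact: tameD.
    by apply: gE_eq => z; rewrite /f1 /f2 /r /Phi /t; ring.
  have -> : E2 f2 = 0.
    rewrite /f2 gED//; [|exact: tameZ..].
    rewrite !gEZ// (gE2_prod tH tx) (@gE2_prod (fun x => x ord0 j * W x) _ (tameM tx tW) tx).
    by rewrite gE_coord !mulr0 addr0.
  rewrite addr0; congr (_ + _).
  rewrite /f1 gEB//; [|apply: tameD; exact: tameZ|exact: tameZ].
  rewrite gED//; [|exact: tameZ..].
  rewrite !gEZ// (@gE2_l (fun x => x ord0 j * H x) (tameM tx tH)).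
  rewrite (@gE2_prod W (fun x => x ord0 j ^+ 2) tW (tameX 2 tx)) gE_coord_sqr mulr1.
  by rewrite (@gE2_l (fun x => x ord0 j ^+ 2 * W x) tx2W).
have tSk : tame (fun z => 8 * S z ^+ 3 * (3 * S z ^+ 2) ^+ k).
  apply: tameM; first by apply: tameZ; exact: tameX.
  by apply: tameX; apply: tameZ; exact: tameX.
have eb := gE_abs_le gaussian_xi2 tr' (tameZ (s ^+ 2) (tameZ C tSk)) rb.
rewrite (gEZ gaussian_xi2) in eb; last exact: tameZ.
rewrite (gEZ gaussian_xi2) // in eb.
set e := E2 (fun z => (c * Y z - s * X z) * r z) in dec eb.
set M := E2 _ in eb; set a := E W in dec *; set b := E (fun x => x ord0 j * H x) in dec *.
set q := E (fun x => x ord0 j ^+ 2 * W x) in dec.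
have -> : a - b = (1 - c) * a + (c - 1) * q - e / s.
  have : s * (a - b) = s * ((1 - c) * a + (c - 1) * q) - e by move: dec; rewrite E0; lra.
  move=> hh; apply: (mulfI (lt0r_neq0 s0)); rewrite hh mulrBr; congr (_ - _).
  by rewrite mulrC divfK// gt_eqF.
rewrite (le_trans (ler_normB _ _))// /K !mulrDr lerD//.
  rewrite (le_trans (ler_normD _ _))// !normrM (distrC c) (ger0_norm (_ : 0 <= 1 - c)); last lra.
  have cs' : 1 - c <= s by rewrite (le_trans c1')// expr2 ler_piMr ?(ltW s0)//; lra.
  by rewrite lerD// ler_wpM2r.
rewrite normrM normfV (ger0_norm (ltW s0)) ler_pdivrMr// mulrAC -expr2.
exact: eb.
Qed.

End independent_copy.


(** * One step of the Gaussian interpolation *)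

Section covariance.
Context {R : realType} {n : nat}.

(** [V] is the gradient of [g], with a second order remainder of polynomial
    growth. *)
Definition taylor (g : 'rV[R]_n -> R) (V : 'rV[R]_n -> 'rV[R]_n) :=
  exists2 C : R, 0 <= C & exists k, forall x y,
    `|g y - g x - dot (V x) (y - x)| <= C * (wt x * wt y) ^+ k * enorm (y - x) ^+ 2.

Definition lr_wt (z : 'rV[R]_(n + n)) : R := wt (lsubmx z) * wt (rsubmx z).
Local Notation S := lr_wt.

Lemma lr_wt_ge1 z : 1 <= S z.
Proof. by rewrite -[1]mulr1 ler_pM ?wt_ge1. Qed.

Lemma lr_wt_ge0 z : 0 <= S z.
Proof. exact: le_trans (lr_wt_ge1 z). Qed.

Lemma tame_lr_wt : tame S.
Proof. by apply: tameM; apply: tame_wt; [exact: tamev_lsubmx|exact: tamev_rsubmx]. Qed.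

Definition lin (a b : R) (z : 'rV[R]_(n + n)) : 'rV[R]_n := a *: lsubmx z + b *: rsubmx z.

Lemma tamev_lin a b : tamev (lin a b).
Proof. by apply: tamevD; apply: tamevZc; [exact: tamev_lsubmx|exact: tamev_rsubmx]. Qed.

Lemma enorm_lin_le a b z : `|a| <= 1 -> `|b| <= 1 ->
  enorm (lin a b z) <= enorm (lsubmx z) + enorm (rsubmx z).
Proof.
move=> a1 b1; rewrite (le_trans (ler_enormD _ _))// !enormZ.
by rewrite lerD// ler_piMl ?enorm_ge0.
Qed.

Lemma wt_lin_le a b z : `|a| <= 1 -> `|b| <= 1 -> wt (lin a b z) <= S z.
Proof.
move=> a1 b1; have := enorm_lin_le z a1 b1; rewrite /lr_wt !wtE.
have := mulr_ge0 (enorm_ge0 (lsubmx z)) (enorm_ge0 (rsubmx z)); lra.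
Qed.

Lemma polybd_lin (g : 'rV[R]_n -> R) : tame g -> exists2 C : R, 0 <= C &
  exists k, forall a b z, `|a| <= 1 -> `|b| <= 1 -> `|g (lin a b z)| <= C * S z ^+ k.
Proof.
move=> /tame_polybd[C C0 [k gC]]; exists C => //; exists k => a b z a1 b1.
rewrite (le_trans (gC _))// ler_wpM2l//; apply: lerXn2r; rewrite ?nnegrE ?wt_ge0 ?lr_wt_ge0//.
exact: wt_lin_le.
Qed.

Lemma dot_lr m (z z' : 'rV[R]_(n + m)) :
  dot z z' = dot (lsubmx z) (lsubmx z') + dot (rsubmx z) (rsubmx z').
Proof. by rewrite /dot big_split_ord/=; congr (_ + _); apply: eq_bigr => i _; rewrite !mxE. Qed.

Lemma enorm_lsubmx_le m (z : 'rV[R]_(n + m)) : enorm (lsubmx z) <= enorm z.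
Proof. by rewrite ler_enorm (dot_lr z z) lerDl dot_ge0. Qed.

Lemma enorm_rsubmx_le m (z : 'rV[R]_(n + m)) : enorm (rsubmx z) <= enorm z.
Proof. by rewrite ler_enorm (dot_lr z z) lerDr dot_ge0. Qed.

Lemma sqr_sum1_abs (c s : R) : c ^+ 2 + s ^+ 2 = 1 -> `|c| <= 1 /\ `|s| <= 1.
Proof.
move=> cs; have := sqr_ge0 c; have := sqr_ge0 s => s0 c0.
by split; rewrite -(ler_pXn2r (n := 2))// ?nnegrE// expr1n real_normK ?num_real//; lra.
Qed.

(** The integrand of the integration by parts in [covariance_step], as a
    function of the second half of the coordinates. *)
Lemma dtaylor_prod (Gi p : 'rV[R]_n -> R) (V : 'rV[R]_n -> 'rV[R]_n) (c s : R) i :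
  `|c| <= 1 -> `|s| <= 1 -> tame Gi -> taylor p V ->
  dtaylor (rshift n i) (fun z : 'rV[R]_(n + n) => Gi (lsubmx z) * p (lin c (- s) z))
    (fun z => - s * (Gi (lsubmx z) * V (lin c (- s) z) ord0 i)).
Proof.
move=> c1 s1 /tame_polybd[C C0 [k GC]] [D D0 [l pD]].
exists (C * (D * 4 ^+ l)); first by rewrite !mulr_ge0// exprn_ge0.
exists (k + (l + l))%N => z t.
pose e : 'rV[R]_(n + n) := delta_mx ord0 (rshift n i).
pose q := lin c (- s) z; pose q' := lin c (- s) (z + t *: e).
have el : lsubmx (z + t *: e) = lsubmx z.
  by apply/rowP => j; rewrite !mxE eq_lrshift andbF mulr0 addr0.
have er : rsubmx (z + t *: e) = rsubmx z + t *: delta_mx ord0 i.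
  by apply/rowP => j; rewrite !mxE (inj_eq (@rshift_inj _ _)).
have qq : q' - q = (- s * t) *: delta_mx ord0 i.
  by rewrite /q' /q /lin el er; apply/rowP => j; rewrite !mxE; ring.
have nqq : enorm (q' - q) ^+ 2 <= t ^+ 2.
  rewrite qq enormZ enorm_delta mulr1 real_normK ?num_real// exprMn sqrrN ler_piMl ?sqr_ge0//.
  by rewrite -real_normK ?num_real// expr_le1.
have wz := wt_ge1 z.
have wq : wt q <= 2 * wt z.
  have := enorm_lin_le z c1 (_ : `|- s| <= 1); rewrite normrN => /(_ s1).
  have := enorm_lsubmx_le z; have := enorm_rsubmx_le z; rewrite !wtE -/q; lra.
have t0 := normr_ge0 t.
have wq' : wt q' <= 2 * (wt z * (1 + `|t|)).
  have h1 : enorm q' <= enorm q + `|t|.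
    have := enorm_triangle q q' 0; rewrite !subr0 qq enormZ enorm_delta mulr1 normrM normrN => h.
    have : `|s| * `|t| <= `|t| by rewrite ler_piMl.
    lra.
  have h2 : `|t| <= wt z * `|t| by rewrite ler_peMl.
  by move: wq h1; rewrite !wtE !mulrDl => wq h1; move: h2; rewrite wtE; lra.
rewrite el -/q -/q'.
have -> : Gi (lsubmx z) * p q' - Gi (lsubmx z) * p q -
    t * (- s * (Gi (lsubmx z) * V q ord0 i)) =
    Gi (lsubmx z) * (p q' - p q - dot (V q) (q' - q)).
  by rewrite qq dotZr dot_delta; ring.
rewrite normrM.
have a1 : 1 <= 1 + `|t| by rewrite lerDl.
rewrite (_ : C * _ * _ * _ = (C * (wt z * (1 + `|t|)) ^+ k) *
   (D * (4 ^+ l * (wt z * (1 + `|t|)) ^+ (l + l)) * t ^+ 2)); last first.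
  by rewrite [in LHS]exprD; ring.
apply: ler_pM => //.
  rewrite (le_trans (GC _))// ler_wpM2l//; apply: lerXn2r; rewrite ?nnegrE ?wt_ge0 ?mulr_ge0 ?wt_ge0 ?addr_ge0//.
  apply: (@le_trans _ _ (wt z)); last by rewrite ler_peMr ?wt_ge0.
  by rewrite !wtE lerD2l enorm_lsubmx_le.
apply: (le_trans (pD _ _)).
apply: ler_pM => //; rewrite ?sqr_ge0// ?mulr_ge0 ?wtMX_ge0//.
rewrite ler_wpM2l// exprD -!exprMn; apply: lerXn2r; rewrite ?nnegrE.
- by rewrite mulr_ge0 ?wt_ge0.
- by rewrite !mulr_ge0 ?wt_ge0 ?addr_ge0.
rewrite (_ : 4 * _ = (2 * (wt z * (1 + `|t|))) * (2 * (wt z * (1 + `|t|)))); last by ring.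
apply: ler_pM; rewrite ?wt_ge0//.
by rewrite (le_trans wq)// ler_wpM2l// ler_peMr ?wt_ge0.
Qed.

Section one_step.
Context d (Omega : measurableType d) (P : probability Omega R).
Variable (xi : Omega -> 'rV[R]_n).
Hypothesis gxi : standard_gaussian P xi.
Local Notation E := (gE P xi).
Local Notation E2 := (gE (P2 P) (xi2 xi)).
Variables (F p : 'rV[R]_n -> R) (G V : 'rV[R]_n -> 'rV[R]_n).
Hypotheses (tF : tame F) (tG : tamev G) (FG : taylor F G).
Hypotheses (tp : tame p) (tV : tamev V) (pV : taylor p V).

(** In the rotated coordinates u = c x + s y, v = c y - s x the difference
    F(u) - F(ch u + sh v) is, at first order, - sh <G(u), v>, and integration by parts in v turns
    the factor v into the gradient of p at x = c u - s v. *)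
Lemma covariance_step : exists2 K : R, 0 <= K & forall c s ch sh h,
  0 < c -> c ^+ 2 + s ^+ 2 = 1 -> ch ^+ 2 + sh ^+ 2 = 1 ->
  0 <= 1 - ch -> 1 - ch <= h ^+ 2 -> `|sh| <= h -> h <= 1 ->
  `|E2 (fun z => (F (lin c s z) - F (lin (c * ch - s * sh) (s * ch + c * sh) z)) * p (lsubmx z))
    - (c - (c * ch - s * sh)) * E2 (fun z => dot (G (lin c s z)) (V (lsubmx z)))|
  <= K * h ^+ 2.
Proof.
have g2 := gaussian_xi2 gxi.
have [Cp Cp0 [kp pb]] := polybd_lin tp.
have tGx : tame (fun x => dot (G x) x) by apply: tame_dot => //; exact: tamev_id.
have [C1 C10 [k1 b1]] := polybd_lin tGx.
have [C2 C20 [k2 b2]] := polybd_lin (tame_enormv tG).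
have [C3 C30 [k3 b3]] := polybd_lin (tame_enormv tV).
have [D D0 [l FD]] := FG.
pose M k := E2 (fun z => S z ^+ k).
have tS k : tame (fun z => S z ^+ k) by apply: tameX; exact: tame_lr_wt.
have M0 k : 0 <= M k by apply: gE_ge0 => z; exact: exprn_ge0 (lr_wt_ge0 z).
have bE f (C : R) k : tame f -> (forall z, `|f z| <= C * S z ^+ k) -> `|E2 f| <= C * M k.
  by move=> tf fC; rewrite /M -(gEZ g2)//; apply: (gE_abs_le g2) => //; exact: tameZ.
exists (C1 * Cp * M (k1 + kp)%N + C2 * C3 * M (k2 + k3)%N + 4 * D * Cp * M (l + l + 2 + kp)%N).
  by rewrite !addr_ge0 ?mulr_ge0.
move=> c s ch sh h c0 cs chsh ch0 chh shh h1.
have [c1 s1] := sqr_sum1_abs cs; have [ch1 sh1] := sqr_sum1_abs chsh.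
have s1' : `|- s| <= 1 by rewrite normrN.
have h0 : 0 <= h by exact: le_trans (normr_ge0 _) shh.
pose q z := lin c (- s) z.
pose Phi z := (F (lsubmx z) - F (lin ch sh z)) * p (q z).
have tpq : tame (fun z => p (q z)) by apply: (tame_comp tp); exact: tamev_lin.
have tVq : tamev (fun z => V (q z)) by apply: (tamev_comp tV); exact: tamev_lin.
have tGl : tamev (fun z : 'rV[R]_(n + n) => G (lsubmx z)).
  by apply: (tamev_comp tG); exact: tamev_lsubmx.
have tFc : tame (fun z => F (lin ch sh z)) by apply: (tame_comp tF); exact: tamev_lin.
have tFl := tame_l tF.
have tPhi : tame Phi by apply: tameM => //; exact: tameB.
have lrot z : lsubmx (rotate c s z) = lin c s z by rewrite /rotate row_mxKl.
have rrot z : rsubmx (rotate c s z) = c *: rsubmx z - s *: lsubmx z by rewrite /rotate row_mxKr.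
have qrot z : q (rotate c s z) = lsubmx z.
  rewrite /q /lin lrot rrot /lin; apply/rowP => i; rewrite !mxE.
  rewrite (_ : c * _ + _ = (c ^+ 2 + s ^+ 2) * z ord0 (lshift n i)); last by ring.
  by rewrite cs mul1r.
pose T1 z := dot (G (lsubmx z)) (lsubmx z) * p (q z).
pose T2 z := dot (G (lsubmx z)) (V (q z)).
pose T3 z := dot (G (lsubmx z)) (rsubmx z) * p (q z).
pose rem z := (F (lin ch sh z) - F (lsubmx z) - dot (G (lsubmx z)) (lin ch sh z - lsubmx z)) * p (q z).
have tT1 : tame T1 by apply: tameM => //; apply: tame_dot => //; exact: tamev_lsubmx.
have tT2 : tame T2 by exact: tame_dot.
have tT3 : tame T3 by apply: tameM => //; apply: tame_dot => //; exact: tamev_rsubmx.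
have trem : tame rem.
  apply: tameM => //; apply: tameB; first exact: tameB.
  apply: tame_dot => //; apply: tamevD; first exact: tamev_lin.
  by apply: tamevN; exact: tamev_lsubmx.
have -> : E2 (fun z => (F (lin c s z) - F (lin (c * ch - s * sh) (s * ch + c * sh) z)) * p (lsubmx z)) = E2 Phi.
  rewrite -(gE2_rotate gxi c0 cs tPhi); apply: gE_eq => z.
  rewrite /Phi qrot lrot; congr ((_ - F _) * _).
  by rewrite /lin lrot rrot /lin; apply/rowP => i; rewrite !mxE; ring.
have -> : E2 (fun z => dot (G (lin c s z)) (V (lsubmx z))) = E2 T2.
  by rewrite -(gE2_rotate gxi c0 cs tT2); apply: gE_eq => z; rewrite /T2 qrot lrot.
have l10 z : lsubmx z = lin 1 0 z :> 'rV[R]_n by rewrite /lin scale1r scale0r addr0.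
have n1 : `|1 : R| <= 1 by rewrite normr1.
have n0 : `|0 : R| <= 1 by rewrite normr0.
have bT1 z : `|T1 z| <= C1 * Cp * S z ^+ (k1 + kp).
  rewrite normrM exprD mulrACA; apply: ler_pM => //; last exact: pb.
  by have := b1 1 0 z n1 n0; rewrite -l10.
have bT2 z : `|T2 z| <= C2 * C3 * S z ^+ (k2 + k3).
  rewrite (le_trans (cauchy_schwarz _ _))// exprD mulrACA.
  have := b2 1 0 z n1 n0; rewrite -l10 => h2.
  have h3 := b3 c (- s) z c1 s1'.
  apply: ler_pM; rewrite ?enorm_ge0//.
    exact: le_trans (ler_norm _) h2.
  exact: le_trans (ler_norm _) h3.
have brem z : `|rem z| <= h ^+ 2 * (4 * D * Cp) * S z ^+ (l + l + 2 + kp).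
  have S1 := lr_wt_ge1 z; have S0 := lr_wt_ge0 z.
  rewrite normrM exprD (_ : h ^+ 2 * _ * _ =
    (D * S z ^+ (l + l) * (4 * h ^+ 2 * S z ^+ 2)) * (Cp * S z ^+ kp)); last first.
    by rewrite exprD; ring.
  apply: ler_pM => //; last exact: pb.
  apply: (le_trans (FD _ _)); apply: ler_pM; rewrite ?mulr_ge0 ?wtMX_ge0 ?enorm_ge0//.
    rewrite ler_wpM2l// exprD -exprMn; apply: lerXn2r; rewrite ?nnegrE ?mulr_ge0 ?wt_ge0//.
    apply: ler_pM; rewrite ?wt_ge0//; last exact: wt_lin_le.
    by rewrite l10; exact: wt_lin_le.
  rewrite (_ : 4 * _ * _ = (2 * h * S z) ^+ 2); last by ring.
  apply: lerXn2r; rewrite ?nnegrE ?enorm_ge0 ?mulr_ge0 ?wt_ge0//.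
  have -> : lin ch sh z - lsubmx z = - (1 - ch) *: lsubmx z + sh *: rsubmx z.
    by apply/rowP => i; rewrite !mxE; ring.
  rewrite (le_trans (ler_enormD _ _))// !enormZ normrN (ger0_norm ch0).
  have hh : 1 - ch <= h by rewrite (le_trans chh)// expr2 ler_piMr.
  have e1 : enorm (lsubmx z) <= S z.
    by rewrite (le_trans (enorm_le_wt _))// l10; exact: wt_lin_le.
  have e2 : enorm (rsubmx z) <= S z.
    by rewrite (le_trans (enorm_le_wt _))// /lr_wt ler_peMl ?wt_ge0 ?wt_ge1.
  rewrite (_ : 2 * h * S z = h * S z + h * S z); last by ring.
  by rewrite lerD// ler_pM ?enorm_ge0.
have ibp : E2 T3 = - s * E2 T2.
  have -> : E2 T3 = E2 (fun z => \sum_(i < n) z ord0 (rshift n i) * (G (lsubmx z) ord0 i * p (q z))).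
    apply: gE_eq => z; rewrite /T3 /dot mulr_suml; apply: eq_bigr => i _.
    by rewrite [rsubmx z _ _]mxE; ring.
  have tGp i : tame (fun z : 'rV[R]_(n + n) => G (lsubmx z) ord0 i * p (q z)).
    by apply: tameM => //; exact: tGl.
  have tGV i : tame (fun z : 'rV[R]_(n + n) => G (lsubmx z) ord0 i * V (q z) ord0 i).
    by apply: tameM; [exact: tGl|exact: tVq].
  rewrite (gE_sum g2); last by move=> i; apply: tameM; [exact: tame_coord|exact: tGp].
  rewrite /T2 /dot (gE_sum g2)// mulr_sumr; apply: eq_bigr => i _.
  rewrite (gaussian_ibp g2 (tGp i) (tameZ (- s) (tGV i))); first exact: (gEZ g2).
  exact: (@dtaylor_prod (fun x => G x ord0 i) p V c s i c1 s1 (tG i) pV).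
have dec : E2 Phi = (1 - ch) * E2 T1 + s * sh * E2 T2 - E2 rem.
  have -> : s * sh * E2 T2 = - sh * E2 T3 by rewrite ibp; ring.
  rewrite -!(gEZ g2)// -(gED g2); [|exact: tameZ..].
  rewrite -(gEB g2)//; last by apply: tameD; exact: tameZ.
  apply: gE_eq => z; rewrite /Phi /T1 /T3 /rem /lin !dotE; ring.
rewrite (_ : _ - _ = (1 - ch) * E2 T1 - c * (1 - ch) * E2 T2 - E2 rem); last by rewrite dec; ring.
have hT1 := bE _ _ _ tT1 bT1; have hT2 := bE _ _ _ tT2 bT2; have hrem := bE _ _ _ trem brem.
rewrite (le_trans (ler_normB _ _))// [leRHS]mulrDl lerD//; last first.
  by rewrite (le_trans hrem)// le_eqVlt; apply/orP; left; apply/eqP; ring.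
rewrite (le_trans (ler_normB _ _))// [leRHS]mulrDl !normrM (ger0_norm ch0) ![_ * h ^+ 2]mulrC.
apply: lerD; apply: ler_pM => //; first by rewrite mulr_ge0.
by rewrite (le_trans _ chh)// ler_piMl.
Qed.

End one_step.
End covariance.


(** * The covariance formula and the Poincare inequality *)

Lemma le_of_le_divn (R : realType) (a b K : R) : 0 <= K ->
  (forall N, (2 <= N)%N -> a <= b + K / N%:R) -> a <= b.
Proof.
move=> K0 h; apply/ler_addgt0Pr => e e0.
have [m hm] : exists m, K / m.+2%:R <= e.
  exists (Num.bound (K / e)); have := archi_boundP (divr_ge0 K0 (ltW e0)).
  rewrite ltr_pdivrMr// => hb; rewrite ler_pdivrMr ?ltr0n// mulrC.
  by rewrite (le_trans (ltW hb))// ler_wpM2r ?(ltW e0)// ler_nat -addn2 leq_addr.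
by rewrite (le_trans (h m.+2 isT))// lerD2l.
Qed.

Section angles.
Context {R : realType}.

Lemma sin_le_id (h : R) : 0 <= h -> `|sin h| <= h.
Proof.
rewrite le_eqVlt => /predU1P[<-|h0]; first by rewrite sin0 normr0.
have [c _] := MVT h0 (fun x _ => is_derive_sin x) (continuous_subspaceT (@continuous_sin R)).
rewrite sin0 !subr0 => ->; rewrite normrM (ger0_norm (ltW h0)) ler_piMl ?(ltW h0)//.
exact: cos_max.
Qed.

Lemma cosB_MVT (a b : R) : a < b -> exists2 c, a < c < b & cos a - cos b = sin c * (b - a).
Proof.
move=> ab; have [c cab h] := MVT ab (fun x _ => is_derive_cos x) (continuous_subspaceT (@continuous_cos R)).
exists c; first by move: cab; rewrite in_itv.
by rewrite -opprB h mulNr opprK.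
Qed.

Lemma cos_ge_quadratic (h : R) : 0 <= h -> 1 - cos h <= h ^+ 2.
Proof.
rewrite le_eqVlt => /predU1P[<-|h0]; first by rewrite cos0 subrr sqr_ge0.
have [c /andP[c0 ch]] := cosB_MVT h0; rewrite cos0 subr0 => ->.
rewrite expr2 ler_wpM2r ?(ltW h0)//.
by rewrite (le_trans (ler_norm _))// (le_trans (sin_le_id (ltW c0)))// ltW.
Qed.

(** Subdivision of the quarter turn, weighted by the increments of the
    cosine. *)
Definition angle (N k : nat) : R := k%:R * (pi / 2 / N%:R).
Definition weight (N k : nat) : R := cos (angle N k) - cos (angle N k.+1).

Lemma angle0 N : angle N 0 = 0.
Proof. by rewrite /angle mul0r. Qed.

Lemma angleN N : (0 < N)%N -> angle N N = pi / 2.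
Proof. by move=> N0; rewrite /angle mulrC divfK// pnatr_eq0 -lt0n. Qed.

Lemma step_gt0 N : (0 < N)%N -> 0 < pi / 2 / N%:R :> R.
Proof. by move=> N0; rewrite !divr_gt0 ?pi_gt0// ltr0n. Qed.

Lemma angleS N k : angle N k.+1 = angle N k + pi / 2 / N%:R.
Proof. by rewrite /angle -natr1 mulrDl mul1r. Qed.

Lemma angle_ge0 N k : (0 < N)%N -> 0 <= angle N k.
Proof. by move=> N0; rewrite mulr_ge0// ltW// step_gt0. Qed.

Lemma angle_lt N k : (k < N)%N -> angle N k < pi / 2.
Proof.
move=> kN; have N0 : (0 < N)%N by exact: leq_ltn_trans kN.
by rewrite -(angleN N0) /angle ltr_pM2r ?step_gt0// ltr_nat.
Qed.

Lemma cos_angle_gt0 N k : (k < N)%N -> 0 < cos (angle N k).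
Proof.
move=> kN; apply: cos_gt0_pihalf; rewrite angle_lt// andbT.
have := @angle_ge0 N k (leq_ltn_trans (leq0n k) kN); have := pi_gt0 R; lra.
Qed.

Lemma weight_ge0 N k : (k < N)%N -> 0 <= weight N k.
Proof.
move=> kN; have N0 : (0 < N)%N by exact: leq_ltn_trans kN.
have lt : angle N k < angle N k.+1 by rewrite angleS ltrDl step_gt0.
have [c /andP[c1 c2] hc] := cosB_MVT lt; rewrite /weight hc mulr_ge0//; last by rewrite subr_ge0 ltW.
apply: ltW; apply: sin_gt0_pi; rewrite (le_lt_trans (angle_ge0 k N0) c1)/=.
have : angle N k.+1 <= pi / 2 by rewrite -(angleN N0) /angle ler_pM2r ?step_gt0// ler_nat.
have := pi_gt0 R; lra.
Qed.

Lemma sum_weight N : (0 < N)%N -> \sum_(k < N) weight N k = 1.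
Proof.
move=> N0; transitivity (cos (angle N 0) - cos (angle N N)); last first.
  by rewrite angle0 angleN// cos0 cos_pihalf subr0.
rewrite -(big_mkord xpredT (fun k => weight N k)) -[RHS]opprB.
rewrite -(telescope_sumr (fun k => cos (angle N k)) (leq0n N)) -sumrN.
by apply: eq_bigr => k _; rewrite opprB.
Qed.

(** The limit is the integral of sin cos over the quarter turn; the Riemann sum
    is above it, because cos decreases. *)
Lemma sum_weight_cos N : (0 < N)%N -> 2^-1 <= \sum_(k < N) weight N k * cos (angle N k).
Proof.
move=> N0; apply: (@le_trans _ _ (\sum_(k < N) 2^-1 *
    (cos (angle N k) ^+ 2 - cos (angle N k.+1) ^+ 2))).
  rewrite -mulr_sumr -(big_mkord xpredT (fun k => cos (angle N k) ^+ 2 - cos (angle N k.+1) ^+ 2)).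
  have -> : \sum_(0 <= k < N) (cos (angle N k) ^+ 2 - cos (angle N k.+1) ^+ 2) =
      cos (angle N 0) ^+ 2 - cos (angle N N) ^+ 2.
    rewrite -[RHS]opprB -(telescope_sumr (fun k => cos (angle N k) ^+ 2) (leq0n N)) -sumrN.
    by apply: eq_bigr => k _; rewrite opprB.
  by rewrite angle0 angleN// cos0 cos_pihalf expr1n expr0n/= subr0 mulr1.
apply: ler_sum => k _; rewrite /weight.
by have := sqr_ge0 (cos (angle N k) - cos (angle N k.+1)); rewrite sqrrB; lra.
Qed.

End angles.

Section covariance_formula.
Context {R : realType} {n : nat}.
Context d (Omega : measurableType d) (P : probability Omega R).
Variable (xi : Omega -> 'rV[R]_n).
Hypothesis gxi : standard_gaussian P xi.
Local Notation E := (gE P xi).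
Local Notation E2 := (gE (P2 P) (xi2 xi)).

Lemma gE2_lin c s (g : 'rV[R]_n -> R) : 0 < c -> c ^+ 2 + s ^+ 2 = 1 -> tame g ->
  E2 (fun z => g (lin c s z)) = E g.
Proof.
move=> c0 cs tg; rewrite -(gE2_l gxi tg) -(gE2_rotate gxi c0 cs (tame_l tg)).
by apply: gE_eq => z; rewrite /rotate row_mxKl.
Qed.

(** The interpolation from x to its independent copy y along the circle,
    cos theta x + sin theta y, gives
      Cov(F, p) = int_0^(pi/2) sin theta E <G(cos theta x + sin theta y), V x>,
    here with a Riemann sum of N steps, each of them an instance of
    [covariance_step] with an error of order 1 / N^2. *)
Lemma covariance_formula (F p : 'rV[R]_n -> R) (G V : 'rV[R]_n -> 'rV[R]_n) :
  tame F -> tamev G -> taylor F G -> tame p -> tamev V -> taylor p V ->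
  exists2 K : R, 0 <= K & forall N, (2 <= N)%N ->
  `|E (fun x => F x * p x) - E F * E p - \sum_(k < N) weight N k *
     E2 (fun z => dot (G (lin (cos (angle N k)) (sin (angle N k)) z)) (V (lsubmx z)))|
  <= K / N%:R.
Proof.
move=> tF tG FG tp tV pV.
have [K K0 hK] := covariance_step gxi tF tG FG tp tV pV.
exists (4 * K); first by rewrite mulr_ge0.
move=> N N2; have N0 : (0 < N)%N by exact: leq_trans N2.
have NR : (0 : R) < N%:R by rewrite ltr0n.
have g2 := gaussian_xi2 gxi.
pose h : R := pi / 2 / N%:R; have h0 : 0 < h := step_gt0 N0.
have pi2 : pi / 2 <= 2 :> R by have /andP[] := (@pihalf_02_cos_pihalf R).1.
have h2 : h <= 2 / N%:R by rewrite /h ler_pM2r ?invr_gt0.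
have h1 : h <= 1.
  by rewrite (le_trans h2)// ler_pdivrMr// mul1r ler_nat.
pose u k z := F (lin (cos (angle N k)) (sin (angle N k)) z) * p (lsubmx z).
have tu k : tame (u k).
  by apply: tameM; [apply: (tame_comp tF); exact: tamev_lin|exact: tame_l].
have u0 : E2 (u 0) = E (fun x => F x * p x).
  rewrite -(gE2_l gxi (tameM tF tp)); apply: gE_eq => z.
  by rewrite /u angle0 cos0 sin0 /lin scale1r scale0r addr0.
have uN : E2 (u N) = E F * E p.
  rewrite mulrC -(gE2_prod gxi tp tF); apply: gE_eq => z.
  by rewrite /u angleN// cos_pihalf sin_pihalf /lin scale1r scale0r add0r mulrC.
pose D k := E2 (fun z => dot (G (lin (cos (angle N k)) (sin (angle N k)) z)) (V (lsubmx z))).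
have -> : E (fun x => F x * p x) - E F * E p = \sum_(k < N) (E2 (u k) - E2 (u k.+1)).
  rewrite -u0 -uN -(big_mkord xpredT (fun k => E2 (u k) - E2 (u k.+1))).
  rewrite -[LHS]opprB -(telescope_sumr (fun k => E2 (u k)) (leq0n N)) -sumrN.
  by apply: eq_bigr => k _; rewrite opprB.
rewrite -sumrB (le_trans (ler_norm_sum _ _ _))//.
apply: (@le_trans _ _ (\sum_(k < N) K * (2 / N%:R) ^+ 2)); last first.
  rewrite sumr_const card_ord -mulr_natl le_eqVlt; apply/orP; left; apply/eqP.
  by field; rewrite gt_eqF.
apply: ler_sum => k _.
have cosk := @cos_angle_gt0 R _ _ (ltn_ord k).
have := hK _ _ (cos h) (sin h) h cosk (cos2Dsin2 _) (cos2Dsin2 _).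
rewrite -cosD -sinD -angleS -(gEB g2)//.
rewrite subr_ge0 cos_le1 (cos_ge_quadratic (ltW h0)) (sin_le_id (ltW h0)) h1.
move=> /(_ isT isT isT isT) hk.
apply: (@le_trans _ _ (K * h ^+ 2)).
  rewrite (le_trans _ hk)// le_eqVlt; apply/orP; left; apply/eqP; congr `|_ - _|.
  by apply: gE_eq => z; rewrite /u mulrBl.
rewrite ler_wpM2l//; apply: lerXn2r; rewrite ?nnegrE ?(ltW h0)// divr_ge0//.
Qed.

(** The Gaussian Poincare inequality, for functions with a gradient: the
    gradients at x and at its rotate have the same law, so the covariance
    formula bounds the variance by an average of E |V|^2. *)
Lemma poincare_taylor (g : 'rV[R]_n -> R) (V : 'rV[R]_n -> 'rV[R]_n) :
  tame g -> tamev V -> taylor g V ->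
  E (fun x => g x ^+ 2) - E g ^+ 2 <= E (fun x => enorm (V x) ^+ 2).
Proof.
move=> tg tV gV; have [K K0 hK] := covariance_formula tg tV gV tg tV gV.
have g2 := gaussian_xi2 gxi.
have tV2 : tame (fun x => enorm (V x) ^+ 2) by apply: tameX; exact: tame_enormv.
set M := E (fun x => enorm (V x) ^+ 2).
apply: (le_of_le_divn K0) => N N2; have N0 : (0 < N)%N by exact: leq_trans N2.
have := hK N N2; set Sg := \sum_(k < N) _.
have -> : E (fun x => g x * g x) = E (fun x => g x ^+ 2).
  by apply: gE_eq => x; rewrite expr2.
rewrite -expr2 => h1; have Sle : Sg <= M.
  rewrite -[leRHS]mul1r -(@sum_weight R N N0) mulr_suml; apply: ler_sum => k _.
  rewrite ler_wpM2l ?weight_ge0//.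
  set c := cos _; set s := sin _.
  have c0 : 0 < c := @cos_angle_gt0 R _ _ (ltn_ord k).
  have cs : c ^+ 2 + s ^+ 2 = 1 := cos2Dsin2 _.
  have tVl : tamev (fun z : 'rV[R]_(n + n) => V (lsubmx z)) by apply: (tamev_comp tV); exact: tamev_lsubmx.
  have tVc : tamev (fun z => V (lin c s z)) by apply: (tamev_comp tV); exact: tamev_lin.
  have t1 : tame (fun z : 'rV[R]_(n + n) => enorm (V (lsubmx z)) ^+ 2) by apply: tameX; exact: tame_enormv.
  have t2 : tame (fun z => enorm (V (lin c s z)) ^+ 2) by apply: tameX; exact: tame_enormv.
  have -> : M = E2 (fun z => 2^-1 * (enorm (V (lin c s z)) ^+ 2 + enorm (V (lsubmx z)) ^+ 2)).
    rewrite (gEZ g2); last exact: tameD.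
    rewrite (gED g2)// (gE2_lin c0 cs tV2) (gE2_l gxi tV2) -/M; lra.
  apply: (gE_le g2); [exact: tame_dot|by apply: tameZ; exact: tameD|move=> z].
  apply: (le_trans (dot_le _ _)).
  set a := enorm (V (lin c s z)); set b := enorm (V (lsubmx z)).
  have -> : 2^-1 * (a ^+ 2 + b ^+ 2) = a * b + 2^-1 * (a - b) ^+ 2 by field.
  by rewrite lerDl mulr_ge0 ?sqr_ge0.
move: h1; rewrite ler_norml => /andP[_]; rewrite lerBlDr => h1.
by apply: (le_trans h1); rewrite addrC; exact: lerD.
Qed.

End covariance_formula.


(** * Averages over the unit interval *)

Section average.
Context {R : realType}.
Local Notation leb := (@lebesgue_measure R).
Implicit Types k : R -> R.

Definition avg (k : R -> R) : R := \int[leb]_(u in `[0, 1]) k u.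

Let leb01 : leb `[0%R, 1%R]%classic = 1%E.
Proof. by rewrite lebesgue_measure_itv/= lte01 oppr0 adde0. Qed.

Lemma avgB k1 k2 : continuous k1 -> continuous k2 ->
  avg (fun u => k1 u - k2 u) = avg k1 - avg k2.
Proof. by move=> c1 c2; apply: RintegralB => //; exact: continuous_itv_integrable. Qed.

Lemma avgZ a k : continuous k -> avg (fun u => a * k u) = a * avg k.
Proof. by move=> c1; apply: RintegralZl => //; exact: continuous_itv_integrable. Qed.

Lemma avg_cst a : avg (fun _ => a) = a.
Proof.
rewrite /avg Rintegral_cst// -[RHS]mulr1; congr (_ * _).
exact: (congr1 fine leb01).
Qed.

Lemma avg_eq k1 k2 : k1 =1 k2 -> avg k1 = avg k2.
Proof. by move=> h; apply: eq_Rintegral => u _; exact: h. Qed.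

Lemma avg_abs_le k b : continuous k -> (forall u, 0 <= u <= 1 -> `|k u| <= b) ->
  `|avg k| <= b.
Proof.
move=> ck kb; have ik := continuous_itv_integrable 0 1 ck.
have ib : leb.-integrable `[0, 1] (EFin \o (fun _ : R => b)).
  by apply: continuous_itv_integrable => x; exact: cvg_cst.
have iNb : leb.-integrable `[0, 1] (EFin \o (fun _ : R => - b)).
  by apply: continuous_itv_integrable => x; exact: cvg_cst.
rewrite ler_norml -{1}(avg_cst (- b)) -{2}(avg_cst b); apply/andP; split;
  apply: le_Rintegral => // u /=; rewrite in_itv/= => /kb; rewrite ler_norml => /andP[] //.
Qed.

(** The primitives below have a derivative on a half-line only. *)
Lemma FTC_gt (F f : R -> R) (c a b : R) : c < a -> a <= b ->
  (forall x : R, c < x -> is_derive x 1 F (f x)) -> continuous f ->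
  \int[leb]_(x in `[a, b]) f x = F b - F a.
Proof.
move=> ca ab dF cf.
have cF x : c < x -> {for x, continuous F}.
  move=> cx; apply: differentiable_continuous; apply/derivable1_diffP.
  exact: (@ex_derive _ _ _ _ _ _ _ (dF x cx)).
move: ab; rewrite le_eqVlt => /predU1P[<-|ab].
  by rewrite set_itv1 Rintegral_set1 subrr.
rewrite /Rintegral (@continuous_FTC2 _ f F)//.
- exact: continuous_subspaceT.
- split.
  + move=> x; rewrite in_itv/= => /andP[ax _].
    exact: (@ex_derive _ _ _ _ _ _ _ (dF x (lt_trans ca ax))).
  + by apply: cvg_at_right_filter; exact: cF.
  + by apply: cvg_at_left_filter; apply: cF; exact: lt_trans ab.
- move=> x; rewrite in_itv/= => /andP[ax _]; rewrite derive1E.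
  exact: (@derive_val _ _ _ _ _ _ _ (dF x (lt_trans ca ax))).
Qed.

Lemma primitive_gt (k : R -> R) (c : R) : continuous k ->
  exists K : R -> R, forall x : R, c < x -> is_derive x 1 K (k x).
Proof.
move=> ck; exists (fun x => \int[leb]_(t in `[c, x]) k t) => x cx.
have xu : x < x + 1 by rewrite ltrDl.
have [dK dKE] := continuous_FTC1_closed xu (continuous_itv_integrable c (x + 1) ck) cx (ck x).
by apply: DeriveDef; [exact: dK|rewrite -derive1E; exact: dKE].
Qed.

Lemma MVT_gt (K k : R -> R) (c x y : R) : c < x -> c < y ->
  (forall x : R, c < x -> is_derive x 1 K (k x)) ->
  exists2 z, `|z - x| <= `|y - x| & K y - K x = k z * (y - x).
Proof.
move=> cx cy dK.
have cK z : c < z -> {for z, continuous K}.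
  move=> cz; apply: differentiable_continuous; apply/derivable1_diffP.
  exact: (@ex_derive _ _ _ _ _ _ _ (dK z cz)).
have main a b : c < a -> a < b -> exists2 z, a < z < b & K b - K a = k z * (b - a).
  move=> ca ab.
  have h1 z : z \in `]a, b[ -> is_derive z 1 K (k z).
    by rewrite in_itv/= => /andP[az _]; apply: dK; exact: lt_trans az.
  have h2 : {within `[a, b], continuous K}.
    apply: continuous_in_subspaceT => z; rewrite inE/= in_itv/= => /andP[az _].
    by apply: cK; exact: lt_le_trans az.
  have [z] := MVT ab h1 h2; rewrite in_itv/= => zab hz; by exists z.
have [->|] := eqVneq x y; first by exists y; rewrite ?subrr// mulr0.
rewrite neq_lt => /orP[xy|yx].
  have [z /andP[z1 z2] ->] := main _ _ cx xy; exists z => //.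
  by rewrite !ger0_norm ?subr_ge0 ?(ltW xy) ?(ltW z1)// lerD2r ltW.
have [z /andP[z1 z2] hz] := main _ _ cy yx; exists z.
  by rewrite !ler0_norm ?subr_le0 ?(ltW yx) ?(ltW z2)// !opprB lerD2l lerN2 ltW.
by rewrite -[LHS]opprB hz -mulrN opprB.
Qed.

(** Averaging over an interval of length [s] turns a Lipschitz function into
    one with a Lipschitz derivative, the difference quotient of step [s]. *)
Lemma avg_taylor (k : R -> R) (s t B : R) : continuous k -> 0 < s ->
  (forall v, `|v| <= `|t| -> `|k (s + v) - k s| <= B * `|v|) ->
  (forall v, `|v| <= `|t| -> `|k v - k 0| <= B * `|v|) ->
  `|avg (fun u => k (t + s * u)) - avg (fun u => k (s * u)) - t * ((k s - k 0) / s)|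
   <= 2 * B / s * t ^+ 2.
Proof.
move=> ck s0 hs h0.
pose c : R := - (`|t| + 1).
have [K dK] := primitive_gt c ck.
have t1 := ler_norm t; have t2 : - `|t| <= t by rewrite lerNl -normrN ler_norm.
have c0 : c < 0 by rewrite /c; have := normr_ge0 t; lra.
have ct : c < t by rewrite /c; lra.
have avgK (a : R) : c < a -> avg (fun u => k (a + s * u)) = (K (a + s) - K a) / s.
  move=> ca.
  have dL (u : R) : (c - a) / s < u -> is_derive u 1 (fun u => s^-1 * K (a + s * u)) (k (a + s * u)).
    rewrite ltr_pdivrMr// ltrBlDr => hu.
    have dl : is_derive u 1 (fun u : R => a + s * u) s.
      have h := derivRD (derivR_cst a u) (derivRM (derivR_cst s u) (derivR_id u)).
      by apply: (is_derive_eq h); ring.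
    have dd : is_derive (a + s * u) 1 K (k (a + s * u)).
      by apply: dK; rewrite addrC mulrC.
    have h := derivRM (derivR_cst s^-1 u) (derivR_comp (g := fun u : R => a + s * u) dd dl).
    by apply: (is_derive_eq h); field; rewrite gt_eqF.
  rewrite /avg (FTC_gt _ ler01 dL); last 2 first.
  - by rewrite ltr_pdivrMr// mul0r subr_lt0.
  - move=> u; apply: (@continuous_comp _ _ _ (fun u => a + s * u) k); last exact: ck.
    by apply: cvgD; [exact: cvg_cst|apply: cvgM; [exact: cvg_cst|exact: cvg_id]].
  by rewrite mulr0 addr0 mulr1; ring.
rewrite avgK// (avg_eq (_ : _ =1 fun u => k (0 + s * u))); last by move=> u; rewrite add0r.
rewrite avgK// add0r.
have cs : c < s by exact: lt_trans s0.
have cts : c < s + t by rewrite /c; lra.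
have [z1 hz1 E1] := MVT_gt cs cts dK.
have [z2 hz2 E2] := MVT_gt c0 ct dK.
have {}hz1 : `|z1 - s| <= `|t| by rewrite (le_trans hz1)// addrAC subrr add0r.
have {}hz2 : `|z2| <= `|t| by move: hz2; rewrite !subr0.
have b1 := hs _ hz1; have b2 := h0 _ hz2.
have -> : (K (t + s) - K t) / s - (K s - K 0) / s - t * ((k s - k 0) / s) =
   t / s * ((k (s + (z1 - s)) - k s) - (k z2 - k 0)).
  rewrite (_ : s + (z1 - s) = z1); last by ring.
  rewrite (_ : (K (t + s) - K t) / s - (K s - K 0) / s =
    ((K (s + t) - K s) - (K t - K 0)) / s); last by rewrite (addrC s); ring.
  by rewrite E1 E2; ring.
rewrite normrM (_ : 2 * B / s * t ^+ 2 = `|t / s| * (2 * B * `|t|)); last first.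
  rewrite normrM normfV (ger0_norm (ltW s0)) -(real_normK (num_real t)); ring.
rewrite ler_wpM2l// (le_trans (ler_normB _ _))//.
have B0 : 0 <= B * `|t|.
  exact: le_trans (normr_ge0 _) (h0 t (lexx _)).
have [t0|t0] := eqVneq t 0.
  move: hz1 hz2 b1 b2; rewrite t0 !normr0 !normr_le0 => /eqP -> /eqP ->.
  by rewrite normr0 !mulr0 addr0 !subrr !normr0 addr0.
have Bp : 0 <= B.
  by move: B0; rewrite pmulr_lge0// normr_gt0.
have : B * `|z1 - s| <= B * `|t| by rewrite ler_wpM2l.
have : B * `|z2| <= B * `|t| by rewrite ler_wpM2l.
lra.
Qed.

End average.


(** * Smoothing along one axis *)

Section smoothing.
Context {R : realType} {n : nat}.
Local Notation e_ j := (delta_mx ord0 j : 'rV[R]_n).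
Implicit Types (c B : R) (g V : 'rV[R]_n -> R) (x y : 'rV[R]_n).

Definition smooth1 (s : R) (j : 'I_n) g x : R := avg (fun u => g (x + (s * u) *: e_ j)).

Lemma axis_continuous g (s : R) j x : tame g -> continuous (fun u : R => g (x + (s * u) *: e_ j)).
Proof.
move=> tg u.
apply: (@continuous_comp _ _ _ (fun u : R => x + (s * u) *: e_ j) g); last exact: tame_continuous.
apply: continuousD; first exact: (@cst_continuous R 'rV[R]_n).
apply: continuousZr_tmp; apply: continuousM; [exact: cvg_cst|exact: cvg_id].
Qed.

(** [V] is the partial derivative of [g] along the axis [i], with one constant
    for its second order remainder and its own Lipschitz bound. *)
Definition partial (B : R) (i : 'I_n) g V :=
  (forall x t, `|g (x + t *: e_ i) - g x - t * V x| <= B * (wt x * (1 + `|t|)) * t ^+ 2) /\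
  (forall x y, `|V x - V y| <= B * (wt x * wt y) * enorm (x - y)).

Lemma partial_tame B i g V : 0 <= B -> partial B i g V -> tame V.
Proof. by move=> B0 [_ h]; exists B => //; exists 1. Qed.

Lemma enorm_axis (s u : R) j : 0 <= s -> 0 <= u <= 1 -> enorm ((s * u) *: e_ j) <= s * u.
Proof.
by move=> s0 /andP[u0 u1]; rewrite enormZ enorm_delta mulr1 ger0_norm// mulr_ge0.
Qed.

Lemma wt_axis (s u : R) j x : 0 <= s -> s <= 1 -> 0 <= u <= 1 ->
  wt (x + (s * u) *: e_ j) <= 2 * wt x.
Proof.
move=> s0 s1 u01; have /andP[u0 u1] := u01.
have h1 := ler_enormD x ((s * u) *: e_ j); have h2 := enorm_axis j s0 u01.
have h3 : s * u <= 1 by rewrite mulr_ile1.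
by rewrite !wtE; have := enorm_ge0 x; lra.
Qed.

(** Smoothing along one axis keeps the derivatives gained along the others. *)
Lemma partial_smooth1 (s : R) j B i g V : 0 <= s -> s <= 1 -> 0 <= B -> tame g ->
  partial B i g V -> partial (4 * B) i (smooth1 s j g) (smooth1 s j V).
Proof.
move=> s0 s1 B0 tg gV; have tV := partial_tame B0 gV; have [h1 h2] := gV.
have cg x := @axis_continuous g s j x tg; have cV x := @axis_continuous V s j x tV.
split=> [x t|x y]; rewrite /smooth1.
  rewrite -avgB// -avgZ// -avgB; last 2 first.
  - by move=> u; apply: cvgB; exact: cg.
  - by move=> u; apply: cvgM; [exact: cvg_cst|exact: cV].
  apply: avg_abs_le.
    move=> u; apply: cvgB; first by apply: cvgB; exact: cg.
    by apply: cvgM; [exact: cvg_cst|exact: cV].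
  move=> u u01; rewrite [x + _ + _]addrAC (le_trans (h1 _ _))// ler_wpM2r ?sqr_ge0//.
  rewrite (_ : 4 * B * _ = B * (4 * wt x * (1 + `|t|))); last by ring.
  rewrite ler_wpM2l// ler_wpM2r ?addr_ge0//.
  by rewrite (le_trans (wt_axis j x s0 s1 u01))// ler_wpM2r ?wt_ge0//; lra.
rewrite -avgB//; apply: avg_abs_le; first by move=> u; apply: cvgB; exact: cV.
move=> u u01; rewrite (le_trans (h2 _ _))// opprD addrACA subrr addr0.
rewrite ler_wpM2r ?enorm_ge0// (_ : 4 * B * _ = B * ((2 * wt x) * (2 * wt y))); last by ring.
rewrite ler_wpM2l//.
by apply: ler_pM; rewrite ?wt_ge0// wt_axis.
Qed.

Section loclip.
Variables (L : 'rV[R]_n -> R) (A : R).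
Hypotheses (A0 : 0 <= A) (L0 : forall x, 0 <= L x).
Hypothesis LA : forall x y, `|L x - L y| <= A * enorm (x - y).

(** [L + c] bounds the local Lipschitz constant; [c] absorbs the loss due to
    smoothing and tends to 0 with its scale. *)
Definition loclip (c : R) g := forall x y,
  `|g x - g y| <= (L x + c + A * enorm (x - y)) * enorm (x - y).

Let L_le x y : L y <= L x + A * enorm (x - y).
Proof. by rewrite -lerBlDl (le_trans _ (LA x y))// distrC ler_norm. Qed.

Let L_wt x : L x <= L 0 + A * enorm x.
Proof. by have := L_le 0 x; rewrite sub0r enormN. Qed.

Lemma tame_loclip c g : 0 <= c -> loclip c g -> tame g.
Proof.
move=> c0 h; exists (L 0 + c + 2 * A); first by rewrite !addr_ge0// mulr_ge0.
exists 1 => x y; rewrite (le_trans (h x y))// ler_wpM2r ?enorm_ge0//.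
have := ler_enormB x y; have ex := enorm_ge0 x; have ey := enorm_ge0 y; have := L_wt x.
rewrite expr1 !wtE => l1 l2.
have : A * enorm (x - y) <= A * (enorm x + enorm y) by rewrite ler_wpM2l.
have exy := mulr_ge0 ex ey; have L00 := L0 0.
have := mulr_ge0 A0 ex; have := mulr_ge0 A0 ey; have := mulr_ge0 A0 exy.
have : 0 <= (L 0 + c) * (enorm x + enorm y + enorm x * enorm y).
  by rewrite mulr_ge0 ?addr_ge0.
have := A0; lra.
Qed.

Lemma loclip_smooth1 (s : R) j c g : 0 <= s -> 0 <= c -> loclip c g ->
  loclip (c + s * A) (smooth1 s j g).
Proof.
move=> s0 c0 h x y; have tg := tame_loclip c0 h.
have cg z := @axis_continuous g s j z tg.
rewrite /smooth1 -avgB//; apply: avg_abs_le; first by move=> u; apply: cvgB; exact: cg.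
move=> u u01; have /andP[u0 u1] := u01; rewrite (le_trans (h _ _))//.
rewrite opprD addrACA subrr addr0 ler_wpM2r ?enorm_ge0// lerD2r.
have := L_le x (x + (s * u) *: e_ j); rewrite opprD addrA subrr sub0r enormN.
have := enorm_axis j s0 u01.
have : s * u <= s by rewrite ler_piMr.
move=> h1 h2; have : A * enorm ((s * u) *: e_ j) <= A * s by rewrite ler_wpM2l// (le_trans h2).
lra.
Qed.

Lemma smooth1_dist (s : R) j c g x : 0 <= s -> 0 <= c -> loclip c g ->
  `|smooth1 s j g x - g x| <= (L x + c + A * s) * s.
Proof.
move=> s0 c0 h; have tg := tame_loclip c0 h.
have cg z := @axis_continuous g s j z tg.
have cc (a : R) : continuous (fun _ : R => a) by move=> u; exact: cvg_cst.
rewrite /smooth1 -[in X in _ - X](avg_cst (g x)) -avgB//.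
apply: avg_abs_le; first by move=> u; apply: cvgB; [exact: cg|exact: cc].
move=> u u01; rewrite distrC (le_trans (h _ _))// opprD addrA subrr sub0r enormN.
have h2 := enorm_axis j s0 u01; have /andP[u0 u1] := u01.
have h3 : enorm ((s * u) *: e_ j) <= s by rewrite (le_trans h2)// ler_piMr.
apply: ler_pM; rewrite ?enorm_ge0//; first by rewrite !addr_ge0// mulr_ge0// enorm_ge0.
by rewrite lerD2l ler_wpM2l.
Qed.

Lemma smooth1_partial (s : R) j c g : 0 < s -> s <= 1 -> 0 <= c -> loclip c g ->
  exists2 B, 0 <= B & partial B j (smooth1 s j g) (fun x => (g (x + s *: e_ j) - g x) / s).
Proof.
move=> s0 s1 c0 h; have tg := tame_loclip c0 h.
have D0 : 0 <= L 0 + c + 2 * A by rewrite !addr_ge0// mulr_ge0.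
exists (2 / s * (L 0 + c + 2 * A)); first by rewrite mulr_ge0// divr_ge0// ltW.
split=> [x t|x y].
  have ck : continuous (fun v : R => g (x + v *: e_ j)).
    move=> v; have := @axis_continuous g 1 j x tg v.
    by under eq_fun do rewrite mul1r.
  have en (v : R) : enorm (v *: e_ j) = `|v| by rewrite enormZ enorm_delta mulr1.
  pose B := L x + A * s + c + A * `|t|.
  have hB (v w : R) : 0 <= w <= s -> `|v| <= `|t| ->
      `|g (x + (w + v) *: e_ j) - g (x + w *: e_ j)| <= B * `|v|.
    move=> /andP[w0 ws] vt; rewrite distrC (le_trans (h _ _))//.
    rewrite (_ : _ - _ = - (v *: e_ j)); last by rewrite scalerDl; apply/rowP => i; rewrite !mxE; ring.
    rewrite enormN en ler_wpM2r//.
    have := L_le x (x + w *: e_ j); rewrite opprD addrA subrr sub0r enormN en (ger0_norm w0).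
    have : A * w <= A * s by rewrite ler_wpM2l.
    have : A * `|v| <= A * `|t| by rewrite ler_wpM2l.
    rewrite /B; lra.
  have := @avg_taylor R (fun v => g (x + v *: e_ j)) s t B ck s0.
  rewrite scale0r addr0 => /(_ _ _)/le_trans hh.
  rewrite (_ : smooth1 s j g (x + t *: e_ j) = avg (fun u => g (x + (t + s * u) *: e_ j))); last first.
    by apply: avg_eq => u; rewrite scalerDl addrA.
  apply: hh => [v vt|v vt|].
  - by apply: hB => //; rewrite lexx (ltW s0).
  - by have := hB v 0 _ vt; rewrite add0r scale0r addr0; apply; rewrite lexx (ltW s0).
  rewrite ler_wpM2r ?sqr_ge0// (_ : 2 * B / s = 2 / s * B); last by ring.
  rewrite -[leRHS]mulrA ler_wpM2l ?divr_ge0 ?(ltW s0)//.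
  have := L_wt x; have ex := enorm_ge0 x; have t0 := normr_ge0 t.
  have : A * s <= A by rewrite ler_piMr.
  have := mulr_ge0 A0 ex; have := mulr_ge0 A0 t0; have := mulr_ge0 A0 (mulr_ge0 ex t0).
  have L00 := L0 0.
  have : 0 <= (L 0 + c) * (enorm x + `|t| + enorm x * `|t|).
    by rewrite mulr_ge0 ?addr_ge0// mulr_ge0.
  by have := A0; rewrite /B wtE; lra.
rewrite -mulrBl normrM normfV (gtr0_norm s0) ler_pdivrMr//.
rewrite (_ : 2 / s * _ * _ * _ * s =
    2 * (L 0 + c + 2 * A) * (wt x * wt y) * enorm (x - y)); last by field; rewrite gt_eqF.
rewrite (_ : _ - _ = (g (x + s *: e_ j) - g (y + s *: e_ j)) - (g x - g y)); last by ring.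
rewrite (le_trans (ler_normB _ _))//.
have := h (x + s *: e_ j) (y + s *: e_ j); have := h x y; rewrite opprD addrACA subrr addr0.
move=> h1 h2; apply: (le_trans (lerD h2 h1)); rewrite -mulrDl ler_wpM2r ?enorm_ge0//.
have := L_le x (x + s *: e_ j); rewrite opprD addrA subrr sub0r enormN enormZ enorm_delta mulr1 (gtr0_norm s0).
have := ler_enormB x y; have ex := enorm_ge0 x; have ey := enorm_ge0 y; have := L_wt x.
rewrite !wtE => l1 l2.
have : A * enorm (x - y) <= A * (enorm x + enorm y) by rewrite ler_wpM2l.
have exy := mulr_ge0 ex ey; have L00 := L0 0.
have : A * s <= A by rewrite ler_piMr.
have := mulr_ge0 A0 ex; have := mulr_ge0 A0 ey; have := mulr_ge0 A0 exy.
have : 0 <= (L 0 + c) * (enorm x + enorm y + enorm x * enorm y).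
  by rewrite mulr_ge0 ?addr_ge0.
have := A0; lra.
Qed.

End loclip.
End smoothing.


(** * The Poincare inequality for locally Lipschitz functions *)

Section gradient.
Context {R : realType} {n : nat}.
Local Notation e_ j := (delta_mx ord0 j : 'rV[R]_n).
Implicit Types (B c s : R) (g : 'rV[R]_n -> R) (x y : 'rV[R]_n).

(** Changing the coordinates one at a time. *)
Lemma partial_taylor B g (W : 'I_n -> 'rV[R]_n -> R) : 0 <= B ->
  (forall i, partial B i g (W i)) -> taylor g (fun x => \row_i W i x).
Proof.
move=> B0 gW; exists (n%:R * (4 * B)); first by rewrite !mulr_ge0.
exists 2 => x y; set h := y - x.
pose p (k : nat) : 'rV[R]_n := \row_i (if (i < k)%N then y ord0 i else x ord0 i).
have p0 : p 0 = x by apply/rowP => i; rewrite mxE.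
have pn : p n = y by apply/rowP => i; rewrite mxE ltn_ord.
have pS (k : 'I_n) : p k.+1 = p k + h ord0 k *: e_ k.
  apply/rowP => i; rewrite !mxE eqxx/=; case: (ltngtP i k) => ik.
  - by rewrite ltnS (ltnW ik) (_ : (i == k) = false) ?mulr0 ?addr0//; apply/eqP => e; rewrite e ltnn in ik.
  - by rewrite ltnS leqNgt ik/= (_ : (i == k) = false) ?mulr0 ?addr0//; apply/eqP => e; rewrite e ltnn in ik.
  - by rewrite ltnS ik leqnn (val_inj ik) eqxx mulr1 addrC subrK.
have dp k : enorm (p k - x) <= enorm h.
  rewrite ler_enorm /dot; apply: ler_sum => i _; rewrite !mxE.
  by case: ifP => _ //; rewrite subrr mulr0 -expr2 sqr_ge0.
have -> : g y - g x - dot (\row_i W i x) h =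
    \sum_(k < n) (g (p k.+1) - g (p k) - h ord0 k * W k x).
  rewrite sumrB; congr (_ - _).
    by rewrite -(big_mkord xpredT (fun k => g (p k.+1) - g (p k))) telescope_sumr// pn p0.
  by apply: eq_bigr => k _; rewrite mxE mulrC.
rewrite (le_trans (ler_norm_sum _ _ _))//.
have -> : n%:R * (4 * B) * (wt x * wt y) ^+ 2 * enorm h ^+ 2 =
    \sum_(k < n) 4 * B * (wt x * wt y) ^+ 2 * enorm h ^+ 2.
  by rewrite sumr_const card_ord -[RHS]mulr_natl; ring.
apply: ler_sum => k _; rewrite pS.
have [h1 h2] := gW k; have {}h1 := h1 (p k) (h ord0 k); have {}h2 := h2 (p k) x.
rewrite (_ : _ - _ - _ = (g (p k + h ord0 k *: e_ k) - g (p k) - h ord0 k * W k (p k))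
  + h ord0 k * (W k (p k) - W k x)); last by ring.
rewrite (le_trans (ler_normD _ _))// normrM.
set hk := `|h ord0 k|; have hkE : hk <= enorm h := ler_coord_enorm h k.
have hk0 : 0 <= hk := normr_ge0 _.
have H : enorm h <= enorm x + enorm y by rewrite addrC ler_enormB.
have ex := enorm_ge0 x; have ey := enorm_ge0 y; have eh := enorm_ge0 h.
have exy := mulr_ge0 ex ey.
have wM : wt x * wt y = 1 + enorm x + enorm y + enorm x * enorm y by rewrite !wtE; ring.
have wp : wt (p k) <= 2 * (wt x * wt y).
  have := enorm_triangle x (p k) 0; rewrite !subr0 => q; have := dp k.
  by rewrite wM wtE; lra.
have h1' : 1 + hk <= wt x * wt y by rewrite wM; lra.
have wx : wt x <= wt x * wt y := wt_le_wtM x y.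
have w0 := wt_ge0 (p k); have wxy := wtM_ge1 x y; have wx0 := wt_ge0 x.
rewrite (_ : 4 * B * _ * _ = B * (2 * (wt x * wt y) * (wt x * wt y)) * enorm h ^+ 2 +
   enorm h * (B * (2 * (wt x * wt y) * (wt x * wt y)) * enorm h)); last by ring.
apply: lerD.
  apply: (le_trans h1); rewrite -/hk -(real_normK (num_real (h ord0 k))) -/hk.
  apply: ler_pM; rewrite ?sqr_ge0 ?mulr_ge0 ?addr_ge0//.
    by rewrite ler_wpM2l//; apply: ler_pM => //; exact: addr_ge0.
  by apply: lerXn2r; rewrite ?nnegrE.
apply: ler_pM => //; apply: (le_trans h2).
apply: ler_pM; rewrite ?enorm_ge0 ?mulr_ge0//.
by rewrite ler_wpM2l//; apply: ler_pM.
Qed.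

Section loclip.
Variables (L : 'rV[R]_n -> R) (A : R).
Hypotheses (A0 : 0 <= A) (L0 : forall x, 0 <= L x).
Hypothesis LA : forall x y, `|L x - L y| <= A * enorm (x - y).
Local Notation loclip := (loclip L A).

(** Letting y tend to x along the gradient. *)
Lemma gradient_le c g V x : 0 <= c -> loclip c g -> taylor g V -> enorm (V x) <= L x + c.
Proof.
move=> c0 gL [C C0 [k gV]]; set v := enorm (V x).
have v0 : 0 <= v := enorm_ge0 _.
have vv : dot (V x) (V x) = v ^+ 2 by rewrite -enorm2.
suff h : 0 <= (L x + c) * v - v ^+ 2.
  have [->|vn0] := eqVneq v 0; first by rewrite addr_ge0.
  have vp : 0 < v by rewrite lt_neqAle eq_sym vn0.
  by rewrite -(ler_pM2r vp) -expr2; lra.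
apply: (@ge0_lin_sq _ _ (A * v ^+ 2 + C * (wt x * (wt x + v)) ^+ k * v ^+ 2)) => t t0 t1.
have := gV x (x + t *: V x).
rewrite [x + _ - x]addrC addKr enormZ (ger0_norm t0) -/v dotZr vv.
have := gL x (x + t *: V x); rewrite distrC opprD addrA subrr sub0r enormN enormZ (ger0_norm t0) -/v.
move=> g1 g2.
have hw : C * (wt x * wt (x + t *: V x)) ^+ k * (t * v) ^+ 2 <=
    t ^+ 2 * (C * (wt x * (wt x + v)) ^+ k * v ^+ 2).
  rewrite (_ : t ^+ 2 * _ = C * (wt x * (wt x + v)) ^+ k * (t * v) ^+ 2); last by ring.
  rewrite ler_wpM2r ?sqr_ge0// ler_wpM2l//; apply: lerXn2r; rewrite ?nnegrE ?mulr_ge0 ?wt_ge0 ?addr_ge0 ?wt_ge0//.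
  rewrite ler_wpM2l ?wt_ge0// !wtE -addrA lerD2l (le_trans (ler_enormD _ _))// lerD2l enormZ (ger0_norm t0).
  by rewrite ler_piMl.
move: g1 g2; rewrite !ler_norml => /andP[_ g1] /andP[g2 _].
move: hw g2; set Q := C * _ * _; set Q' := (C * (wt x * (wt x + v)) ^+ k * v ^+ 2).
move: Q Q' => Q Q'; lra.
Qed.

Definition smooth s (r : seq 'I_n) g := foldr (smooth1 s) g r.

(* c = s * A * size r accumulates one term s * A per smoothed axis *)
Lemma smooth_spec s (r : seq 'I_n) g : 0 < s -> s <= 1 -> loclip 0 g ->
  [/\ loclip (s * A * (size r)%:R) (smooth s r g),
   forall x, `|smooth s r g x - g x| <= (size r)%:R * s * (L x + s * A * (size r)%:R) &
   exists2 B, 0 <= B & forall i, i \in r -> exists V, partial B i (smooth s r g) V].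
Proof.
move=> s0 s1 gL; have s0' := ltW s0; elim: r => [|j r [h1 h2 [B B0 h3]]]/=.
  by split; [rewrite mulr0|move=> x; rewrite subrr normr0 !mul0r|exists 0].
have c0 : 0 <= s * A * (size r)%:R by rewrite !mulr_ge0.
have tg := tame_loclip A0 L0 LA c0 h1.
split.
- rewrite -natr1 mulrDr mulr1; exact: loclip_smooth1.
- move=> x; rewrite -(subrK (smooth s r g x) (smooth1 _ _ _ _)) -addrA.
  rewrite (le_trans (ler_normD _ _))// -natr1.
  have := smooth1_dist A0 L0 LA j x s0' c0 h1; have := h2 x.
  set m : R := (size r)%:R; move=> a1 a2; apply: (le_trans (lerD a2 a1)).
  have : 0 <= m * s * (s * A) by rewrite !mulr_ge0.
  lra.
- have [B1 B10 h4] := smooth1_partial A0 L0 LA j s0 s1 c0 h1.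
  exists (B1 + 4 * B); first by rewrite addr_ge0// mulr_ge0.
  have mono B2 i g' V : 0 <= B2 <= B1 + 4 * B -> partial B2 i g' V -> partial (B1 + 4 * B) i g' V.
    move=> /andP[b0 b1] [k1 k2]; split=> [x t|x y].
      rewrite (le_trans (k1 x t))// ler_wpM2r ?sqr_ge0// ler_wpM2r// mulr_ge0 ?wt_ge0// addr_ge0//.
    by rewrite (le_trans (k2 x y))// ler_wpM2r ?enorm_ge0// ler_wpM2r// mulr_ge0 ?wt_ge0.
  move=> i; rewrite inE => /predU1P[->|ir].
    by exists (fun x => (smooth s r g (x + s *: e_ j) - smooth s r g x) / s); apply: mono h4; rewrite B10 lerDl mulr_ge0.
  have [V hV] := h3 i ir; exists (smooth1 s j V).
  by apply: (mono (4 * B)); [rewrite mulr_ge0//= lerDr|exact: partial_smooth1].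
Qed.

Context d (Omega : measurableType d) (P : probability Omega R).
Variable (xi : Omega -> 'rV[R]_n).
Hypothesis gxi : standard_gaussian P xi.
Local Notation E := (gE P xi).

(** The Gaussian Poincare inequality for locally Lipschitz functions, by
    smoothing at a scale [s] that tends to 0. *)
Lemma poincare_loclip g : loclip 0 g ->
  E (fun x => g x ^+ 2) - E g ^+ 2 <= E (fun x => L x ^+ 2).
Proof.
move=> gL; have tg := tame_loclip A0 L0 LA (lexx 0) gL.
have tL : tame L := tame_lip LA.
pose m : R := n%:R; have m0 : 0 <= m by [].
pose Q x := m * (L x + A * m).
have Q0 x : 0 <= Q x by rewrite mulr_ge0// addr_ge0// mulr_ge0.
have tQ : tame Q by apply: tameZ; apply: tameD => //; exact: tame_cst.
pose q := E Q; have q0 : 0 <= q by exact: gE_ge0.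
pose D := 2 * A * m * E L + A ^+ 2 * m ^+ 2 + (E (fun x => g x ^+ 2) + E (fun x => Q x ^+ 2))
  + 2 * `|E g| * q + q ^+ 2.
suff h s : 0 < s -> s <= 1 ->
    E (fun x => g x ^+ 2) - E g ^+ 2 <= E (fun x => L x ^+ 2) + s * D.
  rewrite -subr_ge0; apply: (@ge0_lin_sq _ _ D) => t.
  rewrite le_eqVlt => /predU1P[<-|t0 t1]; first by rewrite !expr0n/= !mul0r addr0.
  have := h t t0 t1.
  rewrite (_ : t * _ + _ = t * (E (fun x => L x ^+ 2) + t * D - (E (fun x => g x ^+ 2) - E g ^+ 2))); last by ring.
  by move=> h'; rewrite mulr_ge0 ?(ltW t0)// subr_ge0.
move=> s0 s1; have s0' := ltW s0.
have [h1 h2 [B B0 h3]] := smooth_spec (enum 'I_n) s0 s1 gL.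
move: h1 h2 h3; rewrite size_enum_ord -/m; set gs := smooth _ _ _ => h1 h2 h3.
have c0 : 0 <= s * A * m by rewrite !mulr_ge0.
have tgs := tame_loclip A0 L0 LA c0 h1.
have [W hW] := boolp.choice (fun i => h3 i (mem_enum 'I_n i)).
have tay := partial_taylor B0 hW.
have tV : tamev (fun x => \row_i W i x).
  move=> i; have := partial_tame B0 (hW i); congr tame; apply/funext => x; by rewrite mxE.
have P1 := poincare_taylor gxi tgs tV tay.
have tLc : tame (fun x => L x ^+ 2 + (2 * (s * A * m) * L x + (s * A * m) ^+ 2)).
  by apply: tameD; [exact: tameX|apply: tameD; [exact: tameZ|exact: tame_cst]].
have P2 : E (fun x => enorm (\row_i W i x) ^+ 2) <=
   E (fun x => L x ^+ 2) + (2 * (s * A * m) * E L + (s * A * m) ^+ 2).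
  have tl := tameZ (2 * (s * A * m)) tL.
  have tc := @tame_cst _ n ((s * A * m) ^+ 2).
  rewrite -[X in _ + (_ + X)](gE_cst P xi) -(gEZ gxi)// -(gED gxi)// -(gED gxi)//; last 2 first.
  - exact: tameX.
  - exact: tameD.
  apply: (gE_le gxi) => //; first by apply: tameX; exact: tame_enormv.
  move=> x; rewrite addrA (_ : _ + _ + _ = (L x + s * A * m) ^+ 2); last by ring.
  apply: lerXn2r; rewrite ?nnegrE ?enorm_ge0 ?addr_ge0//.
  exact: (gradient_le x c0 h1 tay).
have hQ x : `|gs x - g x| <= s * Q x.
  rewrite (le_trans (h2 x))// /Q [leRHS]mulrA [s * m]mulrC ler_wpM2l ?mulr_ge0// lerD2l ler_wpM2r//.
  by rewrite ler_piMl.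
have hE : `|E gs - E g| <= s * q.
  rewrite -(gEB gxi)// -(gEZ gxi)//; apply: (gE_abs_le gxi) => //; [exact: tameB|exact: tameZ].
have hE2 : E (fun x => g x ^+ 2) <= E (fun x => gs x ^+ 2) + s * (E (fun x => g x ^+ 2) + E (fun x => Q x ^+ 2)).
  have t1 := tameX 2 tg; have t2 := tameX 2 tgs; have t3 := tameX 2 tQ.
  have t4 := tameD t1 t3.
  rewrite -(gED gxi t1 t3) -(gEZ gxi)// -(gED gxi)//; last exact: tameZ.
  apply: (gE_le gxi) => //; first by apply: tameD => //; exact: tameZ.
  move=> x; have := hQ x; set a := g x; set b := gs x; set p := Q x => hp.
  have : 2 * `|a| * `|b - a| <= 2 * `|a| * (s * p) by rewrite ler_wpM2l// mulr_ge0.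
  have : 0 <= s * (`|a| - p) ^+ 2 by rewrite mulr_ge0// sqr_ge0.
  have : - (2 * a * (b - a)) <= 2 * `|a| * `|b - a|.
    by rewrite -[2 in leRHS]ger0_norm// -!normrM -normrN ler_norm.
  (* g^2 <= gs^2 + 2 |g| |gs - g|, and 2 |g| Q <= g^2 + Q^2 *)
  have := sqr_ge0 (b - a); rewrite !sqrrB real_normK ?num_real//; lra.
have hsq : (E gs) ^+ 2 <= E g ^+ 2 + s * (2 * `|E g| * q + q ^+ 2).
  have a1 : `|E gs| <= `|E g| + s * q.
    by rewrite -(subrK (E g) (E gs)) addrC (le_trans (ler_normD _ _))// lerD2l.
  have : `|E gs| ^+ 2 <= (`|E g| + s * q) ^+ 2 by apply: lerXn2r; rewrite ?nnegrE// addr_ge0// mulr_ge0.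
  rewrite sqrrD !real_normK ?num_real//.
  have : (s * q) ^+ 2 <= s * q ^+ 2 by rewrite exprMn ler_wpM2r ?sqr_ge0// expr2 ler_piMr.
  lra.
have : (s * A * m) ^+ 2 <= s * (A ^+ 2 * m ^+ 2).
  rewrite (_ : (s * A * m) ^+ 2 = s ^+ 2 * (A ^+ 2 * m ^+ 2)); last by ring.
  by rewrite ler_wpM2r ?mulr_ge0 ?sqr_ge0// expr2 ler_piMr.
rewrite /D; lra.
Qed.

End loclip.
End gradient.


(** * Stein's equation *)

Section gaussian_tails.
Context {R : realType}.
Local Notation leb := (@lebesgue_measure R).
Local Notation gam := (normal_prob (0 : R) 1).
Local Notation phi := (normal_pdf (0 : R) 1).

Lemma phi_sym (x : R) : phi (- x) = phi x.
Proof. by rewrite !normal_pdf01 sqrrN. Qed.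

Lemma phi_cvg0 : phi x @[x --> +oo] --> (0 : R).
Proof.
have [C C0 hC] := @pow_phi_le R 1.
pose D := C * normal_peak (Num.sqrt 2).
have D0 : 0 <= D by rewrite mulr_ge0// normal_peak_ge0.
apply/cvgrPdist_le => e e0; near=> x.
have x0 : 0 < x by near: x; exact: nbhs_pinfty_gt.
rewrite sub0r normrN (ger0_norm (ltW (phi_gt0 _))).
apply: (@le_trans _ _ (D / x)).
  rewrite ler_pdivlMr// mulrC (le_trans (_ : _ <= `|x| ^+ 1 * phi x))//.
    by rewrite expr1 (ger0_norm (ltW x0)).
  by rewrite (le_trans (hC x))// ler_wpM2l// normal_pdf_ub// gt_eqF// sqrtr_gt0.
by rewrite ler_pdivrMr// mulrC -ler_pdivrMr.
Unshelve. all: by end_near. Qed.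

Lemma integrable_phi (A : set (measurableTypeR R)) : measurable A -> leb.-integrable A (EFin \o phi).
Proof.
by move=> mA; apply: (integrableS measurableT mA (subsetT _) (integrable_normal_pdf 0 1)).
Qed.

(** phi x is the integral of u phi u over [x, +oo[, where u >= x. *)
Lemma mills (x : R) : 0 <= x -> x * \int[leb]_(u in `[x, +oo[) phi u <= phi x.
Proof.
move=> x0; have cphi := @phi_continuous R.
have cf : continuous (fun u : R => u * phi u).
  by move=> u; apply: cvgM; [exact: cvg_id|exact: cphi].
have dF (u : R) : is_derive u 1 (fun u => - phi u) (u * phi u).
  have h := derivRM (derivR_cst (-1) u) (is_derive_phi u).
  rewrite (_ : (fun _ => _) = (fun y => -1 * phi y)); last by apply/funext => y; rewrite mulN1r.
  by apply: (is_derive_eq h); ring.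
have -> : phi x = \int[leb]_(u in `[x, +oo[) (u * phi u).
  rewrite (@ge0_FTCy _ (fun u => - phi u) (fun u => u * phi u) x 0)//.
  - by rewrite sub0r opprK.
  - by move=> u xu; rewrite mulr_ge0 ?(le_trans x0 xu)// ltW// phi_gt0.
  - have h : (- phi u) @[u --> +oo] --> - (0 : R) by apply: cvgN; exact: phi_cvg0.
    by rewrite oppr0 in h.
rewrite -RintegralZl//; last exact: integrable_phi.
apply: le_Rintegral => //.
- have ip : leb.-integrable `[x, +oo[ (EFin \o phi) by exact: integrable_phi.
  by have := fun mD => integrableZl mD x ip; apply.
- apply: (integrableS measurableT _ (subsetT _)) => //.
  apply: (le_integrable measurableT _ _ (integrable_pow_phi 1)).
    by apply/measurable_EFinP; exact: continuous_measurable_fun.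
  by move=> u _ /=; rewrite lee_fin expr1 normrM [leRHS]normrM normr_id.
- move=> u /=; rewrite in_itv/= andbT => xu.
  by rewrite ler_wpM2r// ltW// phi_gt0.
Qed.

Section dominated.
Variable q : R -> R.
Hypotheses (cq : continuous q) (qphi : forall u, `|q u| <= phi u).

Lemma dominated_integrable (A : set (measurableTypeR R)) : measurable A -> leb.-integrable A (EFin \o q).
Proof.
move=> mA; apply: (integrableS measurableT mA (subsetT _)).
apply: (le_integrable measurableT _ _ (integrable_phi measurableT)).
  by apply/measurable_EFinP; exact: continuous_measurable_fun.
by move=> u _ /=; rewrite lee_fin (le_trans (qphi u))// ler_norm.
Qed.

Lemma dominated_le (A : set (measurableTypeR R)) : measurable A ->
  `|\int[leb]_(u in A) q u| <= \int[leb]_(u in A) phi u.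
Proof.
move=> mA; have iq := dominated_integrable mA.
have ip := integrable_phi mA.
apply: (le_trans (le_normr_Rintegral mA iq)).
apply: le_Rintegral => //; exact: integrable_norm.
Qed.

Lemma tail_right (x : R) : 0 <= x -> x * `|\int[leb]_(u in `[x, +oo[) q u| <= phi x.
Proof.
by move=> x0; rewrite (le_trans _ (mills x0))// ler_wpM2l// dominated_le.
Qed.

Lemma tail_left (x : R) : x <= 0 -> - x * `|\int[leb]_(u in `]-oo, x]) q u| <= phi x.
Proof.
move=> x0; have Nx0 : 0 <= - x by rewrite oppr_ge0.
rewrite -phi_sym (le_trans _ (mills Nx0))// ler_wpM2l//.
apply: (le_trans (dominated_le _)) => //.
rewrite /Rintegral -{1}(opprK x) ge0_integration_by_substitutionNy.
- rewrite le_eqVlt; apply/orP; left; apply/eqP; congr fine.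
  by apply: eq_integral => u _ /=; rewrite phi_sym.
- by apply: continuous_subspaceT; exact: phi_continuous.
- by move=> u _; exact: ltW (phi_gt0 _).
Qed.

End dominated.
End gaussian_tails.

Section stein.
Context {R : realType}.
Local Notation leb := (@lebesgue_measure R).
Local Notation gam := (normal_prob (0 : R) 1).
Local Notation phi := (normal_pdf (0 : R) 1).
Variables (h : R -> R) (M : R).
Hypotheses (h01 : forall x, 0 <= h x <= 1) (M0 : 0 <= M).
Hypothesis hM : forall x y, `|h x - h y| <= M * `|x - y|.

Lemma lip_continuous : continuous h.
Proof.
have M1 : 0 < M + 1 by have := M0; lra.
move=> x; apply/cvgrPdist_le => e e0; near=> y.
rewrite (le_trans (hM x y))//.
apply: (@le_trans _ _ ((M + 1) * `|x - y|)); first by rewrite ler_wpM2r// lerDl.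
rewrite mulrC -ler_pdivlMr//; near: y.
apply: cvgr_dist_le; [exact: cvg_id|exact: divr_gt0].
Unshelve. all: by end_near. Qed.

Let m := \int[gam]_x h x.

Let mh : measurable_fun setT h.
Proof. exact: continuous_measurable_fun lip_continuous. Qed.

Lemma bounded_integrable : gam.-integrable setT (EFin \o h).
Proof.
have i1 : gam.-integrable setT (EFin \o (fun _ : R => 1 : R)).
  by apply: finite_measure_integrable_cst.
apply: (le_integrable measurableT _ _ i1); first exact/measurable_EFinP.
move=> x _ /=; rewrite lee_fin normr1 ger0_norm; by have /andP[] := h01 x.
Qed.

Lemma normal_mean01 : 0 <= m <= 1.
Proof.
have i1 : gam.-integrable setT (EFin \o (fun _ : R => 1 : R)).
  by apply: finite_measure_integrable_cst.
apply/andP; split; first by apply: Rintegral_ge0 => x _; have /andP[] := h01 x.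
have -> : 1 = \int[gam]_x (1 : R).
  rewrite Rintegral_cst// mul1r; symmetry; exact: (congr1 fine (probability_setT gam)).
apply: le_Rintegral => //; first exact: bounded_integrable.
by move=> x _; have /andP[] := h01 x.
Qed.

Let q (u : R) := (h u - m) * phi u.

Let cq : continuous q.
Proof.
move=> u; apply: cvgM; last exact: phi_continuous.
by apply: cvgB; [exact: lip_continuous|exact: cvg_cst].
Qed.

Let hm1 u : `|h u - m| <= 1.
Proof.
by have /andP[a b] := h01 u; have /andP[c d] := normal_mean01; rewrite ler_norml; lra.
Qed.

Let qphi u : `|q u| <= phi u.
Proof. by rewrite normrM (ger0_norm (ltW (phi_gt0 u))) ler_piMl// ltW// phi_gt0. Qed.

Let q0 : \int[leb]_u q u = 0.
Proof.
have ih : leb.-integrable setT (EFin \o (fun u => h u * phi u)).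
  apply: dominated_integrable => // u.
    by apply: cvgM; [exact: lip_continuous|exact: phi_continuous].
  have /andP[a b] := h01 u.
  by rewrite normrM (ger0_norm (ltW (phi_gt0 u))) ger0_norm// ler_piMl// ltW// phi_gt0.
have ip : leb.-integrable setT (EFin \o phi) by exact: integrable_phi.
have imp : leb.-integrable setT (EFin \o (fun u => m * phi u)).
  by have := fun mD => integrableZl mD m ip; apply.
have -> : \int[leb]_u q u = \int[leb]_u (h u * phi u - m * phi u).
  by apply: eq_Rintegral => u _; rewrite /q mulrBl.
rewrite RintegralB// RintegralZl//.
have -> : \int[leb]_u phi u = 1 by exact: (congr1 fine (integral_normal_pdf 0 1)).
have -> : \int[leb]_u (h u * phi u) = m.
  rewrite /m /Rintegral; congr fine; symmetry.
  apply: (etrans (ge0_integral_normal _ _)).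
  - exact/measurable_EFinP.
  - by move=> x; rewrite lee_fin; have /andP[] := h01 x.
  - by apply: eq_integral => u _; rewrite EFinM.
by rewrite mulr1 subrr.
Qed.

(* the integral of q over R is 0, so H is controlled by both tails *)
Let H (x : R) := \int[leb]_(u in `]-oo, x]) q u.

Let H_right x : H x = - \int[leb]_(u in `[x, +oo[) q u.
Proof.
have iq (A : set (measurableTypeR R)) : measurable A -> leb.-integrable A (EFin \o q).
  exact: dominated_integrable.
have := @Rintegral_itvB R q -oo%O +oo%O x (iq _ (measurable_itv `]-oo, +oo[)) isT isT.
rewrite set_itvNyy q0 sub0r Rintegral_itv_obnd_cbnd; last exact: iq.
by move=> <-; rewrite opprK.
Qed.

Let H_le x : `|x * H x| <= phi x.
Proof.
rewrite normrM; have [x0|x0] := leP 0 x.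
  by rewrite H_right normrN (ger0_norm x0); exact: tail_right.
by rewrite ltr0_norm//; apply: tail_left => //; exact: ltW.
Qed.

Let dH (x : R) : is_derive x 1 H (q x).
Proof.
have xx : x < x + 1 by rewrite ltrDl.
have iq : leb.-integrable [set` Interval -oo%O (BRight (x + 1))] (EFin \o q).
  exact: dominated_integrable.
have [d1 d2] := @continuous_FTC1 _ q -oo%O x (x + 1) xx iq (ltNyr _) (@cq x).
by apply: DeriveDef; [exact: d1|rewrite -derive1E; exact: d2].
Qed.

(** The bounded solution of Stein's equation f' x = x f x + h x - m. *)
Definition stein_sol (x : R) := H x * (phi x)^-1.
Definition stein_der (x : R) := x * stein_sol x + h x - m.

Lemma stein_derive (x : R) : is_derive x 1 stein_sol (stein_der x).
Proof.
have c0 : (0 : R) < normal_peak 1 by apply: normal_peak_gt0; exact: oner_neq0.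
pose w (x : R) := (normal_peak 1)^-1 * expR (x * x / 2).
have wE y : (phi y)^-1 = w y.
  by rewrite normal_pdf01 invfM -expRN mulNr opprK expr2.
have dw : is_derive x 1 w (x * w x).
  have d1 := derivRM (derivRM (derivR_id x) (derivR_id x)) (derivR_cst (2^-1) x).
  have d2 := derivR_comp (g := fun y : R => y * y / 2) (is_derive_expR (x * x / 2)) d1.
  have d3 := derivRM (derivR_cst (normal_peak 1)^-1 x) d2.
  by apply: (is_derive_eq d3); rewrite /w; field; rewrite gt_eqF.
rewrite (_ : stein_sol = fun y => H y * w y); last by apply/funext => y; rewrite /stein_sol wE.
apply: (is_derive_eq (derivRM (dH x) dw)).
rewrite /stein_der /stein_sol wE /q -wE mulfK ?gt_eqF ?phi_gt0//; ring.
Qed.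

Lemma stein_sol_le x : `|x * stein_sol x| <= 1.
Proof.
rewrite /stein_sol mulrA normrM normfV (gtr0_norm (phi_gt0 x)) ler_pdivrMr ?phi_gt0//.
by rewrite mul1r H_le.
Qed.

Lemma stein_der_le x : `|stein_der x| <= 2.
Proof.
rewrite /stein_der -addrA (le_trans (ler_normD _ _))//.
by rewrite (_ : 2 = 1 + 1)// lerD// stein_sol_le.
Qed.

Lemma stein_sol_MVT x y :
  exists2 z, `|z - x| <= `|y - x| & stein_sol y - stein_sol x = stein_der z * (y - x).
Proof.
have dS z : - (`|x| + `|y| + 1) < z -> is_derive z 1 stein_sol (stein_der z).
  by move=> _; exact: stein_derive.
have x1 : - x <= `|x| by rewrite -normrN ler_norm.
have y1 : - y <= `|y| by rewrite -normrN ler_norm.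
have x0 := normr_ge0 x; have y0 := normr_ge0 y.
by apply: MVT_gt dS; lra.
Qed.

Lemma stein_sol_lip x y : `|stein_sol x - stein_sol y| <= 2 * `|x - y|.
Proof.
have [z _ ->] := stein_sol_MVT y x; rewrite normrM ler_wpM2r//; exact: stein_der_le.
Qed.

Lemma stein_der_lip : exists2 c : R, 0 <= c & forall x y,
  `|stein_der x - stein_der y| <= c * (1 + `|x| + `|y|) * `|x - y|.
Proof.
exists (`|stein_sol 0| + M + 2); first by rewrite !addr_ge0.
move=> x y.
rewrite (_ : _ - _ = stein_sol x * (x - y) + y * (stein_sol x - stein_sol y) + (h x - h y));
  last by rewrite /stein_der; ring.
rewrite (le_trans (ler_normD _ _))// (le_trans (lerD (ler_normD _ _) (hM x y)))//.
rewrite [`|_ * (x - y)|]normrM [`|y * _|]normrM.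
have s1 : `|stein_sol x| <= `|stein_sol 0| + 2 * `|x|.
  rewrite -(subrK (stein_sol 0) (stein_sol x)) addrC (le_trans (ler_normD _ _))// lerD2l.
  by have := stein_sol_lip x 0; rewrite subr0.
have s2 : `|y| * `|stein_sol x - stein_sol y| <= `|y| * 2 * `|x - y|.
  by rewrite -mulrA ler_wpM2l// stein_sol_lip.
have s3 : `|stein_sol x| * `|x - y| <= (`|stein_sol 0| + 2 * `|x|) * `|x - y|.
  by rewrite ler_wpM2r.
apply: (le_trans (lerD (lerD s3 s2) (lexx _))); rewrite -!mulrDl ler_wpM2r//.
have : 0 <= (`|stein_sol 0| + M) * (`|x| + `|y|) by rewrite mulr_ge0 ?addr_ge0.
have := M0; lra.
Qed.

Lemma stein_taylor : exists2 c : R, 0 <= c & forall x y,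
  `|stein_sol y - stein_sol x - stein_der x * (y - x)| <=
  c * (1 + `|x| + `|y|) * (y - x) ^+ 2.
Proof.
have [c c0 hc] := stein_der_lip; exists (3 * c); first by rewrite mulr_ge0.
move=> x y; have [z zx ->] := stein_sol_MVT x y.
rewrite -mulrBl normrM -(real_normK (num_real (y - x))) expr2 mulrA ler_wpM2r//.
rewrite (le_trans (hc z x))//; apply: ler_pM => //; first by rewrite mulr_ge0// !addr_ge0.
rewrite (_ : 3 * c * _ = c * (3 * (1 + `|x| + `|y|))); last by ring.
rewrite ler_wpM2l//.
have : `|z| <= `|x| + `|y - x|.
  by rewrite -{1}(subrK x z) addrC (le_trans (ler_normD _ _))// lerD2l.
have := ler_normB y x; have := normr_ge0 x; have := normr_ge0 y; lra.
Qed.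

End stein.


(** * Chain rules *)

Section composition.
Context {R : realType} {n : nat}.
Implicit Types (g : 'rV[R]_n -> R) (x y : 'rV[R]_n).

Lemma tame_comp1 g (f : R -> R) (c : R) : 0 <= c ->
  (forall a b : R, `|f a - f b| <= c * (1 + `|a| + `|b|) * `|a - b|) ->
  tame g -> tame (fun x => f (g x)).
Proof.
move=> c0 hf tg; have [D D0 [l gD]] := tame_polybd tg; have [C C0 [k gC]] := tg.
exists (c * (1 + D + D) * C); first by rewrite !mulr_ge0// !addr_ge0.
exists (l + k)%N => x y; rewrite (le_trans (hf _ _))// exprD.
rewrite (_ : c * (1 + D + D) * C * _ * _ =
  c * ((1 + D + D) * (wt x * wt y) ^+ l) * (C * (wt x * wt y) ^+ k * enorm (x - y))); last by ring.
apply: ler_pM => //; first by rewrite mulr_ge0// !addr_ge0.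
rewrite ler_wpM2l// !mulrDl mul1r.
have w1 := wtMX_homo x y (leq0n l); rewrite expr0 in w1.
have b u : wt u <= wt x * wt y -> `|g u| <= D * (wt x * wt y) ^+ l.
  move=> hu; rewrite (le_trans (gD _))// ler_wpM2l//; apply: lerXn2r; rewrite ?nnegrE ?wt_ge0//.
  exact: le_trans (wt_ge0 _) hu.
rewrite lerD ?b//; last by rewrite mulrC wt_le_wtM.
by rewrite lerD ?b// wt_le_wtM.
Qed.

Lemma taylor_affine g V (a b : R) : taylor g V -> taylor (fun x => (g x - a) / b) (fun x => b^-1 *: V x).
Proof.
move=> [C C0 [k gV]]; exists (`|b^-1| * C); first by rewrite mulr_ge0.
exists k => x y.
rewrite (_ : _ - _ = b^-1 * (g y - g x - dot (V x) (y - x))); last by rewrite dotZl; ring.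
by rewrite normrM -2!mulrA ler_wpM2l// mulrA.
Qed.

Lemma taylor_comp g V (f f' : R -> R) (c B : R) : 0 <= c -> 0 <= B ->
  (forall a, `|f' a| <= B) ->
  (forall a b, `|f b - f a - f' a * (b - a)| <= c * (1 + `|a| + `|b|) * (b - a) ^+ 2) ->
  tame g -> taylor g V -> taylor (fun x => f (g x)) (fun x => f' (g x) *: V x).
Proof.
move=> c0 B0 fB hf tg [E E0 [m gV]].
have [D D0 [l gD]] := tame_polybd tg; have [C C0 [k gC]] := tg.
exists (c * (1 + D + D) * C ^+ 2 + B * E).
  by rewrite addr_ge0 ?mulr_ge0 ?addr_ge0// exprn_ge0.
exists (l + (k + k) + m)%N => x y.
set a := g x; set b := g y; set W := wt x * wt y; set e := enorm (y - x).
have W1 : 1 <= W := wtM_ge1 x y.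
rewrite (_ : _ - _ = (f b - f a - f' a * (b - a)) + f' a * (b - a - dot (V x) (y - x))); last first.
  by rewrite dotZl; ring.
rewrite (le_trans (ler_normD _ _))// mulrDl mulrDl; apply: lerD; last first.
  rewrite normrM -mulrA -mulrA; apply: ler_pM => //.
  rewrite (le_trans (gV _ _))// -/W -/e -mulrA ler_wpM2l// ler_wpM2r ?sqr_ge0//.
  by rewrite ler_weXn2l// leq_addl.
rewrite (le_trans (hf _ _))//.
have h1 : 1 + `|a| + `|b| <= (1 + D + D) * W ^+ l.
  rewrite !mulrDl mul1r.
  have bd u : wt u <= W -> `|g u| <= D * W ^+ l.
    move=> hu; rewrite (le_trans (gD _))// ler_wpM2l//; apply: lerXn2r; rewrite ?nnegrE ?wt_ge0//.
    exact: le_trans (wt_ge0 _) hu.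
  rewrite lerD ?bd//; last by rewrite /W mulrC wt_le_wtM.
  by rewrite lerD ?bd// ?wt_le_wtM// exprn_ege1.
have h2 : (b - a) ^+ 2 <= (C * W ^+ k * e) ^+ 2.
  rewrite -(real_normK (num_real (b - a))); apply: lerXn2r; rewrite ?nnegrE//.
    by rewrite mulr_ge0 ?enorm_ge0// mulr_ge0// exprn_ge0// (le_trans ler01).
  by rewrite /b /a (le_trans (gC _ _))// /W [wt y * _]mulrC.
apply: (@le_trans _ _ (c * ((1 + D + D) * W ^+ l) * (C * W ^+ k * e) ^+ 2)).
  by apply: ler_pM; rewrite ?sqr_ge0 ?mulr_ge0 ?addr_ge0// ler_wpM2l.
rewrite (_ : c * _ * _ = c * (1 + D + D) * C ^+ 2 * (W ^+ (l + (k + k)) * e ^+ 2)); last first.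
  by rewrite !exprD; ring.
rewrite -[leRHS]mulrA ler_wpM2l ?mulr_ge0 ?addr_ge0 ?exprn_ge0// ler_wpM2r ?sqr_ge0//.
by rewrite ler_weXn2l// leq_addr.
Qed.

Lemma enorm_linB (c s : R) (z z' : 'rV[R]_(n + n)) : c ^+ 2 + s ^+ 2 = 1 ->
  enorm (lin c s z - lin c s z') <= enorm (z - z').
Proof.
move=> cs; rewrite ler_enorm (dot_lr (z - z')).
have -> : lin c s z - lin c s z' = c *: lsubmx (z - z') + s *: rsubmx (z - z').
  by apply/rowP => i; rewrite !mxE; ring.
set u := lsubmx _; set v := rsubmx _.
have := dot_ge0 (s *: u - c *: v); rewrite !dotE (dotC v u) => h.
have -> : dot u u + dot v v = (c ^+ 2 + s ^+ 2) * (dot u u + dot v v) by rewrite cs mul1r.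
by move: h; lra.
Qed.

End composition.


(** * Normal approximation of |Pi x|^2 *)

Section chi_bar_square.
Context {R : realType} {n : nat}.
(** The projection onto a closed convex cone enters through these four
    properties only. *)
Variable Pi : 'rV[R]_n -> 'rV[R]_n.
Hypothesis dot_PiE : forall x, dot x (Pi x) = dot (Pi x) (Pi x).
Hypothesis dot_Pi_ge : forall x y, dot y (Pi x) <= dot (Pi y) (Pi x).
Hypothesis Pi_lip : forall x y, enorm (Pi x - Pi y) <= enorm (x - y).
Hypothesis Pi_taylor : forall x y,
  `|dot (Pi y) (Pi y) - dot (Pi x) (Pi x) - dot (2 *: Pi x) (y - x)| <= 2 * enorm (y - x) ^+ 2.
Context d (Omega : measurableType d) (P : probability Omega R).
Variable (xi : Omega -> 'rV[R]_n).
Hypothesis gxi : standard_gaussian P xi.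
Local Notation E := (gE P xi).
Local Notation E2 := (gE (P2 P) (xi2 xi)).

Definition projsq (x : 'rV[R]_n) : R := dot (Pi x) (Pi x).
Local Notation F := projsq.
Let G (x : 'rV[R]_n) : 'rV[R]_n := 2 *: Pi x.

Let tPi : tamev (fun x : 'rV[R]_n => Pi x).
Proof. by apply: (@tamev_lip _ _ _ _ 1) => x y; rewrite mul1r; exact: Pi_lip. Qed.

Lemma tame_projsq : tame F.
Proof. exact: tame_dot. Qed.
Let tF := tame_projsq.

Let tG : tamev G.
Proof. exact: tamevZc. Qed.

Let FG : taylor F G.
Proof. by exists 2 => //; exists 0 => x y; rewrite expr0 mulr1; exact: Pi_taylor. Qed.

Let G_lip x y : enorm (G x - G y) <= 2 * enorm (x - y).
Proof. by rewrite /G -scalerBr enormZ ger0_norm// ler_wpM2l// Pi_lip. Qed.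

Let delta := E F.
Let var := E (fun x => F x ^+ 2) - delta ^+ 2.

Let delta_ge0 : 0 <= delta.
Proof. by apply: gE_ge0 => x; exact: dot_ge0. Qed.

Let EG2 : E (fun x => enorm (G x) ^+ 2) = 4 * delta.
Proof.
rewrite -(gEZ gxi)//; apply: gE_eq => x.
by rewrite /G enormZ exprMn enorm2 ger0_norm// -natrX.
Qed.

Let g2 := gaussian_xi2 gxi.

(** [Pi x] is the nearest point of the cone, so [<Pi u, Pi x> >= <u, Pi x>],
    and the mean of the latter is [c * E |Pi x|^2] when [u = c x + s y]. *)
Lemma dot_proj_rotate_ge (c s : R) : 0 < c -> c ^+ 2 + s ^+ 2 = 1 ->
  c * delta <= E2 (fun z => dot (Pi (lin c s z)) (Pi (lsubmx z))).
Proof.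
move=> c0 cs.
have tPl : tamev (fun z : 'rV[R]_(n + n) => Pi (lsubmx z)).
  by apply: (tamev_comp tPi); exact: tamev_lsubmx.
have tPc : tamev (fun z => Pi (lin c s z)) by apply: (tamev_comp tPi); exact: tamev_lin.
have t1 : tame (fun z : 'rV[R]_(n + n) => dot (lsubmx z) (Pi (lsubmx z))).
  by apply: tame_dot => //; exact: tamev_lsubmx.
have t2 : tame (fun z : 'rV[R]_(n + n) => dot (rsubmx z) (Pi (lsubmx z))).
  by apply: tame_dot => //; exact: tamev_rsubmx.
have e1 : E2 (fun z => dot (lsubmx z) (Pi (lsubmx z))) = delta.
  rewrite /delta -(gE2_l gxi tF); apply: gE_eq => z; exact: dot_PiE.
have e2 : E2 (fun z => dot (rsubmx z) (Pi (lsubmx z))) = 0.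
  have ti i : tame (fun x : 'rV[R]_n => Pi x ord0 i) by exact: tPi.
  have tc i : tame (fun x : 'rV[R]_n => x ord0 i) by exact: tame_coord.
  transitivity (E2 (fun z => \sum_(i < n) Pi (lsubmx z) ord0 i * rsubmx z ord0 i)).
    by apply: gE_eq => z; apply: eq_bigr => i _; rewrite mulrC.
  rewrite (gE_sum g2); last by move=> i; apply: tameM; [exact: tame_l (ti i)|exact: tame_r (tc i)].
  by apply: big1 => i _; rewrite (gE2_prod gxi (ti i) (tc i)) (gE_coord gxi) mulr0.
have -> : c * delta = E2 (fun z => dot (lin c s z) (Pi (lsubmx z))).
  transitivity (c * E2 (fun z => dot (lsubmx z) (Pi (lsubmx z))) +
                s * E2 (fun z => dot (rsubmx z) (Pi (lsubmx z)))).
    by rewrite e1 e2 mulr0 addr0.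
  rewrite -!(gEZ g2)// -(gED g2); [|exact: tameZ..].
  by apply: gE_eq => z; rewrite /lin !dotE.
apply: (gE_le g2); [by apply: tame_dot => //; exact: tamev_lin|exact: tame_dot|].
by move=> z; exact: dot_Pi_ge.
Qed.

(** The covariance formula with p = F, where <G u, G x> = 4 <Pi u, Pi x>. *)
Lemma var_ge : 2 * delta <= var.
Proof.
have [K K0 hK] := covariance_formula gxi tF tG FG tF tG FG.
apply: (le_of_le_divn K0) => N N2; have N0 : (0 < N)%N by exact: leq_trans N2.
have := hK N N2; rewrite ler_norml => /andP[+ _].
have -> : E (fun x => F x * F x) - E F * E F = var.
  by rewrite /var expr2; congr (_ - _); apply: gE_eq => x; rewrite expr2.
set S := \sum_(k < N) _ => h; suff : 2 * delta <= S by lra.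
apply: (@le_trans _ _ (\sum_(k < N) weight N k * (4 * (cos (angle N k) * delta)))).
  have hc := @sum_weight_cos R N N0.
  rewrite (_ : \sum_(k < N) _ = 4 * delta * \sum_(k < N) weight N k * cos (angle N k)); last first.
    by rewrite mulr_sumr; apply: eq_bigr => k _; ring.
  have := ler_wpM2l (mulr_ge0 (ler0n R 4) delta_ge0) hc; lra.
apply: ler_sum => k _; rewrite ler_wpM2l ?weight_ge0//.
have c0 := @cos_angle_gt0 R _ _ (ltn_ord k).
have := dot_proj_rotate_ge c0 (cos2Dsin2 _) => hc.
rewrite (le_trans (ler_wpM2l _ hc))//.
rewrite -(gEZ g2); last first.
  apply: tame_dot; apply: (tamev_comp tPi); [exact: tamev_lin|exact: tamev_lsubmx].
rewrite le_eqVlt; apply/orP; left; apply/eqP; apply: gE_eq => z.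
by rewrite /G dotZl dotZr; ring.
Qed.

Section kernel.
Variable N : nat.
Hypothesis N2 : (2 <= N)%N.
Let N0 : (0 < N)%N. Proof. exact: leq_trans N2. Qed.

Local Notation rot k := (lin (cos (angle N k)) (sin (angle N k))).

(** The Stein kernel of |Pi x|^2, discretized, before averaging over the
    independent copy. *)
Definition stein_kernel (z : 'rV[R]_(n + n)) : R :=
  \sum_(k < N) weight N k * dot (G (rot k z)) (G (lsubmx z)).
Local Notation tau := stein_kernel.

Let tGl : tamev (fun z : 'rV[R]_(n + n) => G (lsubmx z)).
Proof. by apply: (tamev_comp tG); exact: tamev_lsubmx. Qed.

Let tGr k : tamev (fun z => G (rot k z)).
Proof. by apply: (tamev_comp tG); exact: tamev_lin. Qed.

Let td k : tame (fun z => dot (G (rot k z)) (G (lsubmx z))).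
Proof. exact: tame_dot. Qed.

Lemma tame_stein_kernel : tame tau.
Proof. by apply: tame_sum => k; apply: tameZ; exact: td. Qed.

Let L (z : 'rV[R]_(n + n)) : R :=
  \sum_(k < N) weight N k * (2 * (enorm (G (lsubmx z)) + enorm (G (rot k z)))).

Let L_ge0 z : 0 <= L z.
Proof.
by apply: sumr_ge0 => k _; rewrite mulr_ge0 ?weight_ge0// mulr_ge0// addr_ge0 ?enorm_ge0.
Qed.

Let G_norm_lip m (z z' : 'rV[R]_m) (f : 'rV[R]_m -> 'rV[R]_n) :
  enorm (f z - f z') <= enorm (z - z') ->
  enorm (G (f z) - G (f z')) <= 2 * enorm (z - z').
Proof. by move=> h; rewrite (le_trans (G_lip _ _))// ler_wpM2l. Qed.

Let norm_lip m (u v : 'rV[R]_m) : `|enorm u - enorm v| <= enorm (u - v).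
Proof.
have h1 := enorm_triangle v u 0; have h2 := enorm_triangle u v 0.
by move: h1 h2; rewrite !subr0 (enormBC v u) ler_norml; lra.
Qed.

Let rot_lip k (z z' : 'rV[R]_(n + n)) : enorm (rot k z - rot k z' : 'rV[R]_n) <= enorm (z - z').
Proof. by apply: enorm_linB; exact: cos2Dsin2. Qed.

Let l_lip (z z' : 'rV[R]_(n + n)) : enorm (lsubmx z - lsubmx z' : 'rV[R]_n) <= enorm (z - z').
Proof.
rewrite (_ : lsubmx z - lsubmx z' = lsubmx (z - z')); first exact: enorm_lsubmx_le.
by apply/rowP => i; rewrite !mxE.
Qed.

Let wsum (a : R) : a = \sum_(k < N) weight N k * a.
Proof. by rewrite -mulr_suml sum_weight// mul1r. Qed.

Let norm_pair_lip (a b a' b' e : R) : `|a - a'| <= 2 * e -> `|b - b'| <= 2 * e ->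
  2 * `|a + b - (a' + b')| <= 8 * e.
Proof.
move=> h1 h2; have := ler_normD (a - a') (b - b').
rewrite (_ : a - a' + (b - b') = a + b - (a' + b')); last by ring.
lra.
Qed.

Let dot_pair_lip (u v u' v' : 'rV[R]_n) (e : R) : enorm (u - u') <= 2 * e -> enorm (v - v') <= 2 * e ->
  `|dot u v - dot u' v'| <= (2 * (enorm v + enorm u) + 8 * e) * e.
Proof.
move=> h1 h2; have e0 : 0 <= e by have := enorm_ge0 (u - u'); lra.
rewrite (_ : dot u v - dot u' v' = dot (u - u') v + dot u' (v - v')); last by rewrite !dotE; ring.
have h3 : enorm u' <= enorm u + 2 * e.
  by have := enorm_triangle u u' 0; rewrite !subr0 (enormBC u' u); lra.
rewrite (le_trans (ler_normD _ _))//.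
rewrite (le_trans (lerD (cauchy_schwarz _ _) (cauchy_schwarz _ _)))//.
have k1 : enorm (u - u') * enorm v <= 2 * e * enorm v by rewrite ler_wpM2r ?enorm_ge0.
have k2 : enorm u' * enorm (v - v') <= (enorm u + 2 * e) * (2 * e) by rewrite ler_pM ?enorm_ge0.
have := sqr_ge0 e; lra.
Qed.

Let L_lip z z' : `|L z - L z'| <= 8 * enorm (z - z').
Proof.
rewrite /L -sumrB (le_trans (ler_norm_sum _ _ _))//.
rewrite [leRHS]wsum; apply: ler_sum => k _.
rewrite -mulrBr normrM ger0_norm ?weight_ge0// ler_wpM2l ?weight_ge0//.
rewrite -mulrBr normrM ger0_norm//.
by apply: norm_pair_lip; rewrite (le_trans (norm_lip _ _))//;
  [apply: (@G_norm_lip _ z z' (fun z => lsubmx z)); exact: l_lip|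
   apply: (@G_norm_lip _ z z' (rot k)); exact: rot_lip].
Qed.

Let tau_loclip : loclip L 8 0 tau.
Proof.
move=> z z'; rewrite /stein_kernel -sumrB (le_trans (ler_norm_sum _ _ _))//.
rewrite addr0 /L [8 * _]wsum -big_split/= mulr_suml; apply: ler_sum => k _.
rewrite -mulrBr normrM ger0_norm ?weight_ge0// -mulrDr -mulrA ler_wpM2l ?weight_ge0//.
by apply: dot_pair_lip; [apply: (@G_norm_lip _ z z' (rot k)); exact: rot_lip|
  apply: (@G_norm_lip _ z z' (fun z => lsubmx z)); exact: l_lip].
Qed.

(** Poincare in dimension 2n: the local Lipschitz constant of the kernel is an
    average of 2 (|G x| + |G u|), where u has the law of x and E |G|^2 = 4 delta,
    hence 64 = 4 * 4 * 4. *)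
Lemma var_stein_kernel : E2 (fun z => tau z ^+ 2) - E2 tau ^+ 2 <= 64 * delta.
Proof.
apply: (le_trans (poincare_loclip (_ : 0 <= 8) L_ge0 L_lip g2 tau_loclip)) => //.
have tn : tame (fun z : 'rV[R]_(n + n) => enorm (G (lsubmx z)) ^+ 2).
  by apply: tameX; exact: tame_enormv.
have tk k : tame (fun z => enorm (G (rot k z)) ^+ 2) by apply: tameX; exact: tame_enormv.
have tnk k := tameZ 8 (tameD tn (tk k)).
apply: (@le_trans _ _ (E2 (fun z => \sum_(k < N) weight N k *
    (8 * (enorm (G (lsubmx z)) ^+ 2 + enorm (G (rot k z)) ^+ 2))))).
  apply: (gE_le g2).
  - by apply: tameX; exact: tame_lip L_lip.
  - by apply: tame_sum => k; apply: tameZ; exact: tnk.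
  - move=> z; set l := L z.
    have -> : l ^+ 2 = \sum_(k < N) weight N k * (2 * l *
        (2 * (enorm (G (lsubmx z)) + enorm (G (rot k z)))) - l ^+ 2).
      under eq_bigr do rewrite mulrBr mulrCA.
      by rewrite sumrB -mulr_sumr -/(L z) -/l -mulr_suml (@sum_weight R N N0); ring.
    apply: ler_sum => k _; rewrite ler_wpM2l ?weight_ge0//.
    set a := enorm _; set b := enorm _.
    have := sqr_ge0 (l - 2 * (a + b)); have := sqr_ge0 (a - b); lra.
rewrite (gE_sum g2); last by move=> k; apply: tameZ; exact: tnk.
rewrite [leRHS]wsum; apply: ler_sum => k _.
have tG2 : tame (fun x => enorm (G x) ^+ 2) by apply: tameX; exact: tame_enormv.
have e1 : E2 (fun z => enorm (G (lsubmx z)) ^+ 2) = 4 * delta.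
  by rewrite -EG2; exact: (gE2_l gxi tG2).
have e2 : E2 (fun z => enorm (G (rot k z)) ^+ 2) = 4 * delta.
  by rewrite -EG2; exact: (gE2_lin gxi (@cos_angle_gt0 R _ _ (ltn_ord k)) (cos2Dsin2 _) tG2).
rewrite (gEZ g2 _ (tnk k)) ler_wpM2l ?weight_ge0// (gEZ g2 _ (tameD tn (tk k))).
rewrite (gED g2 tn (tk k)) e1 e2; lra.
Qed.

(* E tau = var up to the discretization error kap *)
Lemma stein_kernel_L1 (kap : R) (f : 'rV[R]_n -> R) : 0 <= kap -> tame f -> (forall x, `|f x| <= 2) ->
  `|var - E2 tau| <= kap ->
  `|E2 (fun z => f (lsubmx z) * (var - tau z))| <= 2 * (8 * Num.sqrt delta + kap).
Proof.
move=> kap0 tf f2 hkap; have tt := tame_stein_kernel.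
have tc : tame (fun _ : 'rV[R]_(n + n) => var) by exact: tame_cst.
have tX := tameB tc tt.
rewrite (le_trans (gE_abs_sqr g2 _))//; first by apply: tameM => //; exact: tame_l.
rewrite -[leRHS]ger0_norm -?sqrtr_sqr; last first.
  by rewrite mulr_ge0// addr_ge0// mulr_ge0// sqrtr_ge0.
rewrite ler_sqrt ?sqr_ge0//.
apply: (@le_trans _ _ (E2 (fun z => 4 * (var - tau z) ^+ 2))).
  apply: (gE_le g2).
  - by apply: tameX; apply: tameM => //; exact: tame_l.
  - by apply: tameZ; exact: tameX.
  - move=> z; rewrite exprMn ler_wpM2r ?sqr_ge0// -real_normK ?num_real//.
    by rewrite (_ : 4 = 2 ^+ 2) ?lerXn2r ?nnegrE// -natrX.
rewrite (gEZ g2); last exact: tameX.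
have -> : E2 (fun z => (var - tau z) ^+ 2) =
    (E2 (fun z => tau z ^+ 2) - E2 tau ^+ 2) + (var - E2 tau) ^+ 2.
  have t2 := tameX 2 tt; have tm := tameZ (2 * var) tt.
  have tc2 : tame (fun _ : 'rV[R]_(n + n) => var ^+ 2) by exact: tame_cst.
  transitivity (E2 (fun z => var ^+ 2 - 2 * var * tau z + tau z ^+ 2)).
    by apply: gE_eq => z; ring.
  rewrite (gED g2)//; last exact: tameB.
  by rewrite (gEB g2)// (gEZ g2)// gE_cst; ring.
have h := var_stein_kernel.
have : (var - E2 tau) ^+ 2 <= kap ^+ 2.
  by rewrite -real_normK ?num_real//; apply: lerXn2r; rewrite ?nnegrE.
have := sqr_sqrtr delta_ge0; have := sqrtr_ge0 delta; set r := Num.sqrt delta => r0 rr.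
have := mulr_ge0 r0 kap0; lra.
Qed.

End kernel.
(** For [V] a multiple of the gradient of [F], the covariance formula only
    involves the Stein kernel. *)
Lemma covariance_stein_kernel (p b : 'rV[R]_n -> R) : tame p -> tame b ->
  taylor p (fun x => b x *: G x) ->
  exists2 K : R, 0 <= K & forall N, (2 <= N)%N ->
    `|E (fun x => F x * p x) - delta * E p - E2 (fun z => b (lsubmx z) * stein_kernel N z)| <= K / N%:R.
Proof.
move=> tp tb pV; have tV : tamev (fun x => b x *: G x) by exact: tamevZ.
have [K K0 hK] := covariance_formula gxi tF tG FG tp tV pV.
exists K => // N N2; have := hK N N2.
have tGl : tamev (fun z : 'rV[R]_(n + n) => G (lsubmx z)).
  by apply: (tamev_comp tG); exact: tamev_lsubmx.
have tGr k : tamev (fun z => G (lin (cos (angle N k)) (sin (angle N k)) z)).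
  by apply: (tamev_comp tG); exact: tamev_lin.
have td k : tame (fun z => b (lsubmx z) * dot (G (lin (cos (angle N k)) (sin (angle N k)) z)) (G (lsubmx z))).
  by apply: tameM; [exact: tame_l|exact: tame_dot].
have -> // : E2 (fun z => b (lsubmx z) * stein_kernel N z) = \sum_(k < N) weight N k *
     E2 (fun z => dot (G (lin (cos (angle N k)) (sin (angle N k)) z)) (b (lsubmx z) *: G (lsubmx z))).
transitivity (E2 (fun z => \sum_(k < N) weight N k *
    (b (lsubmx z) * dot (G (lin (cos (angle N k)) (sin (angle N k)) z)) (G (lsubmx z))))).
  by apply: gE_eq => z; rewrite /stein_kernel mulr_sumr; apply: eq_bigr => k _; rewrite mulrCA.
rewrite (gE_sum g2); last by move=> k; apply: tameZ; exact: td.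
apply: eq_bigr => k _; rewrite (gEZ g2 _ (td k)); congr (_ * _).
by apply: gE_eq => z; rewrite dotZr.
Qed.

(** With Z = (F - delta) / sigma and f the Stein solution for h,
      E h(Z) - m = E f'(Z) - E Z f(Z) = sigma^-2 E f'(Z) (sigma^2 - tau),
    where |f'| <= 2; then [var_stein_kernel] and [var_ge] give
    2 sigma^-2 * 8 sqrt delta <= 8 / sqrt delta. *)
Lemma stein_bound (h : R -> R) (M : R) :
  (forall x, 0 <= h x <= 1) -> 0 <= M -> (forall x y, `|h x - h y| <= M * `|x - y|) ->
  0 < delta ->
  `|E (fun x => h ((F x - delta) / Num.sqrt var)) - \int[normal_prob (0 : R) 1]_x h x|
  <= 8 / Num.sqrt delta.
Proof.
move=> h01 M0 hM d0; pose m := \int[normal_prob (0 : R) 1]_x h x; rewrite -/m.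
have v2 := var_ge; have v0 : 0 < var by lra.
pose s := Num.sqrt var; have s0 : 0 < s by rewrite sqrtr_gt0.
have ss : s ^+ 2 = var by rewrite sqr_sqrtr// ltW.
pose Z x := (F x - delta) / s.
have tZ : tame Z.
  rewrite (_ : Z = fun x => s^-1 * (F x - delta)); last by apply/funext => x; rewrite /Z mulrC.
  by apply: tameZ; apply: tameB => //; exact: tame_cst.
have ZG : taylor Z (fun x => s^-1 *: G x) := taylor_affine delta s FG.
pose f := stein_sol h; pose f' := stein_der h.
have th : tame (fun x => h (Z x)).
  apply: (@tame_comp1 _ _ _ h M M0) => // a b; rewrite (le_trans (hM a b))// ler_wpM2r//.
  by rewrite ler_peMr// -addrA lerDl addr_ge0.
have tf : tame (fun x => f (Z x)).
  apply: (@tame_comp1 _ _ _ f 2) => // a b.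
  rewrite (le_trans (stein_sol_lip h01 M0 hM a b))// ler_wpM2r//.
  by rewrite ler_peMr// -addrA lerDl addr_ge0.
have tf' : tame (fun x => f' (Z x)).
  by have [c c0 hc] := stein_der_lip h01 M0 hM; exact: (tame_comp1 c0 hc).
have [c c0 hc] := stein_taylor h01 M0 hM.
have fV : taylor (fun x => f (Z x)) (fun x => (f' (Z x) * s^-1) *: G x).
  have := taylor_comp c0 (ler0n R 2) (stein_der_le h01 M0 hM) hc tZ ZG.
  by congr taylor; apply/funext => x; rewrite scalerA.
have tb : tame (fun x => f' (Z x) * s^-1) by apply: tameM => //; exact: tame_cst.
have [K1 K10 hK1] := covariance_stein_kernel tf tb fV.
have t1 := @tame_cst R n 1.
have tFv : taylor F (fun x => (1 : R) *: G x).
  by move: FG; congr taylor; apply/funext => x; rewrite scale1r.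
have [K2 K20 hK2] := covariance_stein_kernel tF t1 tFv.
have s20 : 0 < s ^- 2 by rewrite invr_gt0 exprn_gt0.
(* f' = Z f + h - m *)
have stein : E (fun x => h (Z x)) - m =
    E (fun x => f' (Z x)) - s^-1 * (E (fun x => F x * f (Z x)) - delta * E (fun x => f (Z x))).
  have tFf : tame (fun x => F x * f (Z x)) by exact: tameM.
  have tdf := tameZ delta tf.
  rewrite -(gEZ gxi delta tf) -(gEB gxi tFf tdf) -(gEZ gxi _ (tameB tFf tdf)).
  rewrite -(gEB gxi tf' (tameZ _ (tameB tFf tdf))).
  rewrite -[in LHS](gE_cst P xi m) -(gEB gxi th (@tame_cst _ _ m)).
  by apply: gE_eq => x; rewrite /f' /stein_der -/f -/m /Z; ring.
apply: (@le_of_le_divn _ _ _ (2 * K2 * s ^- 2 + K1 * s^-1)).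
  by rewrite addr_ge0// mulr_ge0 ?invr_ge0 ?exprn_ge0 ?(ltW s0)// mulr_ge0.
move=> N N2; have NR : (0 : R) < N%:R by rewrite ltr0n (leq_trans _ N2).
have tt := tame_stein_kernel N.
have e2 : E2 (fun z => (1 : R) * stein_kernel N z) = E2 (stein_kernel N).
  by apply: gE_eq => z; rewrite mul1r.
have kap : `|var - E2 (stein_kernel N)| <= K2 / N%:R.
  have := hK2 N N2; rewrite e2 /var expr2.
  have -> : E (fun x => F x * F x) = E (fun x => F x ^+ 2) by apply: gE_eq => x; rewrite expr2.
  by [].
have kap0 : 0 <= K2 / N%:R by rewrite divr_ge0// ltW.
have L1 := @stein_kernel_L1 N N2 _ (fun x => f' (Z x)) kap0 tf' (fun x => stein_der_le h01 M0 hM _) kap.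
have t2 := tame_l tf'.
have tc : tame (fun _ : 'rV[R]_(n + n) => var) by exact: tame_cst.
pose A := E2 (fun z => f' (Z (lsubmx z)) * s^-1 * stein_kernel N z).
have dec : E (fun x => h (Z x)) - m =
    s ^- 2 * E2 (fun z => f' (Z (lsubmx z)) * (var - stein_kernel N z)) -
    s^-1 * (E (fun x => F x * f (Z x)) - delta * E (fun x => f (Z x)) - A).
  have tA : tame (fun z => f' (Z (lsubmx z)) * s^-1 * stein_kernel N z).
    by apply: tameM => //; exact: (tame_l tb).
  have tB : tame (fun z => f' (Z (lsubmx z)) * (var - stein_kernel N z)).
    by apply: tameM => //; exact: tameB.
  have Ef : E (fun x => f' (Z x)) =
      s ^- 2 * E2 (fun z => f' (Z (lsubmx z)) * (var - stein_kernel N z)) + s^-1 * A.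
    rewrite /A -(gEZ g2 _ tA) -(gEZ g2 _ tB) -(gED g2 (tameZ _ tB) (tameZ _ tA)).
    rewrite -(gE2_l gxi tf'); apply: gE_eq => z; rewrite -ss; field.
    by rewrite gt_eqF.
  by rewrite stein Ef; ring.
have sV0 : 0 < s^-1 by rewrite invr_gt0.
rewrite dec (le_trans (ler_normB _ _))// !normrM (gtr0_norm s20) (gtr0_norm sV0).
have := hK1 N N2; rewrite -/A => hA.
apply: (le_trans (lerD (ler_wpM2l (ltW s20) L1) (ler_wpM2l (ltW sV0) hA))).
set r := Num.sqrt delta; have r0 : 0 < r by rewrite sqrtr_gt0.
have rr : r ^+ 2 = delta by rewrite sqr_sqrtr// ltW.
have main : s ^- 2 * (16 * r) <= 8 / r.
  rewrite ss ler_pdivlMr// [leLHS](_ : _ = 16 * delta / var); last by rewrite -rr; ring.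
  by rewrite ler_pdivrMr//; lra.
have -> : s ^- 2 * (2 * (8 * r + K2 / N%:R)) + s^-1 * (K1 / N%:R) =
  s ^- 2 * (16 * r) + (2 * K2 * s ^- 2 + K1 * s^-1) / N%:R by ring.
by rewrite lerD2r.
Qed.


End chi_bar_square.


(** * Lipschitz approximation of Borel sets *)

Section lipschitz_approximation.
Context {R : realType}.
Local Notation T := (measurableTypeR R).

Definition lipschitz01 (h : R -> R) :=
  (forall x, 0 <= h x <= 1) /\
  exists2 M : R, 0 <= M & forall x y, `|h x - h y| <= M * `|x - y|.

Lemma lipschitz01_measurable h : lipschitz01 h -> measurable_fun [set: T] h.
Proof.
by move=> [_ [M M0 hM]]; apply: continuous_measurable_fun; exact: lip_continuous M0 hM.
Qed.

Lemma lipschitz01_onem h : lipschitz01 h -> lipschitz01 (fun x => 1 - h x).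
Proof.
move=> [h01 [M M0 hM]]; split=> [x|]; first by have := h01 x; lra.
exists M => // x y; rewrite (_ : _ - _ = - (h x - h y)); last by ring.
by rewrite normrN.
Qed.

Lemma lipschitz01_max h k : lipschitz01 h -> lipschitz01 k ->
  lipschitz01 (fun x => Num.max (h x) (k x)).
Proof.
move=> [h01 [M M0 hM]] [k01 [N N0 kN]]; split=> [x|].
  by have := h01 x; have := k01 x; case: (leP (h x) (k x)).
exists (M + N); first exact: addr_ge0.
move=> x y; rewrite mulrDl.
have := hM x y; have := kN x y; set u := M * _; set v := N * _.
rewrite !ler_norml; case: (leP (h x) (k x)); case: (leP (h y) (k y)); lra.
Qed.

Lemma lipschitz01_ramp (a K : R) : 0 <= K ->
  lipschitz01 (fun x => Num.min 1 (Num.max 0 (K * (x - a)))).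
Proof.
move=> K0; split=> [x|].
  set u := K * _.
  by case: (leP 0 u) => u0; [case: (leP 1 u) => u1|case: (leP (1 : R) 0) => u1]; lra.
exists K => // x y.
have : K * (x - y) <= K * `|x - y| by rewrite ler_wpM2l// ler_norm.
have : - (K * (x - y)) <= K * `|x - y|.
  by rewrite -mulrN ler_wpM2l// opprB distrC ler_norm.
rewrite (_ : K * (x - y) = K * (x - a) - K * (y - a)); last by ring.
have : 0 <= K * `|x - y| by rewrite mulr_ge0.
set u := K * (x - a); set v := K * (y - a); set w := K * `|_|.
rewrite ler_norml; case: (leP 0 u) => u0; [case: (leP 1 u) => u1|case: (leP (1 : R) 0) => u1];
  (case: (leP 0 v) => v0; [case: (leP 1 v) => v1|rewrite ?(@min_r _ _ 1 0)//]); lra.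
Qed.

Section one_measure.
Variable m : {measure set T -> \bar R}.
Hypothesis fin : (m setT < +oo)%E.

Definition L1_err (B : set R) (h : R -> R) : \bar R := \int[m]_x (`|\1_B x - h x|)%:E.

Definition approximable (B : set R) := measurable (B : set T) /\
  forall e : R, 0 < e -> exists2 h, lipschitz01 h & (L1_err B h <= e%:E)%E.

Lemma measurable_L1_err (B : set T) h : measurable B -> lipschitz01 h ->
  measurable_fun [set: T] (fun x => (`|\1_B x - h x|)%:E).
Proof.
move=> mB lh; apply/measurable_EFinP; apply: measurableT_comp.
  exact: normr_measurable.
apply: measurable_funB; first exact: measurable_indic.
exact: lipschitz01_measurable.
Qed.

Lemma approximableC B : approximable B -> approximable (~` B).
Proof.
move=> [mB hB]; split; first exact: measurableC.
move=> e e0; have [h lh he] := hB e e0; exists (fun x => 1 - h x).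
  exact: lipschitz01_onem.
rewrite (le_trans _ he)// /L1_err le_eqVlt; apply/orP; left; apply/eqP.
apply: eq_integral => x _; congr EFin; rewrite !indicE in_setC -normrN; congr `|_|.
by case: (x \in B) => /=; ring.
Qed.

Lemma approximableU A B : approximable A -> approximable B -> approximable (A `|` B).
Proof.
move=> [mA hA] [mB hB]; split; first exact: measurableU.
move=> e e0; have e2 : 0 < e / 2 by rewrite divr_gt0.
have [h lh he] := hA _ e2; have [k lk ke] := hB _ e2.
have lhk := lipschitz01_max lh lk.
exists (fun x => Num.max (h x) (k x)) => //.
have -> : e%:E = ((e / 2)%:E + (e / 2)%:E)%E by rewrite -EFinD -splitr.
apply: le_trans (leeD he ke); rewrite /L1_err -ge0_integralD//; last 2 first.
- exact: measurable_L1_err.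
- exact: measurable_L1_err.
apply: ge0_le_integral => //.
- by apply: measurable_L1_err => //; exact: measurableU.
- by apply: emeasurable_funD; exact: measurable_L1_err.
- move=> x _; rewrite -EFinD lee_fin !indicE in_setU.
  have /andP[h0 h1] := lh.1 x; have /andP[k0 k1] := lk.1 x.
  have hk : forall u v w : R, `|u| <= v + w -> `|u| <= v + w by [].
  case: (x \in A) => /=; case: (x \in B) => /=; case: (leP (h x) (k x)) => hk';
    rewrite ?sub0r ?normrN; rewrite ?(ger0_norm h0) ?(ger0_norm k0) ?(@ger0_norm _ (1 - _)) ?subr_ge0//; lra.
Qed.

(* the error on B \ A is at most 1 *)
Lemma L1_err_sub (A B : set T) h : measurable A -> measurable B -> A `<=` B ->
  lipschitz01 h -> (L1_err B h <= m (B `\` A) + L1_err A h)%E.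
Proof.
move=> mA mB AB lh; have mBA : measurable (B `\` A) by exact: measurableD.
have -> : m (B `\` A) = (\int[m]_x (\1_(B `\` A) x)%:E)%E by rewrite integral_indic// setIT.
rewrite /L1_err -ge0_integralD//; last 2 first.
- by apply/measurable_EFinP; exact: measurable_indic.
- exact: measurable_L1_err.
apply: ge0_le_integral => //.
- exact: measurable_L1_err.
- apply: emeasurable_funD; last exact: measurable_L1_err.
  by apply/measurable_EFinP; exact: measurable_indic.
- move=> x _; rewrite -EFinD lee_fin !indicE in_setD.
  case xA : (x \in A); case xB : (x \in B) => //=; rewrite ?add0r//.
    have : x \in B by apply/mem_set/AB/set_mem; rewrite xA.
    by rewrite xB.
  have /andP[h0 h1] := lh.1 x; rewrite normrN ger0_norm ?subr_ge0// ger0_norm//; lra.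
Qed.

Lemma approximable_cvg (F : (set T)^nat) : (forall n, measurable (F n)) ->
  nondecreasing_seq F ->
  (forall n (e : R), 0 < e -> exists2 h, lipschitz01 h &
     (L1_err (\bigcup_n F n) h <= m ((\bigcup_n F n) `\` F n) + e%:E)%E) ->
  approximable (\bigcup_n F n).
Proof.
move=> mF ndF hF; have mU : measurable (\bigcup_n F n) by exact: bigcupT_measurable.
split=> // e e0; have e2 : 0 < e / 2 by rewrite divr_gt0.
have finA (A : set T) : measurable A -> (m A < +oo)%E.
  by move=> mA; rewrite (le_lt_trans _ fin)// le_measure ?inE.
have finN (A : set T) : measurable A -> m A \is a fin_num.
  by move=> mA; rewrite ge0_fin_numE ?finA.
have : m \o F @ \oo --> (fine (m (\bigcup_n F n)))%:E.
  by rewrite fineK ?finN//; exact: nondecreasing_cvg_mu.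
move=> /fine_cvgP[_] /cvgrPdist_le /(_ (e / 2) e2)[n _ hn].
have {}hn := hn n (leqnn n).
have [h lh he] := hF n (e / 2) e2; exists h => //; rewrite (le_trans he)//.
have -> : e%:E = ((e / 2)%:E + (e / 2)%:E)%E by rewrite -EFinD -splitr.
rewrite leeD2r// measureD// ?finA//.
have -> : (\bigcup_n F n) `&` F n = F n by apply/setIidPr; exact: bigcup_sup.
by have := le_trans (ler_norm _) hn; rewrite -lee_fin EFinB !fineK ?finN.
Qed.

Lemma approximable_bigcup (F : (set T)^nat) : (forall n, approximable (F n)) ->
  approximable (\bigcup_n F n).
Proof.
move=> aF; pose G n := \big[setU/set0]_(i < n.+1) F i.
have aG n : approximable (G n).
  elim: n => [|n ih]; first by rewrite /G big_ord1; exact: aF.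
  by rewrite /G big_ord_recr/=; exact: approximableU.
rewrite -bigcup_bigsetU_bigcup; apply: approximable_cvg.
- by move=> n; exact: (aG n).1.
- by move=> i j ij; apply/subsetPset; apply: subset_bigsetU; exact: ij.
move=> n e e0; have [h lh he] := (aG n).2 e e0; exists h => //.
apply: (@le_trans _ _ (m (\bigcup_n G n `\` G n) + L1_err (G n) h)%E); last exact: leeD2l.
apply: L1_err_sub => //; first exact: (aG n).1.
  by apply: bigcupT_measurable => k; exact: (aG k).1.
exact: bigcup_sup.
Qed.

Lemma approximable_ray (a : R) : approximable `]a, +oo[.
Proof.
pose F n : set T := `]a + n.+1%:R^-1, +oo[%classic.
have FE n x : F n x = (a + n.+1%:R^-1 < x) by rewrite /F /= in_itv/= andbT.
have UF : `]a, +oo[%classic = \bigcup_n F n.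
  apply/seteqP; split => x /=.
    rewrite in_itv/= andbT => /ltr_add_invr[k hk]; exists k => //; by rewrite FE.
  move=> [n _]; rewrite FE in_itv/= andbT; apply: lt_trans.
  by rewrite ltrDl invr_gt0 ltr0n.
rewrite UF; apply: approximable_cvg.
- by move=> n; exact: measurable_itv.
- move=> i j ij; apply/subsetPset => x; rewrite !FE; apply: le_lt_trans.
  by rewrite lerD2l lef_pV2 ?posrE ?ltr0n// ler_nat ltnS.
move=> n e e0; rewrite -UF; set U : set T := `]a, +oo[%classic.
have lh := lipschitz01_ramp a (ler0n R n.+1); set h := (fun x => _) in lh; exists h => //.
have mU : measurable U by exact: measurable_itv.
have mUF : measurable (U `\` F n) by apply: measurableD => //; exact: measurable_itv.
rewrite -[leLHS]adde0; apply: leeD; last by rewrite lee_fin ltW.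
have -> : m (U `\` F n) = (\int[m]_x (\1_(U `\` F n) x)%:E)%E by rewrite integral_indic// setIT.
apply: ge0_le_integral => //.
- exact: measurable_L1_err.
- by apply/measurable_EFinP; exact: measurable_indic.
- move=> x _; rewrite lee_fin !indicE in_setD.
  have xU : (x \in U) = (a < x) by apply/idP/idP; rewrite inE /U /= in_itv/= andbT.
  have xF : (x \in F n) = (a + n.+1%:R^-1 < x) by apply/idP/idP; rewrite inE FE.
  have n0 : (0 : R) < n.+1%:R by rewrite ltr0n.
  have /andP[h0 h1] := lh.1 x; rewrite xU xF.
  have [ax|xa] := ltP a x => /=; last first.
    rewrite /h (max_l (_ : _ <= 0)); last by rewrite pmulr_rle0// subr_le0.
    by rewrite (min_r ler01) subrr normr0.
  rewrite ger0_norm ?subr_ge0//; case: ltP => xn /=; last by lra.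
  suff -> : h x = 1 by rewrite subrr.
  have k1 : 1 <= n.+1%:R * (x - a).
    by rewrite -ler_pdivrMl// mulr1 lerBrDl ltW.
  by rewrite /h (max_r (le_trans ler01 k1)) (min_l k1).
Qed.

(** The sets that admit such approximations form a sigma-algebra, which
    contains the half-lines. *)
Lemma borel_approximable (B : set T) : measurable B -> approximable B.
Proof.
have : sigma_algebra setT approximable.
  split.
  - split=> // e e0; exists (fun _ => 0).
      by split=> [x|]; [rewrite lexx ler01|exists 0 => // x y; rewrite subrr normr0 mul0r].
    rewrite /L1_err integral0_eq ?lee_fin ?ltW// => x _.
    by rewrite indic0 subrr normr0.
  - by move=> A; rewrite setTD; exact: approximableC.
  - exact: approximable_bigcup.
move=> sA; have := @RGenOInfty.measurableE R; rewrite /measurable/= => ->.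
apply: smallest_sub => // _ [a ->]; exact: approximable_ray.
Qed.

End one_measure.
End lipschitz_approximation.


(** * Total variation *)

Section total_variation.
Context {R : realType}.
Local Notation T := (measurableTypeR R).

Lemma indic_L1_dist (m : probability T R) (B : set T) h : measurable B -> lipschitz01 h ->
  `|fine (m B) - \int[m]_x h x| <= fine (L1_err m B h).
Proof.
move=> mB lh; have mh := lipschitz01_measurable lh.
have i1 : m.-integrable setT (EFin \o (fun _ : R => 1 : R)).
  by apply: finite_measure_integrable_cst.
have ih : m.-integrable setT (EFin \o h).
  apply: (le_integrable measurableT _ _ i1); first exact/measurable_EFinP.
  by move=> x _ /=; rewrite lee_fin normr1 ger0_norm; have /andP[] := lh.1 x.
have iB : m.-integrable setT (EFin \o (\1_B : R -> R)).
  apply: (le_integrable measurableT _ _ i1).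
    by apply/measurable_EFinP; exact: measurable_indic.
  by move=> x _ /=; rewrite lee_fin normr1 indicE; case: (x \in B); rewrite ?normr1 ?normr0.
have -> : fine (m B) = \int[m]_x (\1_B x : R) by rewrite /Rintegral integral_indic// setIT.
rewrite -RintegralB//; apply: le_normr_Rintegral => //.
by have := integrableB measurableT iB ih.
Qed.

Lemma total_variation_le (m1 m2 : probability T R) (b : R) :
  (forall h, lipschitz01 h -> `|\int[m1]_x h x - \int[m2]_x h x| <= b) ->
  forall B : set T, measurable B -> (`|m1 B - m2 B| <= b%:E)%E.
Proof.
move=> hb B mB; pose rho := measure_add m1 m2.
have fin : (rho setT < +oo)%E.
  rewrite /rho measure_addE; apply: lte_add_pinfty.
    by rewrite (le_lt_trans (probability_le1 m1 _))// ltry.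
  by rewrite (le_lt_trans (probability_le1 m2 _))// ltry.
have finB (m : probability T R) : m B \is a fin_num by exact: fin_num_measure.
rewrite -(fineK (finB m1)) -(fineK (finB m2)) -EFinB/= lee_fin.
apply/ler_addgt0Pr => e e0.
have [h lh he] := (borel_approximable fin mB).2 e e0.
have err0 (m : probability T R) : (0 <= L1_err m B h)%E by apply: integral_ge0 => x _; rewrite lee_fin.
have mm := measurable_L1_err mB lh.
have eE : (L1_err rho B h = L1_err m1 B h + L1_err m2 B h)%E.
  by rewrite /L1_err ge0_integral_measure_add.
rewrite eE in he.
have f1 : L1_err m1 B h \is a fin_num.
  by rewrite ge0_fin_numE// (le_lt_trans (leeDl _ (err0 m2)))// (le_lt_trans he)// ltry.
have f2 : L1_err m2 B h \is a fin_num.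
  by rewrite ge0_fin_numE// (le_lt_trans (leeDr _ (err0 m1)))// (le_lt_trans he)// ltry.
move: he; rewrite -(fineK f1) -(fineK f2) -EFinD lee_fin => he.
have d1 := indic_L1_dist m1 mB lh; have d2 := indic_L1_dist m2 mB lh; have d3 := hb h lh.
move: d1 d2 d3; set x1 := fine (m1 B); set x2 := fine (m2 B).
set y1 := \int[m1]_x h x; set y2 := \int[m2]_x h x => d1 d2 d3.
rewrite (_ : x1 - x2 = (x1 - y1) - (x2 - y2) + (y1 - y2)); last by ring.
rewrite (le_trans (ler_normD _ _))// (le_trans (lerD (ler_normB _ _) (lexx _)))//; lra.
Qed.

End total_variation.

Unset Implicit Arguments.

(* The right-hand side is a quotient in \bar R, where 8 / 0 = +oo. *)
Theorem theorem3p8 (R : realType) (d : measure_display)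
    (Omega : measurableType d) (P : probability Omega R) (n : nat)
    (xi : Omega -> 'rV[R]_n) (K0 : {vspace 'rV[R]_n}) (K : set 'rV[R]_n)
    (mu : 'rV[R]_n) :
  standard_gaussian P xi ->
  [set` K0] `<=` K ->
  closed_convex_cone K ->
  mu \in K0 ->
  let m0 := lrt_mean P xi [set` K0] K 0 in
  let s0 := lrt_sd P xi [set` K0] K 0 in
  let Z := fun w : Omega => (lrt [set` K0] K (mu + xi w) - m0) / s0 in
  (dTV (pushforward P Z) (normal_prob 0%R 1%R) <=
   8%:E / (Num.sqrt (stat_dim P xi K - stat_dim P xi [set` K0]))%:E)%E.
Proof.
move=> gxi K0K cK muK.
have cK0 := vspace_closed_convex_cone K0; have z0 : [set` K0] 0 by exact: mem0v.
have zK := K0K _ z0.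
have cC := cone_part_ccc K0 cK; have zC := cone_part0 K0K.
pose Pi := metric_proj (cone_part K0 K); pose F := projsq Pi.
have Pl := proj_lip cC zC.
have tF : tame F := tame_projsq Pl.
have lrtF x : x \in K0 -> (fun w => lrt [set` K0] K (x + xi w)) = (fun w => F (xi w)).
  by move=> xK; apply/funext => w; rewrite (lrt_shift K0K cK _ xK) (lrtE K0K cK).
have tsq C : closed_convex_cone C -> C 0 -> tame (fun x : 'rV[R]_n => enorm (metric_proj C x) ^+ 2).
  move=> cC' C0; apply: tameX; apply: tame_enormv; apply: (@tamev_lip _ _ _ _ 1) => x y.
  by rewrite mul1r; exact: proj_lip.
have EE g : tame g -> fine ('E_P[(fun w => g (xi w))])%E = gE P xi g.
  by move=> tg; rewrite unlock.
pose delta := gE P xi F.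
pose var := gE P xi (fun x => F x ^+ 2) - delta ^+ 2.
have -> : stat_dim P xi K - stat_dim P xi [set` K0] = delta.
  rewrite /stat_dim !(EE _ (tsq _ _ _))// -(gEB gxi)//; try exact: tsq.
  by apply: gE_eq => x; exact: projsqB.
pose m0 := lrt_mean P xi [set` K0] K 0; pose s0 := lrt_sd P xi [set` K0] K 0.
pose Z w := (lrt [set` K0] K (mu + xi w) - m0) / s0.
suff : (dTV (pushforward P Z) (normal_prob 0%R 1%R) <= 8%:E / (Num.sqrt delta)%:E)%E by [].
have m0E : m0 = delta by rewrite /m0 /lrt_mean lrtF ?mem0v//; exact: EE.
have s0E : s0 = Num.sqrt var.
  rewrite /s0 /lrt_sd lrtF ?mem0v//; congr Num.sqrt.
  rewrite /variance unlock /= (EE F tF) -/delta.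
  transitivity (fine 'E_P[(fun w => (F (xi w) - delta) * (F (xi w) - delta))%R])%E => //.
  have tFd : tame (fun x => F x - delta) by apply: tameB => //; exact: tame_cst.
  rewrite (EE (fun x => (F x - delta) * (F x - delta)) (tameM tFd tFd)).
  have t2 := tameX 2 tF; have t1 := tameZ (2 * delta) tF.
  transitivity (gE P xi (fun x => F x ^+ 2 - 2 * delta * F x + delta ^+ 2)).
    by apply: gE_eq => x; ring.
  rewrite (gED gxi (tameB t2 t1) (@tame_cst _ _ (delta ^+ 2))).
  by rewrite (gEB gxi t2 t1) (gEZ gxi _ tF) (gE_cst P xi) -/delta /var; ring.
have ZE : Z = fun w => (F (xi w) - delta) / Num.sqrt var.
  by apply/funext => w; rewrite /Z m0E s0E; congr ((_ - _) / _); exact: (congr1 (fun f => f w) (lrtF _ muK)).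
have tZ : tame (fun x => (F x - delta) / Num.sqrt var).
  by apply: tameM; [apply: tameB => //; exact: tame_cst|exact: tame_cst].
have mZ : measurable_fun [set: Omega] (Z : Omega -> measurableTypeR R).
  rewrite ZE; exact: (measurable_tame gxi.1 tZ).
have d0 : 0 <= delta by apply: gE_ge0 => x; exact: dot_ge0.
move: d0; rewrite le_eqVlt => /predU1P[d0|d0].
  by rewrite -d0 sqrtr0 inve0 mulry gtr0_sg// mul1e leey.
have r0 : 0 < Num.sqrt delta by rewrite sqrtr_gt0.
rewrite inver gt_eqF// -EFinM.
pose X : {mfun Omega >-> measurableTypeR R} := @mfun_Sub _ _ Omega (measurableTypeR R) Z (mem_set mZ).
apply: ge_ereal_sup => _ [B mB <-].
apply: (@total_variation_le R (distribution P X) (normal_prob 0 1)) mB => h lh.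
have mh := lipschitz01_measurable lh.
have [h01 [M M0 hM]] := lh.
have -> : \int[distribution P X]_x h x = gE P xi (fun x => h ((F x - delta) / Num.sqrt var)).
  rewrite /gE /Rintegral; congr fine.
  rewrite ge0_integral_distribution//; last 2 first.
  - exact/measurable_EFinP.
  - by move=> x; rewrite lee_fin; have /andP[] := h01 x.
  by apply: eq_integral => w _; rewrite /= ZE.
apply: (stein_bound _ _ _ _ gxi h01 M0 hM d0).
- exact: dot_projE.
- exact: dot_proj_ge.
- exact: Pl.
- exact: projsq_taylor.
Qed.
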